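(* Let $m$ be a positive integer and $0<x<\pi$. Then $$\sum_{n=1}^\infty\frac{\sin(2n-1)x}{(2n-1)^{2m}}=\frac{(-1)^m\pi^{2m-1}}{2(2m-1)!}\bigg(2^{2m}\zeta'\Big(1-2m,1-\frac x{2\pi}\Big)-2^{2m}\zeta'\Big(1-2m,\frac x{2\pi}\Big)-\zeta'\Big(1-2m,1-\frac x{\pi}\Big)+\zeta'\Big(1-2m,\frac x{\pi}\Big)\bigg).$$
   Context: For $0<a\le 1$, $\zeta(s,a)$ denotes the Hurwitz zeta function, defined for $\Re s>1$ by $\zeta(s,a)=\sum_{k=0}^\infty (k+a)^{-s}$ and extended by analytic continuation to all complex $s\neq 1$. Throughout, $\zeta'(s,a)$ denotes the partial derivative $\frac{\partial}{\partial s}\zeta(s,a)$ with respect to the first variable $s$. *)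

(* Defs.v *)
From Stdlib Require Import Reals ClassicalEpsilon.
From Coquelicot Require Import Coquelicot.
Open Scope R_scope.

(* x^(-s) for real x > 0 and complex s, via the principal branch:
   x^(-s) = exp(-s ln x) = e^{-Re s ln x} (cos(Im s ln x) - i sin(Im s ln x)). *)
Definition cpow_neg (x : R) (s : C) : C :=
  (exp (- Re s * ln x) * cos (Im s * ln x),
   - (exp (- Re s * ln x) * sin (Im s * ln x)))%R.

(* Z is the analytic continuation of the Hurwitz series sum_k (k+a)^(-s):
   Z is complex-differentiable (holomorphic) at every s <> 1, and agrees with
   the (convergent) series on Re s > 1.  By the identity theorem such Z is unique
   on C \ {1}. *)
Definition is_hurwitz_zeta (a : R) (Z : C -> C) : Prop :=
  (forall s : C, s <> RtoC 1 -> ex_derive (K := C_AbsRing) (V := C_NormedModule) Z s) /\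
  (forall s : C, 1 < Re s ->
     is_series (K := C_AbsRing) (V := C_NormedModule)
       (fun k : nat => cpow_neg (INR k + a) s) (Z s)).

(* The Hurwitz zeta function zeta(s,a) (chosen by Hilbert's epsilon among the
   continuations above; well-defined since the continuation exists and is unique). *)
Definition hurwitz_zeta (a : R) : C -> C :=
  epsilon (inhabits (fun _ : C => RtoC 0)) (is_hurwitz_zeta a).

Definition hurwitz_zeta' (s : C) (a : R) : C :=
  epsilon (inhabits (RtoC 0))
    (fun l : C => is_derive (K := C_AbsRing) (V := C_NormedModule) (hurwitz_zeta a) s l).

(* Main.v *)
Require Import Defs.
From Stdlib Require Import Reals Factorial Lra Lia Psatz ClassicalEpsilon.
From Coquelicot Require Import Coquelicot.
Open Scope R_scope.

(** Euler-Maclaurin summation continues the Hurwitz series: for [p > 2 - Re s],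
    [zeta(s,a) = lim_K (sum_{k<K} (k+a)^(-s) - sum_{j<=p} (B_j/j!) d^j/dx^j (x^(1-s)/(1-s)) at x = K+a)],
    and this may be differentiated in [s].  The identity theorem (Goursat's lemma on the strip
    [z0 + c e^(2 pi w)] shows that the Fourier coefficients on a circle do not depend on its radius)
    identifies every other continuation with this one near [1 - 2m].

    Let [D(a) = zeta'(1-2m,a)].  By periodicity of the sine, the coefficient
    [int_0^1 D(a) sin(2 pi n a) da] becomes an integral of [x^(2m-1) ln x sin(2 pi n x)] over [0,K]
    up to Euler-Maclaurin corrections.  After [2m] integrations by parts the boundary terms are
    Euler-Maclaurin remainders, which vanish in the limit, and what is left is
    [- (-1)^m (2m-1)! (2 pi n)^(-2m)] times the Dirichlet integral [pi/2].  Hence the Fourier series of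
    [D(1-a) - D(a)] is a multiple of [sum_n sin(2 pi n a) / n^(2m)], and the odd terms are isolated by
    combining the cases [a = x/(2 pi)] and [a = x/pi]. *)

(** * Fourier series at a point of differentiability *)

Lemma ex_RInt_cont (f : R -> R) (a b : R) :
  a <= b -> (forall x, a <= x <= b -> continuous f x) -> ex_RInt f a b.
Proof.
  intros Hab Hf. apply (ex_RInt_continuous (V := R_CompleteNormedModule)).
  intros z Hz. rewrite Rmin_left, Rmax_right in Hz by lra. auto.
Qed.

Lemma RInt_antiderivative (F f : R -> R) (a b : R) :
  (forall x, is_derive F x (f x)) -> (forall x, continuous f x) ->
  RInt f a b = F b - F a.
Proof.
  intros HF Hf. apply (is_RInt_unique (V := R_CompleteNormedModule)).
  apply (is_RInt_derive (V := R_CompleteNormedModule) F f); auto.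
Qed.

Lemma continuous_of_derivable (f : R -> R) (x : R) : ex_derive f x -> continuous f x.
Proof. apply (ex_derive_continuous (K := R_AbsRing) (V := R_NormedModule)). Qed.

Ltac by_derive := intros; apply continuous_of_derivable; auto_derive; auto.

Lemma sin_add_multiple_2PI (x : R) (k : nat) : sin (x + 2 * PI * INR k) = sin x.
Proof. rewrite <- (sin_period x k). f_equal; ring. Qed.

Lemma RInt_cos_period (al t0 : R) (k : nat) : (0 < k)%nat ->
  RInt (fun t => cos (2 * PI * INR k * (t - t0))) al (al + 1) = 0.
Proof.
  intros Hk. assert (Hk' : 0 < INR k) by (apply lt_0_INR; lia).
  pose proof PI_RGT_0.
  rewrite (RInt_antiderivative (fun t => sin (2 * PI * INR k * (t - t0)) / (2 * PI * INR k))).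
  - replace (2 * PI * INR k * (al + 1 - t0)) with
      (2 * PI * INR k * (al - t0) + 2 * PI * INR k) by ring.
    rewrite sin_add_multiple_2PI. lra.
  - intros x. auto_derive; auto. unfold Rminus. field. split; lra.
  - by_derive.
Qed.

Definition dsin (t0 : R) (N : nat) (t : R) : R := sin ((2 * INR N + 1) * PI * (t - t0)).

Lemma continuous_dsin (t0 : R) (N : nat) (t : R) : continuous (dsin t0 N) t.
Proof. unfold dsin. by_derive. Qed.

Lemma dsin_mult (t0 : R) (N M : nat) (t : R) : (N <= M)%nat ->
  dsin t0 N t * dsin t0 M t =
  / 2 * (cos (2 * PI * INR (M - N) * (t - t0)) - cos (2 * PI * INR (N + M + 1) * (t - t0))).
Proof.
  intros H. unfold dsin. rewrite minus_INR by auto. rewrite !plus_INR. simpl INR.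
  set (u := t - t0).
  replace (2 * PI * (INR M - INR N) * u) with ((2 * INR M + 1) * PI * u - (2 * INR N + 1) * PI * u) by ring.
  replace (2 * PI * (INR N + INR M + 1) * u) with ((2 * INR M + 1) * PI * u + (2 * INR N + 1) * PI * u) by ring.
  rewrite cos_plus, cos_minus. lra.
Qed.

Lemma dsin_ortho_aux (al t0 : R) (N M : nat) : (N <= M)%nat ->
  RInt (fun t => dsin t0 N t * dsin t0 M t) al (al + 1) = if Nat.eqb N M then / 2 else 0.
Proof.
  intros H.
  rewrite (RInt_ext (V := R_CompleteNormedModule) _
    (fun t => scal (/ 2) (minus (cos (2 * PI * INR (M - N) * (t - t0)))
        (cos (2 * PI * INR (N + M + 1) * (t - t0)))))).
  2: { intros x _. rewrite (dsin_mult t0 N M x H). reflexivity. }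
  assert (E : forall k, ex_RInt (fun t => cos (2 * PI * INR k * (t - t0))) al (al + 1)).
  { intros k. apply ex_RInt_cont; [lra|]. by_derive. }
  rewrite (RInt_scal (V := R_CompleteNormedModule)).
  2: { apply (ex_RInt_minus (V := R_NormedModule)); apply E. }
  rewrite (RInt_minus (V := R_CompleteNormedModule)) by apply E.
  rewrite (RInt_cos_period al t0 (N + M + 1)) by lia.
  destruct (Nat.eqb_spec N M) as [->|Hne].
  - rewrite Nat.sub_diag.
    rewrite (RInt_ext (V := R_CompleteNormedModule) _ (fun _ => 1)).
    2: { intros x _. simpl. rewrite Rmult_0_r, Rmult_0_l, cos_0; reflexivity. }
    rewrite (RInt_const (V := R_CompleteNormedModule)).
    unfold minus, plus, opp, scal; simpl; unfold mult; simpl. lra.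
  - rewrite RInt_cos_period by lia.
    unfold minus, plus, opp, scal; simpl; unfold mult; simpl. lra.
Qed.

Lemma dsin_ortho (al t0 : R) (N M : nat) :
  RInt (fun t => dsin t0 N t * dsin t0 M t) al (al + 1) = if Nat.eqb N M then / 2 else 0.
Proof.
  destruct (Nat.le_gt_cases N M) as [H|H].
  - now apply dsin_ortho_aux.
  - rewrite (RInt_ext (V := R_CompleteNormedModule) _ (fun t => dsin t0 M t * dsin t0 N t)).
    2: { intros; apply Rmult_comm. }
    rewrite dsin_ortho_aux by lia. now rewrite Nat.eqb_sym.
Qed.

Lemma continuous_Rmult (f g : R -> R) (x : R) :
  continuous f x -> continuous g x -> continuous (fun t => f t * g t) x.
Proof. intros Hf Hg. apply (continuous_mult (K := R_AbsRing) f g); auto. Qed.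

Lemma continuous_Rminus (f g : R -> R) (x : R) :
  continuous f x -> continuous g x -> continuous (fun t => f t - g t) x.
Proof. intros Hf Hg. apply (continuous_minus (V := R_NormedModule) f g); auto. Qed.

Lemma continuous_Rplus (f g : R -> R) (x : R) :
  continuous f x -> continuous g x -> continuous (fun t => f t + g t) x.
Proof. intros Hf Hg. apply (continuous_plus (V := R_NormedModule) f g); auto. Qed.

Lemma continuous_Rconst (c x : R) : continuous (fun _ : R => c) x.
Proof. apply continuous_const. Qed.

Ltac cont :=
  match goal with
  | |- continuous (fun t => _ - _) _ => apply continuous_Rminus; cont
  | |- continuous (fun t => _ + _) _ => apply continuous_Rplus; cont
  | |- continuous (fun t => _ * _) _ => apply continuous_Rmult; cont
  | |- continuous (fun t => ?c) _ => apply continuous_Rconst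
  | _ => idtac
  end.

Lemma RInt_Rplus (f g : R -> R) (a b : R) : a <= b ->
  (forall x, a <= x <= b -> continuous f x) -> (forall x, a <= x <= b -> continuous g x) ->
  RInt (fun t => f t + g t) a b = RInt f a b + RInt g a b.
Proof.
  intros H Hf Hg. apply (RInt_plus (V := R_CompleteNormedModule)); apply ex_RInt_cont; auto.
Qed.

Lemma RInt_Rminus (f g : R -> R) (a b : R) : a <= b ->
  (forall x, a <= x <= b -> continuous f x) -> (forall x, a <= x <= b -> continuous g x) ->
  RInt (fun t => f t - g t) a b = RInt f a b - RInt g a b.
Proof.
  intros H Hf Hg. apply (RInt_minus (V := R_CompleteNormedModule)); apply ex_RInt_cont; auto.
Qed.

Lemma RInt_Rconst (c a b : R) : RInt (fun _ => c) a b = (b - a) * c.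
Proof. apply (RInt_const (V := R_CompleteNormedModule)). Qed.

Lemma RInt_Rscal (c : R) (f : R -> R) (a b : R) : a <= b ->
  (forall x, a <= x <= b -> continuous f x) ->
  RInt (fun t => c * f t) a b = c * RInt f a b.
Proof.
  intros H Hf. apply (RInt_scal (V := R_CompleteNormedModule)); apply ex_RInt_cont; auto.
Qed.

Lemma RInt_ext_le (f g : R -> R) (a b : R) : a <= b ->
  (forall x, a < x < b -> f x = g x) -> RInt f a b = RInt g a b.
Proof.
  intros H Hx. apply (RInt_ext (V := R_CompleteNormedModule)).
  rewrite Rmin_left, Rmax_right by lra. exact Hx.
Qed.

Section Bessel.
Variables (al t0 : R) (H : R -> R).
Hypothesis HH : forall t, al <= t <= al + 1 -> continuous H t.

Let a (k : nat) := RInt (fun t => H t * dsin t0 k t) al (al + 1).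

Fixpoint bessel_sum (N : nat) (t : R) : R :=
  match N with
  | O => 0
  | S n => bessel_sum n t + a n * dsin t0 n t
  end.

Lemma continuous_bessel_sum (N : nat) (t : R) : continuous (bessel_sum N) t.
Proof.
  induction N as [|N IH]; simpl.
  - apply continuous_Rconst.
  - apply continuous_Rplus; [exact IH|].
    apply continuous_Rmult; [apply continuous_Rconst|apply continuous_dsin].
Qed.

Lemma bessel_sum_ortho (N M : nat) : (N <= M)%nat ->
  RInt (fun t => bessel_sum N t * dsin t0 M t) al (al + 1) = 0.
Proof.
  induction N as [|N IH]; intros HN; simpl.
  - rewrite (RInt_ext_le _ (fun t => 0)) by (intros; lra || ring).
    rewrite (RInt_const (V := R_CompleteNormedModule)). apply Rmult_0_r.
  - rewrite (RInt_ext_le _ (fun t => bessel_sum N t * dsin t0 M t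
      + a N * (dsin t0 N t * dsin t0 M t))) by (intros; lra || ring).
    pose proof continuous_dsin. pose proof continuous_bessel_sum.
    assert (forall x, continuous (fun t => dsin t0 N t * dsin t0 M t) x)
      by (intros; apply continuous_Rmult; auto).
    rewrite RInt_Rplus; [|lra| |].
    + rewrite IH by lia. rewrite RInt_Rscal by (auto; lra). rewrite dsin_ortho.
      destruct (Nat.eqb_spec N M); [lia|ring].
    + intros; apply continuous_Rmult; auto.
    + intros; apply continuous_Rmult; auto using continuous_Rconst.
Qed.

Let e (N : nat) := RInt (fun t => (H t - 2 * bessel_sum N t) * (H t - 2 * bessel_sum N t)) al (al + 1).

Lemma bessel_step (M : nat) : e M - 2 * (a M * a M) = e (S M).
Proof.
  unfold e. pose proof continuous_dsin. pose proof continuous_bessel_sum.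
  simpl bessel_sum.
    rewrite (RInt_ext_le (fun t => (H t - 2 * (bessel_sum M t + a M * dsin t0 M t)) * _)
      (fun t => (H t - 2 * bessel_sum M t) * (H t - 2 * bessel_sum M t)
       + ((-4 * a M) * (H t * dsin t0 M t) + ((8 * a M) * (bessel_sum M t * dsin t0 M t)
         + (4 * (a M * a M)) * (dsin t0 M t * dsin t0 M t)))))
      by (intros; lra || ring).
    assert (forall x, al <= x <= al + 1 -> continuous (fun t => H t * dsin t0 M t) x)
      by (intros; apply continuous_Rmult; auto).
    assert (forall x, al <= x <= al + 1 -> continuous (fun t => bessel_sum M t * dsin t0 M t) x)
      by (intros; apply continuous_Rmult; auto).
    assert (forall x, al <= x <= al + 1 -> continuous (fun t => dsin t0 M t * dsin t0 M t) x)
      by (intros; apply continuous_Rmult; auto).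
    assert (forall x, al <= x <= al + 1 -> continuous (fun t => H t - 2 * bessel_sum M t) x)
      by (intros; apply continuous_Rminus; auto; apply continuous_Rmult; auto using continuous_Rconst).
    rewrite RInt_Rplus; [|lra|intros; apply continuous_Rmult; auto|
      intros; repeat (apply continuous_Rplus); apply continuous_Rmult; auto using continuous_Rconst].
    rewrite RInt_Rplus; [|lra|intros; apply continuous_Rmult; auto using continuous_Rconst|
      intros; repeat (apply continuous_Rplus); apply continuous_Rmult; auto using continuous_Rconst].
    rewrite RInt_Rplus; [|lra|intros; apply continuous_Rmult; auto using continuous_Rconst|
      intros; repeat (apply continuous_Rplus); apply continuous_Rmult; auto using continuous_Rconst].
    rewrite !RInt_Rscal by (auto; lra).
    rewrite dsin_ortho, bessel_sum_ortho, Nat.eqb_refl by lia. fold (a M). lra.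
Qed.

Lemma bessel_coef_lim : is_lim_seq a 0.
Proof.
  assert (He : forall N, 0 <= e N).
  { intros N. apply RInt_ge_0; [lra| |intros; apply Rle_0_sqr].
    apply ex_RInt_cont; [lra|]. intros.
    assert (continuous (fun t => H t - 2 * bessel_sum N t) x)
      by (apply continuous_Rminus; auto; apply continuous_Rmult;
        auto using continuous_Rconst, continuous_bessel_sum).
    apply continuous_Rmult; auto. }
  destruct (ex_finite_lim_seq_decr e 0) as [l Hl]; auto.
  { intros n. rewrite <- bessel_step. pose proof (Rle_0_sqr (a n)). unfold Rsqr in *. lra. }
  assert (Hd : is_lim_seq (fun n => / 2 * (e n - e (S n))) 0).
  { replace (Finite 0) with (Rbar_mult (/ 2) (l - l)) by (simpl; f_equal; ring).
    apply is_lim_seq_scal_l. apply is_lim_seq_minus'; auto. now apply is_lim_seq_incr_1 in Hl. }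
  apply is_lim_seq_abs_0.
  apply is_lim_seq_ext with (fun n => sqrt (/ 2 * (e n - e (S n)))).
  { intros n. rewrite <- bessel_step. rewrite <- sqrt_Rsqr_abs. f_equal. unfold Rsqr. field. }
  rewrite <- sqrt_0. apply is_lim_seq_continuous; auto. apply continuity_pt_sqrt. lra.
Qed.

End Bessel.

Definition slope (f : R -> R) (t0 l t : R) : R :=
  if Req_dec_T t t0 then l else (f t - f t0) / (t - t0).

Lemma slope_mult (f : R -> R) (t0 l t : R) : slope f t0 l t * (t - t0) = f t - f t0.
Proof.
  unfold slope. destruct (Req_dec_T t t0) as [->|H]; [ring|]. field. lra.
Qed.

Lemma continuous_eps (f : R -> R) (x : R) :
  (forall e, 0 < e -> exists d, 0 < d /\ forall y, Rabs (y - x) < d -> Rabs (f y - f x) < e) ->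
  continuous f x.
Proof.
  intros H. apply continuity_pt_filterlim. intros e He. destruct (H e He) as [d [Hd Hy]].
  exists d. split; [exact Hd|]. intros y [_ Hyx]. apply Hy, Hyx.
Qed.

Lemma continuous_eps_inv (f : R -> R) (x : R) : continuous f x ->
  forall e, 0 < e -> exists d, 0 < d /\ forall y, Rabs (y - x) < d -> Rabs (f y - f x) < e.
Proof.
  intros H e He. apply continuity_pt_filterlim in H. destruct (H e He) as [d [Hd Hy]].
  exists d. split; [exact Hd|]. intros y Hyx. destruct (Req_dec_T x y) as [<-|Hne].
  - rewrite Rminus_diag, Rabs_R0. exact He.
  - apply Hy. split; [split; [exact I|exact Hne]|exact Hyx].
Qed.

Lemma slope_continuous (f : R -> R) (t0 l t : R) :
  is_derive f t0 l -> continuous f t -> continuous (slope f t0 l) t.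
Proof.
  intros Hd Hc. destruct (Req_dec_T t t0) as [->|Hne].
  - apply continuous_eps. intros e He. apply is_derive_Reals in Hd.
    destruct (Hd e He) as [d Hy]. exists d. split; [apply cond_pos|].
    intros y Hyt. unfold slope. destruct (Req_dec_T t0 t0) as [_|]; [|lra].
    destruct (Req_dec_T y t0) as [->|Hn].
    + rewrite Rminus_diag, Rabs_R0. exact He.
    + specialize (Hy (y - t0)). replace (t0 + (y - t0)) with y in Hy by ring.
      apply Hy; [lra|exact Hyt].
  - apply (continuous_ext_loc _ (fun u => (f u - f t0) * / (u - t0))).
    + assert (Hp : 0 < Rabs (t - t0)) by (apply Rabs_pos_lt; lra).
      exists (mkposreal _ Hp). intros y Hy. unfold slope.
      destruct (Req_dec_T y t0) as [->|]; [|reflexivity].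
      exfalso. unfold ball in Hy; simpl in Hy. unfold AbsRing_ball, abs, minus, plus, opp in Hy; simpl in Hy.
      rewrite <- Rabs_Ropp in Hy. replace (- (t0 + - t)) with (t - t0) in Hy by ring. lra.
    + apply continuous_Rmult.
      * apply continuous_Rminus; [exact Hc|apply continuous_Rconst].
      * apply continuous_of_derivable. auto_derive. lra.
Qed.

Fixpoint dirichlet_kernel (N : nat) (u : R) : R :=
  match N with
  | O => 1
  | S n => dirichlet_kernel n u + 2 * cos (2 * PI * INR (S n) * u)
  end.

Lemma dirichlet_kernel_sin (N : nat) (u : R) :
  sin (PI * u) * dirichlet_kernel N u = sin ((2 * INR N + 1) * PI * u).
Proof.
  induction N as [|N IH].
  - simpl. rewrite Rmult_1_r. f_equal. ring.
  - cbn [dirichlet_kernel]. rewrite Rmult_plus_distr_l, IH, S_INR.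
    replace ((2 * INR N + 1) * PI * u) with (2 * PI * (INR N + 1) * u - PI * u) by ring.
    replace ((2 * (INR N + 1) + 1) * PI * u) with (2 * PI * (INR N + 1) * u + PI * u) by ring.
    rewrite sin_plus, sin_minus. ring.
Qed.

Lemma continuous_dirichlet_kernel (N : nat) (c t : R) :
  continuous (fun t => dirichlet_kernel N (t - c)) t.
Proof.
  induction N as [|N IH].
  - apply continuous_Rconst.
  - cbn [dirichlet_kernel]. apply continuous_Rplus; [exact IH|]. by_derive.
Qed.

Lemma RInt_dirichlet_kernel (N : nat) (al c : R) :
  RInt (fun t => dirichlet_kernel N (t - c)) al (al + 1) = 1.
Proof.
  induction N as [|N IH].
  - cbn [dirichlet_kernel]. rewrite (RInt_const (V := R_CompleteNormedModule)).
    unfold scal; simpl; unfold mult; simpl. ring.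
  - cbn [dirichlet_kernel]. rewrite RInt_Rplus, IH; [|lra| |by_derive].
    2: { intros; apply continuous_dirichlet_kernel. }
    rewrite RInt_Rscal; [|lra|by_derive].
    rewrite RInt_cos_period by lia. lra.
Qed.

(* Chernoff's argument: [f t - f t0 = H t * sin (PI (t - t0))] with [H] continuous, and multiplying
   the Dirichlet kernel by [sin] leaves a single oscillating term. *)
Theorem fourier_pointwise (f : R -> R) (al t0 : R) :
  al < t0 < al + 1 -> (forall t, al <= t <= al + 1 -> continuous f t) -> ex_derive f t0 ->
  is_lim_seq (fun N => RInt (fun t => f t * dirichlet_kernel N (t - t0)) al (al + 1)) (f t0).
Proof.
  intros Ht0 Hc [l Hl].
  set (s := fun t => sin (PI * (t - t0))).
  assert (Hs : is_derive s t0 PI).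
  { unfold s. auto_derive; auto. replace (t0 + - t0) with 0 by ring.
    rewrite Rmult_0_r, cos_0. lra. }
  assert (Hs0 : s t0 = 0).
  { unfold s. rewrite Rminus_diag, Rmult_0_r. apply sin_0. }
  assert (Hnz : forall t, al <= t <= al + 1 -> slope s t0 PI t <> 0).
  { intros t Ht. unfold slope. destruct (Req_dec_T t t0); [apply PI_neq0|].
    rewrite Hs0. apply Rmult_integral_contrapositive; split; [|apply Rinv_neq_0_compat; lra].
    rewrite Rminus_0_r. unfold s. pose proof PI_RGT_0.
    destruct (Rtotal_order t t0) as [h|[h|h]]; [|lra|].
    - replace (PI * (t - t0)) with (- (PI * (t0 - t))) by ring. rewrite sin_neg.
      assert (0 < sin (PI * (t0 - t))); [|lra]. apply sin_gt_0; nra.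
    - assert (0 < sin (PI * (t - t0))); [|lra]. apply sin_gt_0; nra. }
  set (H := fun t => slope f t0 l t * / slope s t0 PI t).
  assert (HH : forall t, al <= t <= al + 1 -> continuous H t).
  { intros t Ht. apply continuous_Rmult; [apply slope_continuous; auto|].
    apply (continuous_comp (slope s t0 PI) Rinv).
    - apply slope_continuous; auto. unfold s. by_derive.
    - apply continuous_of_derivable. auto_derive. auto. }
  assert (HK : forall t, al <= t <= al + 1 -> f t - f t0 = H t * s t).
  { intros t Ht. unfold H. rewrite <- (slope_mult f t0 l t).
    replace (s t) with (slope s t0 PI t * (t - t0)) by (rewrite slope_mult, Hs0; ring).
    field. auto. }
  apply is_lim_seq_ext with (fun N => f t0 + RInt (fun t => H t * dsin t0 N t) al (al + 1)).
  - intros N. symmetry.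
    rewrite (RInt_ext_le _ (fun t => f t0 * dirichlet_kernel N (t - t0) + H t * dsin t0 N t)); [|lra|].
    + rewrite RInt_Rplus; [|lra| |].
      * rewrite RInt_Rscal, RInt_dirichlet_kernel by (lra || (intros; apply continuous_dirichlet_kernel)).
        ring.
      * intros; apply continuous_Rmult; [apply continuous_Rconst|apply continuous_dirichlet_kernel].
      * intros; apply continuous_Rmult; auto using continuous_dsin.
    + intros t Ht. unfold dsin. rewrite <- dirichlet_kernel_sin. fold (s t).
      replace (f t) with (f t0 + H t * s t) by (rewrite <- HK; lra). ring.
  - rewrite <- (Rplus_0_r (f t0)) at 1. apply is_lim_seq_plus'; [apply is_lim_seq_const|].
    apply bessel_coef_lim. exact HH.
Qed.

(** * Goursat's lemma *)

Section Goursat.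
Variables P Q : R -> R -> R.

Definition closed_form_at (x y : R) : Prop :=
  exists al be ga : R, forall e, 0 < e -> exists d, 0 < d /\
    forall x' y', Rabs (x' - x) < d -> Rabs (y' - y) < d ->
      Rabs (P x' y' - P x y - al * (x' - x) - be * (y' - y)) <= e * (Rabs (x' - x) + Rabs (y' - y)) /\
      Rabs (Q x' y' - Q x y - be * (x' - x) - ga * (y' - y)) <= e * (Rabs (x' - x) + Rabs (y' - y)).

Variables a c W H : R.
Hypothesis HW : 0 < W.
Hypothesis HH : 0 < H.
Hypothesis HPQ : forall x y, a <= x <= a + W -> c <= y <= c + H -> closed_form_at x y.

Definition boundary_form (x y w h : R) : R :=
  RInt (fun t => P t y) x (x + w) - RInt (fun t => P t (y + h)) x (x + w)
  + RInt (fun t => Q (x + w) t) y (y + h) - RInt (fun t => Q x t) y (y + h).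

Lemma linear_bound_continuous (f : R -> R) (x al : R) :
  (exists d, 0 < d /\ forall x', Rabs (x' - x) < d ->
    Rabs (f x' - f x - al * (x' - x)) <= 1 * Rabs (x' - x)) -> continuous f x.
Proof.
  intros [d [Hd Hf]]. apply continuous_eps. intros e He.
  assert (Hk : 0 < Rabs al + 1) by (pose proof (Rabs_pos al); lra).
  exists (Rmin d (e / (Rabs al + 1))). split.
  { apply Rmin_pos; [lra|]. now apply Rdiv_lt_0_compat. }
  intros y Hy.
  assert (Rabs (y - x) < d) by (eapply Rlt_le_trans; [exact Hy|apply Rmin_l]).
  assert (H2 : Rabs (y - x) < e / (Rabs al + 1)) by (eapply Rlt_le_trans; [exact Hy|apply Rmin_r]).
  specialize (Hf y H0).
  replace (f y - f x) with ((f y - f x - al * (y - x)) + al * (y - x)) by ring.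
  eapply Rle_lt_trans; [apply Rabs_triang|]. rewrite Rabs_mult.
  apply (Rmult_lt_compat_r (Rabs al + 1)) in H2; [|lra].
  replace (e / (Rabs al + 1) * (Rabs al + 1)) with e in H2 by (field; lra). lra.
Qed.

Lemma continuous_P (x y : R) : a <= x <= a + W -> c <= y <= c + H -> continuous (fun t => P t y) x.
Proof.
  intros Hx Hy. destruct (HPQ x y Hx Hy) as (al & be & ga & Hd).
  destruct (Hd 1 Rlt_0_1) as [d [Hd0 Hd1]].
  apply (linear_bound_continuous _ x al). exists d. split; [exact Hd0|]. intros x' Hx'.
  assert (E : Rabs (y - y) < d) by (rewrite Rminus_diag, Rabs_R0; lra).
  destruct (Hd1 x' y Hx' E) as [F _]. rewrite Rminus_diag, Rabs_R0 in F.
  rewrite Rmult_0_r, Rminus_0_r, Rplus_0_r in F. exact F.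
Qed.

Lemma continuous_Q (x y : R) : a <= x <= a + W -> c <= y <= c + H -> continuous (fun t => Q x t) y.
Proof.
  intros Hx Hy. destruct (HPQ x y Hx Hy) as (al & be & ga & Hd).
  destruct (Hd 1 Rlt_0_1) as [d [Hd0 Hd1]].
  apply (linear_bound_continuous _ y ga). exists d. split; [exact Hd0|]. intros y' Hy'.
  assert (E : Rabs (x - x) < d) by (rewrite Rminus_diag, Rabs_R0; lra).
  destruct (Hd1 x y' E Hy') as [_ F]. rewrite Rminus_diag, Rabs_R0 in F.
  rewrite Rmult_0_r, Rminus_0_r, Rplus_0_l in F. exact F.
Qed.

Definition subrect (x y w h : R) : Prop :=
  0 < w /\ 0 < h /\ a <= x /\ x + w <= a + W /\ c <= y /\ y + h <= c + H.

Ltac int_cont := apply ex_RInt_cont; [lra|]; intros;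
  (apply continuous_P || apply continuous_Q); lra.

Lemma boundary_form_quarter (x y w h : R) : subrect x y w h ->
  boundary_form x y w h =
  boundary_form x y (w / 2) (h / 2) + boundary_form (x + w / 2) y (w / 2) (h / 2)
  + boundary_form x (y + h / 2) (w / 2) (h / 2)
  + boundary_form (x + w / 2) (y + h / 2) (w / 2) (h / 2).
Proof.
  intros (Hw & Hh & H1 & H2 & H3 & H4). unfold boundary_form.
  replace (x + w / 2 + w / 2) with (x + w) by field.
  replace (y + h / 2 + h / 2) with (y + h) by field.
  rewrite <- (RInt_Chasles (V := R_CompleteNormedModule) (fun t => P t y) x (x + w / 2) (x + w)) by int_cont.
  rewrite <- (RInt_Chasles (V := R_CompleteNormedModule) (fun t => P t (y + h)) x (x + w / 2) (x + w)) by int_cont.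
  rewrite <- (RInt_Chasles (V := R_CompleteNormedModule) (fun t => Q x t) y (y + h / 2) (y + h)) by int_cont.
  rewrite <- (RInt_Chasles (V := R_CompleteNormedModule) (fun t => Q (x + w) t) y (y + h / 2) (y + h)) by int_cont.
  unfold plus; simpl. ring.
Qed.

Lemma boundary_form_small (x y px py w h e d al be ga : R) : subrect x y w h ->
  x <= px <= x + w -> y <= py <= y + h -> w < d -> h < d -> 0 < e ->
  (forall x' y', Rabs (x' - px) < d -> Rabs (y' - py) < d ->
      Rabs (P x' y' - P px py - al * (x' - px) - be * (y' - py)) <= e * (Rabs (x' - px) + Rabs (y' - py)) /\
      Rabs (Q x' y' - Q px py - be * (x' - px) - ga * (y' - py)) <= e * (Rabs (x' - px) + Rabs (y' - py))) ->
  Rabs (boundary_form x y w h) <= 2 * e * ((w + h) * (w + h)).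
Proof.
  intros (Hw & Hh & H1 & H2 & H3 & H4) Hx Hy Hwd Hhd He Hd.
  assert (Hb : forall x' y', x <= x' <= x + w -> y <= y' <= y + h ->
      Rabs (P x' y' - P px py - al * (x' - px) - be * (y' - py)) <= e * (w + h) /\
      Rabs (Q x' y' - Q px py - be * (x' - px) - ga * (y' - py)) <= e * (w + h)).
  { intros x' y' Hx' Hy'.
    assert (Rabs (x' - px) <= w) by (apply Rabs_le; lra).
    assert (Rabs (y' - py) <= h) by (apply Rabs_le; lra).
    destruct (Hd x' y') as [A B]; try lra.
    assert (e * (Rabs (x' - px) + Rabs (y' - py)) <= e * (w + h)) by (apply Rmult_le_compat_l; lra).
    lra. }
  assert (EP : RInt (fun t => P t y) x (x + w) - RInt (fun t => P t (y + h)) x (x + w)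
    = RInt (fun t => P t y - P t (y + h) + be * h) x (x + w) - be * h * w).
  { rewrite RInt_Rplus; [|lra| |intros; apply continuous_Rconst].
    - rewrite RInt_Rminus by (lra || (intros; apply continuous_P; lra)).
      rewrite RInt_Rconst. ring.
    - intros; apply continuous_Rminus; apply continuous_P; lra. }
  assert (EQ : RInt (fun t => Q (x + w) t) y (y + h) - RInt (fun t => Q x t) y (y + h)
    = RInt (fun t => Q (x + w) t - Q x t - be * w) y (y + h) + be * h * w).
  { rewrite RInt_Rminus; [|lra| |intros; apply continuous_Rconst].
    - rewrite RInt_Rminus by (lra || (intros; apply continuous_Q; lra)).
      rewrite RInt_Rconst. change (fun t => Q (x + w) t) with (Q (x + w)). change (fun t => Q x t) with (Q x). ring.
    - intros; apply continuous_Rminus; apply continuous_Q; lra. }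
  replace (boundary_form x y w h) with
    (RInt (fun t => P t y - P t (y + h) + be * h) x (x + w)
     + RInt (fun t => Q (x + w) t - Q x t - be * w) y (y + h)) by (unfold boundary_form; lra).
  eapply Rle_trans; [apply Rabs_triang|].
  assert (B1 : Rabs (RInt (fun t => P t y - P t (y + h) + be * h) x (x + w)) <= (x + w - x) * (2 * (e * (w + h)))).
  { apply abs_RInt_le_const; [lra| |].
    - apply ex_RInt_cont; [lra|]. intros. apply continuous_Rplus; [|apply continuous_Rconst].
      apply continuous_Rminus; apply continuous_P; lra.
    - intros t Ht. destruct (Hb t y) as [A _]; try lra. destruct (Hb t (y + h)) as [B _]; try lra.
      apply Rabs_le_between in A. apply Rabs_le_between in B. apply Rabs_le. lra. }
  assert (B2 : Rabs (RInt (fun t => Q (x + w) t - Q x t - be * w) y (y + h)) <= (y + h - y) * (2 * (e * (w + h)))).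
  { apply abs_RInt_le_const; [lra| |].
    - apply ex_RInt_cont; [lra|]. intros. apply continuous_Rminus; [|apply continuous_Rconst].
      apply continuous_Rminus; apply continuous_Q; lra.
    - intros t Ht. destruct (Hb (x + w) t) as [_ A]; try lra. destruct (Hb x t) as [_ B]; try lra.
      apply Rabs_le_between in A. apply Rabs_le_between in B. apply Rabs_le. lra. }
  lra.
Qed.

Definition big_quarter (x y w h E : R) : R * R :=
  if Rle_dec E (Rabs (boundary_form x y w h)) then (x, y)
  else if Rle_dec E (Rabs (boundary_form (x + w) y w h)) then (x + w, y)
  else if Rle_dec E (Rabs (boundary_form x (y + h) w h)) then (x, y + h)
  else (x + w, y + h).

Lemma big_quarter_spec (x y w h E : R) : subrect x y w h -> E <= Rabs (boundary_form x y w h) ->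
  let q := big_quarter x y (w / 2) (h / 2) (E / 4) in
  E / 4 <= Rabs (boundary_form (fst q) (snd q) (w / 2) (h / 2)) /\
  x <= fst q <= x + w / 2 /\ y <= snd q <= y + h / 2.
Proof.
  intros Hr HE. pose proof Hr as (Hw & Hh & _). rewrite boundary_form_quarter in HE by auto.
  unfold big_quarter; repeat destruct Rle_dec; simpl; repeat split; try lra.
  pose proof (Rabs_triang (boundary_form x y (w / 2) (h / 2) + boundary_form (x + w / 2) y (w / 2) (h / 2)
  + boundary_form x (y + h / 2) (w / 2) (h / 2)) (boundary_form (x + w / 2) (y + h / 2) (w / 2) (h / 2))).
  pose proof (Rabs_triang (boundary_form x y (w / 2) (h / 2) + boundary_form (x + w / 2) y (w / 2) (h / 2))
  (boundary_form x (y + h / 2) (w / 2) (h / 2))).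
  pose proof (Rabs_triang (boundary_form x y (w / 2) (h / 2)) (boundary_form (x + w / 2) y (w / 2) (h / 2))).
  lra.
Qed.

Fixpoint corner (n : nat) : R * R :=
  match n with
  | O => (a, c)
  | S n => let q := corner n in
     big_quarter (fst q) (snd q) (W / 2 ^ n / 2) (H / 2 ^ n / 2)
       (Rabs (boundary_form a c W H) / 4 ^ n / 4)
  end.

Lemma corner_spec (n : nat) :
  subrect (fst (corner n)) (snd (corner n)) (W / 2 ^ n) (H / 2 ^ n) /\
  Rabs (boundary_form a c W H) / 4 ^ n
    <= Rabs (boundary_form (fst (corner n)) (snd (corner n)) (W / 2 ^ n) (H / 2 ^ n)).
Proof.
  induction n as [|n [IH1 IH2]].
  - simpl. rewrite !Rdiv_1_r. split; [|lra]. unfold subrect; lra.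
  - destruct (big_quarter_spec _ _ _ _ _ IH1 IH2) as (A & B & C).
    assert (E2 : forall z, z / 2 ^ S n = z / 2 ^ n / 2)
      by (intros; simpl; field; apply pow_nonzero; lra).
    assert (E4 : forall z, z / 4 ^ S n = z / 4 ^ n / 4)
      by (intros; simpl; field; apply pow_nonzero; lra).
    rewrite !E2, E4. simpl corner. split; [|exact A].
    unfold subrect in *. lra.
Qed.

Lemma corner_step (n : nat) :
  fst (corner n) <= fst (corner (S n)) <= fst (corner n) + W / 2 ^ n / 2 /\
  snd (corner n) <= snd (corner (S n)) <= snd (corner n) + H / 2 ^ n / 2.
Proof.
  destruct (corner_spec n) as [A B]. destruct (big_quarter_spec _ _ _ _ _ A B) as (C & D & E).
  split; assumption.
Qed.

Lemma nested_limit (u : nat -> R) (L : R) : 0 < L ->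
  (forall n, u n <= u (S n) <= u n + L / 2 ^ n / 2) ->
  exists l, forall n, u n <= l <= u n + L / 2 ^ n.
Proof.
  intros HL Hu.
  assert (Hv : forall n, u (S n) + L / 2 ^ S n <= u n + L / 2 ^ n).
  { intros n. replace (L / 2 ^ S n) with (L / 2 ^ n / 2) by (simpl; field; apply pow_nonzero; lra).
    specialize (Hu n). lra. }
  assert (Hi : forall n k, u n <= u (n + k)%nat).
  { intros n k. induction k; [rewrite Nat.add_0_r; lra|]. rewrite Nat.add_succ_r.
    specialize (Hu (n + k)%nat). lra. }
  assert (Hd : forall n k, u (n + k)%nat + L / 2 ^ (n + k) <= u n + L / 2 ^ n).
  { intros n k. induction k; [rewrite Nat.add_0_r; lra|]. rewrite Nat.add_succ_r.
    specialize (Hv (n + k)%nat). lra. }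
  assert (Hp : forall n, 0 < L / 2 ^ n) by (intros; apply Rdiv_lt_0_compat; auto; apply pow_lt; lra).
  destruct (ex_finite_lim_seq_incr u (u 0%nat + L)) as [l Hl].
  { intros n. apply Hu. }
  { intros n. specialize (Hd 0%nat n). simpl in Hd. specialize (Hp n). lra. }
  exists l. intros n. split.
  - apply (is_lim_seq_le_loc (fun _ => u n) u (u n) l); [|apply is_lim_seq_const|exact Hl].
    exists n. intros m Hm. replace m with (n + (m - n))%nat by lia. apply Hi.
  - apply (is_lim_seq_le_loc u (fun _ => u n + L / 2 ^ n) l (u n + L / 2 ^ n));
      [|exact Hl|apply is_lim_seq_const].
    exists n. intros m Hm. replace m with (n + (m - n))%nat by lia.
    specialize (Hd n (m - n)%nat). specialize (Hp (n + (m - n))%nat). lra.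
Qed.

Theorem goursat : boundary_form a c W H = 0.
Proof.
  destruct (nested_limit (fun n => fst (corner n)) W HW) as [px Hpx]; [intros; apply corner_step|].
  destruct (nested_limit (fun n => snd (corner n)) H HH) as [py Hpy]; [intros; apply corner_step|].
  destruct (HPQ px py) as (al & be & ga & Hd).
  { specialize (Hpx 0%nat). simpl in Hpx. lra. }
  { specialize (Hpy 0%nat). simpl in Hpy. lra. }
  destruct (Req_dec_T (boundary_form a c W H) 0) as [|Hne]; [assumption|exfalso].
  assert (HE : 0 < Rabs (boundary_form a c W H)) by now apply Rabs_pos_lt.
  set (E := Rabs (boundary_form a c W H)) in *.
  set (e := E / (4 * ((W + H) * (W + H)))).
  assert (HWH : 0 < (W + H) * (W + H)) by nra.
  assert (He : 0 < e) by (apply Rdiv_lt_0_compat; lra).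
  destruct (Hd e He) as [d [Hd0 Hd1]].
  destruct (pow_lt_1_zero (/ 2)) with (y := d / (W + H)) as [n Hn].
  { rewrite Rabs_pos_eq; lra. }
  { apply Rdiv_lt_0_compat; lra. }
  specialize (Hn n (le_n n)).
  assert (H2n : 0 < 2 ^ n) by (apply pow_lt; lra).
  rewrite Rabs_pos_eq in Hn by (left; apply pow_lt; lra). rewrite pow_inv in Hn.
  assert (Hn' : (W + H) / 2 ^ n < d).
  { apply (Rmult_lt_compat_r (W + H)) in Hn; [|lra].
    replace (d / (W + H) * (W + H)) with d in Hn by (field; lra). unfold Rdiv. lra. }
  destruct (corner_spec n) as [A B].
  assert (0 < W / 2 ^ n) by (apply Rdiv_lt_0_compat; lra).
  assert (0 < H / 2 ^ n) by (apply Rdiv_lt_0_compat; lra).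
  assert (C := boundary_form_small _ _ px py _ _ e d al be ga A (Hpx n) (Hpy n)).
  specialize (C ltac:(lra) ltac:(lra) He Hd1). fold E in B.
  replace (2 * e * ((W / 2 ^ n + H / 2 ^ n) * (W / 2 ^ n + H / 2 ^ n))) with (E / 4 ^ n / 2) in C.
  2: { unfold e. replace 4 with (2 * 2) at 1 by ring. rewrite Rpow_mult_distr. field. lra. }
  assert (0 < E / 4 ^ n) by (apply Rdiv_lt_0_compat; [lra|apply pow_lt; lra]). lra.
Qed.

End Goursat.

(** * Complex derivatives and the exponential *)

Definition cderiv (f : C -> C) (z l : C) : Prop :=
  forall e, 0 < e -> exists d, 0 < d /\ forall y, Cmod (y - z) < d ->
    Cmod (f y - f z - l * (y - z))%C <= e * Cmod (y - z).

Lemma cderiv_is_derive (f : C -> C) (z l : C) :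
  cderiv f z l <-> is_derive (K := C_AbsRing) (V := C_NormedModule) f z l.
Proof.
  split.
  - intros H. split; [apply is_linear_scal_l|].
    intros x Hx. apply (is_filter_lim_locally_unique (K := C_AbsRing) (V := AbsRing_NormedModule C_AbsRing)) in Hx. subst x.
    intros eps. destruct (H eps (cond_pos eps)) as [d [Hd Hy]].
    exists (mkposreal d Hd). intros y Hyz.
    change (Cmod (f y - f z - (y - z) * l)%C <= eps * Cmod (y - z)).
    rewrite (Cmult_comm (y - z) l). apply Hy. exact Hyz.
  - intros [_ H] e He.
    destruct (H z (fun P HP => HP) (mkposreal e He)) as [d Hd].
    exists d. split; [apply cond_pos|]. intros y Hy. specialize (Hd y Hy).
    change (Cmod (f y - f z - (y - z) * l)%C <= e * Cmod (y - z)) in Hd.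
    rewrite (Cmult_comm (y - z) l) in Hd. exact Hd.
Qed.

Lemma cderiv_is_derive_abs (f : C -> C) (z l : C) :
  cderiv f z l <-> is_derive (K := C_AbsRing) (V := AbsRing_NormedModule C_AbsRing) f z l.
Proof.
  split.
  - intros H. split; [apply is_linear_scal_l|].
    intros x Hx. apply (is_filter_lim_locally_unique (K := C_AbsRing) (V := AbsRing_NormedModule C_AbsRing)) in Hx. subst x.
    intros eps. destruct (H eps (cond_pos eps)) as [d [Hd Hy]].
    exists (mkposreal d Hd). intros y Hyz.
    change (Cmod (f y - f z - (y - z) * l)%C <= eps * Cmod (y - z)).
    rewrite (Cmult_comm (y - z) l). apply Hy. exact Hyz.
  - intros [_ H] e He.
    destruct (H z (fun P HP => HP) (mkposreal e He)) as [d Hd].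
    exists d. split; [apply cond_pos|]. intros y Hy. specialize (Hd y Hy).
    change (Cmod (f y - f z - (y - z) * l)%C <= e * Cmod (y - z)) in Hd.
    rewrite (Cmult_comm (y - z) l) in Hd. exact Hd.
Qed.

Lemma cderiv_eq (f : C -> C) (z l l' : C) : l = l' -> cderiv f z l -> cderiv f z l'.
Proof. now intros ->. Qed.

Lemma cderiv_ext_loc (f g : C -> C) (z l : C) :
  (exists d, 0 < d /\ forall y, Cmod (y - z) < d -> f y = g y) -> cderiv f z l -> cderiv g z l.
Proof.
  intros [d [Hd H]] Hf e He. destruct (Hf e He) as [d' [Hd' H']].
  exists (Rmin d d'). split; [now apply Rmin_pos|]. intros y Hy.
  rewrite <- H, <- (H z).
  - apply H'. eapply Rlt_le_trans; [exact Hy|apply Rmin_r].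
  - replace (z - z)%C with (RtoC 0) by ring. now rewrite Cmod_0.
  - eapply Rlt_le_trans; [exact Hy|apply Rmin_l].
Qed.

Lemma cderiv_ext (f g : C -> C) (z l : C) :
  (forall y, f y = g y) -> cderiv f z l -> cderiv g z l.
Proof. intros H. apply cderiv_ext_loc. exists 1. split; [lra|auto]. Qed.

Lemma cderiv_const (c z : C) : cderiv (fun _ => c) z 0.
Proof.
  intros e He. exists 1. split; [lra|]. intros y Hy.
  replace (c - c - 0 * (y - z))%C with (RtoC 0) by ring. rewrite Cmod_0.
  apply Rmult_le_pos; [lra|apply Cmod_ge_0].
Qed.

Lemma cderiv_id (z : C) : cderiv (fun s => s) z 1.
Proof.
  intros e He. exists 1. split; [lra|]. intros y Hy.
  replace (y - z - 1 * (y - z))%C with (RtoC 0) by ring. rewrite Cmod_0.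
  apply Rmult_le_pos; [lra|apply Cmod_ge_0].
Qed.

Lemma cderiv_plus (f g : C -> C) (z lf lg : C) : cderiv f z lf -> cderiv g z lg ->
  cderiv (fun s => f s + g s)%C z (lf + lg)%C.
Proof.
  rewrite !cderiv_is_derive. intros.
  apply (is_derive_plus (K := C_AbsRing) (V := C_NormedModule) f g); auto.
Qed.

Lemma cderiv_opp (f : C -> C) (z lf : C) : cderiv f z lf -> cderiv (fun s => - f s)%C z (- lf)%C.
Proof.
  rewrite !cderiv_is_derive. intros. apply (is_derive_opp (K := C_AbsRing) (V := C_NormedModule) f); auto.
Qed.

Lemma cderiv_minus (f g : C -> C) (z lf lg : C) : cderiv f z lf -> cderiv g z lg ->
  cderiv (fun s => f s - g s)%C z (lf - lg)%C.
Proof. intros. apply cderiv_plus; auto using cderiv_opp. Qed.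

Lemma cderiv_mult (f g : C -> C) (z lf lg : C) : cderiv f z lf -> cderiv g z lg ->
  cderiv (fun s => f s * g s)%C z (lf * g z + f z * lg)%C.
Proof.
  rewrite !cderiv_is_derive_abs. intros.
  apply (is_derive_mult (K := C_AbsRing) f g); auto. apply Cmult_comm.
Qed.

Lemma cderiv_comp (f g : C -> C) (z lf lg : C) : cderiv f (g z) lf -> cderiv g z lg ->
  cderiv (fun s => f (g s)) z (lf * lg)%C.
Proof.
  rewrite !cderiv_is_derive_abs. intros. rewrite Cmult_comm.
  apply (is_derive_comp (K := C_AbsRing) (V := AbsRing_NormedModule C_AbsRing) f g); auto.
Qed.

Lemma cderiv_unique (f : C -> C) (z l l' : C) : cderiv f z l -> cderiv f z l' -> l = l'.
Proof.
  rewrite !cderiv_is_derive. intros H H'.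
  apply is_C_derive_unique in H. apply is_C_derive_unique in H'. congruence.
Qed.

Definition cexp (w : C) : C := (exp (Re w) * cos (Im w), exp (Re w) * sin (Im w)).

Lemma cpow_neg_cexp (x : R) (s : C) : cpow_neg x s = cexp (- RtoC (ln x) * s).
Proof.
  destruct s as [u v]. unfold cpow_neg, cexp, Re, Im. simpl.
  replace (- ln x * u - -0 * v) with (- u * ln x) by ring.
  replace (- ln x * v + -0 * u) with (- (v * ln x)) by ring.
  rewrite cos_neg, sin_neg. f_equal. ring.
Qed.

Lemma cexp_plus (z w : C) : cexp (z + w) = (cexp z * cexp w)%C.
Proof.
  destruct z as [a b], w as [c d]. unfold cexp, Re, Im, Cmult. simpl.
  rewrite exp_plus, cos_plus, sin_plus. f_equal; ring.
Qed.

Lemma Cmod_le_sum (a b : R) : Cmod (a, b) <= Rabs a + Rabs b.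
Proof.
  replace (a, b) with (RtoC a + Ci * RtoC b)%C.
  - eapply Rle_trans; [apply Cmod_triangle|]. rewrite Cmod_mult, Cmod_Ci, !Cmod_R. lra.
  - unfold Cplus, Cmult, RtoC; simpl. f_equal; ring.
Qed.

Lemma Rderiv_eps (f : R -> R) (x l : R) : is_derive f x l ->
  forall e, 0 < e -> exists d, 0 < d /\ forall y, Rabs (y - x) < d ->
    Rabs (f y - f x - l * (y - x)) <= e * Rabs (y - x).
Proof.
  intros [_ H] e He. destruct (H x (fun P HP => HP) (mkposreal e He)) as [d Hd].
  exists d. split; [apply cond_pos|]. intros y Hy. specialize (Hd y Hy).
  rewrite (Rmult_comm l). exact Hd.
Qed.

Lemma cderiv_cexp_0 : cderiv cexp 0 1.
Proof.
  intros e He.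
  set (e' := Rmin (e / 10) 1).
  assert (He' : 0 < e') by (apply Rmin_pos; lra).
  assert (He1 : e' <= e / 10) by apply Rmin_l. assert (He2 : e' <= 1) by apply Rmin_r.
  destruct (Rderiv_eps exp 0 1) with (e := e') as [d1 [Hd1 H1]]; auto.
  { auto_derive; auto. rewrite exp_0. ring. }
  destruct (Rderiv_eps cos 0 0) with (e := e') as [d2 [Hd2 H2]]; auto.
  { auto_derive; auto. rewrite sin_0. ring. }
  destruct (Rderiv_eps sin 0 1) with (e := e') as [d3 [Hd3 H3]]; auto.
  { auto_derive; auto. rewrite cos_0. ring. }
  set (d := Rmin e' (Rmin d1 (Rmin d2 d3))).
  exists d. split; [unfold d; repeat apply Rmin_pos; lra|].
  intros [x y] Hy. replace ((x, y) - 0)%C with (x, y) in * by (unfold Cminus, Cplus, Copp; simpl; f_equal; ring).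
  pose proof (Rmax_Cmod (x, y)) as HM. simpl in HM.
  assert (Hx' : Rabs x <= Cmod (x, y)) by (eapply Rle_trans; [apply Rmax_l|exact HM]).
  assert (Hy' : Rabs y <= Cmod (x, y)) by (eapply Rle_trans; [apply Rmax_r|exact HM]).
  set (M := Cmod (x, y)) in *.
  assert (d <= e' /\ d <= d1 /\ d <= d2 /\ d <= d3) as (D0 & D1 & D2 & D3).
  { pose proof (Rmin_l e' (Rmin d1 (Rmin d2 d3))). pose proof (Rmin_r e' (Rmin d1 (Rmin d2 d3))).
    pose proof (Rmin_l d1 (Rmin d2 d3)). pose proof (Rmin_r d1 (Rmin d2 d3)).
    pose proof (Rmin_l d2 d3). pose proof (Rmin_r d2 d3). unfold d. lra. }
  specialize (H1 x). specialize (H2 y). specialize (H3 y).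
  rewrite exp_0, !Rminus_0_r in H1. rewrite cos_0, !Rminus_0_r in H2. rewrite sin_0, !Rminus_0_r in H3.
  specialize (H1 ltac:(lra)). specialize (H2 ltac:(lra)). specialize (H3 ltac:(lra)).
  rewrite Rmult_0_l, Rminus_0_r in H2.
  assert (0 <= M) by apply Cmod_ge_0.
  assert (Hex : Rabs (exp x - 1) <= 2 * Rabs x).
  { replace (exp x - 1) with ((exp x - 1 - 1 * x) + x) by ring.
    eapply Rle_trans; [apply Rabs_triang|]. pose proof (Rabs_pos x). nra. }
  assert (He3 : Rabs (exp x) <= 3).
  { replace (exp x) with ((exp x - 1) + 1) by ring.
    eapply Rle_trans; [apply Rabs_triang|]. rewrite Rabs_R1. lra. }
  assert (E0 : cexp 0 = 1).
  { unfold cexp, RtoC; simpl. rewrite exp_0, cos_0, sin_0. f_equal; ring. }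
  rewrite E0.
  replace (cexp (x, y) - 1 - 1 * (x, y))%C with
    ((exp x - 1 - 1 * x) + exp x * (cos y - 1), exp x * (sin y - 1 * y) + (exp x - 1) * y)
    by (unfold cexp, Cminus, Cplus, Cmult, Copp, RtoC; simpl; f_equal; ring).
  eapply Rle_trans; [apply Cmod_le_sum|].
  pose proof (Rabs_triang (exp x - 1 - 1 * x) (exp x * (cos y - 1))).
  pose proof (Rabs_triang (exp x * (sin y - 1 * y)) ((exp x - 1) * y)).
  rewrite Rabs_mult in H0. rewrite !Rabs_mult in H4.
  pose proof (Rabs_pos x). pose proof (Rabs_pos y).
  assert (Rabs (exp x) * Rabs (cos y - 1) <= 3 * (e' * M)).
  { apply Rmult_le_compat; try apply Rabs_pos; [lra|]. nra. }
  assert (Rabs (exp x) * Rabs (sin y - 1 * y) <= 3 * (e' * M)).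
  { apply Rmult_le_compat; try apply Rabs_pos; [lra|]. nra. }
  assert (Rabs (exp x - 1) * Rabs y <= (2 * e') * M).
  { apply Rmult_le_compat; try apply Rabs_pos; lra. }
  assert (e' * Rabs x <= e' * M) by nra.
  nra.
Qed.

Lemma cderiv_cexp (z : C) : cderiv cexp z (cexp z).
Proof.
  apply (cderiv_ext (fun s => cexp z * cexp (s - z))%C).
  { intros y. rewrite <- cexp_plus. f_equal. ring. }
  eapply cderiv_eq; [|apply cderiv_mult; [apply cderiv_const|apply (cderiv_comp cexp (fun s => s - z)%C)]].
  2: { replace (z - z)%C with (RtoC 0) by ring. apply cderiv_cexp_0. }
  2: { apply cderiv_minus; [apply cderiv_id|apply cderiv_const]. }
  simpl. ring.
Qed.

Lemma cderiv_cexp_lin (a z : C) : cderiv (fun s => cexp (a * s))%C z (a * cexp (a * z))%C.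
Proof.
  eapply cderiv_eq; [|apply (cderiv_comp cexp (fun s => a * s)%C); [apply cderiv_cexp|]].
  2: { apply cderiv_mult; [apply cderiv_const|apply cderiv_id]. }
  simpl. ring.
Qed.

Lemma cderiv_cpow_neg (x : R) (s : C) :
  cderiv (cpow_neg x) s (- RtoC (ln x) * cpow_neg x s)%C.
Proof.
  apply (cderiv_ext (fun s => cexp (- RtoC (ln x) * s))%C).
  { intros; now rewrite cpow_neg_cexp. }
  rewrite cpow_neg_cexp. apply cderiv_cexp_lin.
Qed.

Lemma Cmod_sub_sym (a b : C) : Cmod (a - b) = Cmod (b - a).
Proof. rewrite <- Cmod_opp. f_equal. ring. Qed.

Lemma cderiv_closed_form (f : C -> C) (x y : R) (l : C) : cderiv f (x, y) l ->
  closed_form_at (fun x y => Im (f (x, y))) (fun x y => Re (f (x, y))) x y /\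
  closed_form_at (fun x y => Re (f (x, y))) (fun x y => - Im (f (x, y))) x y.
Proof.
  intros H. destruct l as [a b].
  assert (K : forall e, 0 < e -> exists d, 0 < d /\ forall x' y', Rabs (x' - x) < d -> Rabs (y' - y) < d ->
    Rabs (Re (f (x', y')) - Re (f (x, y)) - (a * (x' - x) - b * (y' - y))) <= e * (Rabs (x' - x) + Rabs (y' - y)) /\
    Rabs (Im (f (x', y')) - Im (f (x, y)) - (a * (y' - y) + b * (x' - x))) <= e * (Rabs (x' - x) + Rabs (y' - y))).
  { intros e He. destruct (H e He) as [d [Hd Hf]]. exists (d / 2). split; [lra|].
    intros x' y' Hx Hy. specialize (Hf (x', y')).
    change ((x', y') - (x, y))%C with (x' - x, y' - y) in Hf.
    pose proof (Cmod_le_sum (x' - x) (y' - y)) as Hs.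
    specialize (Hf ltac:(lra)).
    assert (Hm : e * Cmod (x' - x, y' - y) <= e * (Rabs (x' - x) + Rabs (y' - y)))
      by (apply Rmult_le_compat_l; lra).
    pose proof (Rmax_Cmod (f (x', y') - f (x, y) - (a, b) * ((x' - x)%R, (y' - y)%R))%C) as HM.
    split.
    - eapply Rle_trans; [|exact Hm]. eapply Rle_trans; [|exact Hf]. eapply Rle_trans; [|exact HM].
      apply Rmax_l.
    - eapply Rle_trans; [|exact Hm]. eapply Rle_trans; [|exact Hf]. eapply Rle_trans; [|exact HM].
      apply Rmax_r. }
  split.
  - exists b, a, (- b). intros e He. destruct (K e He) as [d [Hd Hf]]. exists d. split; [exact Hd|].
    intros x' y' Hx Hy. destruct (Hf x' y' Hx Hy) as [A B]. split.
    + replace (_ - _ - _ - _) with (Im (f (x', y')) - Im (f (x, y)) - (a * (y' - y) + b * (x' - x))) by ring.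
      exact B.
    + replace (_ - _ - _ - _) with (Re (f (x', y')) - Re (f (x, y)) - (a * (x' - x) - b * (y' - y))) by ring.
      exact A.
  - exists a, (- b), (- a). intros e He. destruct (K e He) as [d [Hd Hf]]. exists d. split; [exact Hd|].
    intros x' y' Hx Hy. destruct (Hf x' y' Hx Hy) as [A B]. split.
    + replace (_ - _ - _ - _) with (Re (f (x', y')) - Re (f (x, y)) - (a * (x' - x) - b * (y' - y))) by ring.
      exact A.
    + replace (_ - _ - _ - _) with (- (Im (f (x', y')) - Im (f (x, y)) - (a * (y' - y) + b * (x' - x)))) by ring.
      rewrite Rabs_Ropp. exact B.
Qed.

(** * The identity theorem *)

Lemma closed_form_at_derive (P Q : R -> R -> R) (x y : R) :
  closed_form_at P Q x y -> ex_derive (fun t => Q x t) y.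
Proof.
  intros (al & be & ga & H). exists ga. split; [apply is_linear_scal_l|].
  intros z Hz. apply (is_filter_lim_locally_unique (K := R_AbsRing) (V := AbsRing_NormedModule R_AbsRing)) in Hz.
  subst z. intros eps. destruct (H eps (cond_pos eps)) as [d [Hd Hf]].
  exists (mkposreal d Hd). intros t Ht.
  change (Rabs (Q x t - Q x y - (t - y) * ga) <= eps * Rabs (t - y)).
  destruct (Hf x t) as [_ B].
  - rewrite Rminus_diag, Rabs_R0. exact Hd.
  - exact Ht.
  - rewrite Rminus_diag, Rabs_R0, Rmult_0_r, Rminus_0_r, Rplus_0_l in B.
    rewrite (Rmult_comm (t - y)). exact B.
Qed.

Lemma cderiv_line (h : C -> C) (x y : R) : (exists l, cderiv h (x, y) l) ->
  ex_derive (fun t => Re (h (x, t))) y /\ ex_derive (fun t => Im (h (x, t))) y.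
Proof.
  intros [l Hl]. destruct (cderiv_closed_form _ _ _ _ Hl) as [A B].
  apply closed_form_at_derive in A. apply closed_form_at_derive in B. split; [exact A|].
  apply (ex_derive_ext (fun t => - - Im (h (x, t)))).
  - intros. apply Ropp_involutive.
  - apply (ex_derive_opp (V := R_NormedModule)). exact B.
Qed.

Lemma goursat_periodic (h : C -> C) (rho : R) : 0 < rho ->
  (forall x y, - rho <= x <= 0 -> - / 2 <= y <= / 2 -> exists l, cderiv h (x, y) l) ->
  (forall x, h (x, - / 2) = h (x, / 2)) -> (forall y, h (- rho, y) = 0) ->
  RInt (fun t => Re (h (0, t))) (- / 2) (- / 2 + 1) = 0 /\
  RInt (fun t => Im (h (0, t))) (- / 2) (- / 2 + 1) = 0.
Proof.
  intros Hrho Hh Hper Hz.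
  assert (K : forall P Q : R -> R -> R, (forall x y, - rho <= x <= 0 -> - / 2 <= y <= / 2 ->
      closed_form_at P Q x y) -> (forall x, P x (- / 2) = P x (/ 2)) -> (forall y, Q (- rho) y = 0) ->
      RInt (fun t => Q 0 t) (- / 2) (- / 2 + 1) = 0).
  { intros P Q H1 H2 H3.
    pose proof (goursat P Q (- rho) (- / 2) rho 1 Hrho Rlt_0_1) as G.
    specialize (G ltac:(intros; apply H1; lra)). unfold boundary_form in G.
    rewrite (RInt_ext_le (fun t => P t (- / 2 + 1)) (fun t => P t (- / 2))) in G.
    - rewrite (RInt_ext_le (fun t => Q (- rho) t) (fun t => 0)) in G by (lra || (intros; apply H3)).
      rewrite RInt_Rconst in G. rewrite Rplus_opp_l in G. lra.
    - lra.
    - intros. rewrite H2. f_equal. lra. }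
  split.
  - apply (K (fun x y => Im (h (x, y))) (fun x y => Re (h (x, y)))).
    + intros x y Hx Hy. destruct (Hh x y Hx Hy) as [l Hl]. apply (cderiv_closed_form _ _ _ _ Hl).
    + intros; now rewrite Hper.
    + intros; now rewrite Hz.
  - assert (E : RInt (fun t => - Im (h (0, t))) (- / 2) (- / 2 + 1) = 0).
    { apply (K (fun x y => Re (h (x, y))) (fun x y => - Im (h (x, y)))).
      + intros x y Hx Hy. destruct (Hh x y Hx Hy) as [l Hl]. apply (cderiv_closed_form _ _ _ _ Hl).
      + intros; now rewrite Hper.
      + intros; rewrite Hz. apply Ropp_0. }
    rewrite (RInt_ext_le _ (fun t => (-1) * Im (h (0, t)))) in E by (intros; lra).
    rewrite RInt_Rscal in E; [lra|lra|].
    intros y Hy. apply continuous_of_derivable. apply cderiv_line. apply Hh; lra.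
Qed.

Lemma Cmod_cexp (w : C) : Cmod (cexp w) = exp (Re w).
Proof.
  unfold cexp, Cmod. simpl.
  replace (_ + _) with (exp (Re w) * exp (Re w) * (Rsqr (sin (Im w)) + Rsqr (cos (Im w))))
    by (unfold Rsqr; ring).
  rewrite sin2_cos2, Rmult_1_r. apply sqrt_square. left; apply exp_pos.
Qed.

Lemma cexp_scal_half (mu x : R) (k : nat) : mu = 2 * PI * INR k \/ mu = - (2 * PI * INR k) ->
  cexp (RtoC mu * (x, - / 2)) = cexp (RtoC mu * (x, / 2)).
Proof.
  intros Hmu. unfold cexp, Re, Im, Cmult, RtoC; simpl.
  replace (mu * - / 2 + 0 * x) with (- (mu / 2)) by field.
  replace (mu * / 2 + 0 * x) with (mu / 2) by field.
  replace (mu * x - 0 * - / 2) with (mu * x) by ring.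
  replace (mu * x - 0 * / 2) with (mu * x) by ring.
  rewrite cos_neg, sin_neg.
  assert (E : sin (PI * INR k) = 0) by (rewrite Rmult_comm; apply sin_eq_0_1; exists (Z.of_nat k); now rewrite <- INR_IZR_INZ).
  replace (sin (mu / 2)) with 0; [now rewrite Ropp_0|].
  destruct Hmu as [-> | ->].
  - rewrite <- E. f_equal. field.
  - replace (- (2 * PI * INR k) / 2) with (- (PI * INR k)) by field. rewrite sin_neg, E. ring.
Qed.

Section VanishDisc.
Variables (g : C -> C) (z0 c : C) (r : R).
Hypothesis Hg : forall z, Cmod (z - z0) <= Cmod c -> exists l, cderiv g z l.
Hypothesis Hr : 0 < r.
Hypothesis Hz : forall z, Cmod (z - z0) < r -> g z = 0.

Let circ (w : C) : C := (z0 + c * cexp (RtoC (2 * PI) * w))%C.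
Let h (mu : R) (w : C) : C := (g (circ w) * cexp (RtoC mu * w))%C.

Lemma Cmod_circ (w : C) : Cmod (circ w - z0) = Cmod c * exp (2 * PI * Re w).
Proof.
  unfold circ. replace (z0 + c * cexp (RtoC (2 * PI) * w) - z0)%C with (c * cexp (RtoC (2 * PI) * w))%C by ring.
  rewrite Cmod_mult, Cmod_cexp. do 2 f_equal. destruct w; simpl. ring.
Qed.

Lemma circ_derive (mu : R) (w : C) : Re w <= 0 -> exists l, cderiv (h mu) w l.
Proof.
  intros Hw. destruct (Hg (circ w)) as [l Hl].
  - rewrite Cmod_circ. rewrite <- (Rmult_1_r (Cmod c)) at 2.
    apply Rmult_le_compat_l; [apply Cmod_ge_0|]. rewrite <- exp_0.
    pose proof PI_RGT_0.
    destruct (Rle_lt_or_eq_dec _ _ Hw) as [H1|H1].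
    + left. apply exp_increasing. nra.
    + rewrite H1, Rmult_0_r. lra.
  - eexists. apply cderiv_mult; [|apply cderiv_cexp_lin].
    apply (cderiv_comp g circ); [exact Hl|]. unfold circ.
    apply cderiv_plus; [apply cderiv_const|]. apply cderiv_mult; [apply cderiv_const|apply cderiv_cexp_lin].
Qed.

Let u (t : R) : R := Re (g (circ (0, t))).
Let v (t : R) : R := Im (g (circ (0, t))).

Lemma circ_fourier (mu : R) (k : nat) : mu = 2 * PI * INR k \/ mu = - (2 * PI * INR k) ->
  RInt (fun t => u t * cos (mu * t) - v t * sin (mu * t)) (- / 2) (- / 2 + 1) = 0 /\
  RInt (fun t => u t * sin (mu * t) + v t * cos (mu * t)) (- / 2) (- / 2 + 1) = 0.
Proof.
  intros Hmu. pose proof PI_RGT_0 as HPI.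
  assert (exists rho, 0 < rho /\ Cmod c * exp (- (2 * PI * rho)) < r) as [rho [Hrho Hsmall]].
  { set (q := r / (Cmod c + 1)). pose proof (Cmod_ge_0 c).
    assert (Hq : 0 < q) by (apply Rdiv_lt_0_compat; lra).
    exists (Rabs (ln q) / (2 * PI) + 1). split.
    - assert (0 <= Rabs (ln q) / (2 * PI)); [|lra].
      apply Rmult_le_pos; [apply Rabs_pos|]. left. apply Rinv_0_lt_compat. lra.
    - replace (2 * PI * (Rabs (ln q) / (2 * PI) + 1)) with (Rabs (ln q) + 2 * PI) by (field; lra).
      assert (exp (- (Rabs (ln q) + 2 * PI)) < q).
      { rewrite <- (exp_ln q Hq) at 2. apply exp_increasing. pose proof (Rle_abs (- ln q)).
        rewrite Rabs_Ropp in H0. lra. }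
      assert (Cmod c * exp (- (Rabs (ln q) + 2 * PI)) <= Cmod c * q) by (apply Rmult_le_compat_l; lra).
      assert ((Cmod c + 1) * q = r) by (unfold q; field; lra). nra. }
  destruct (goursat_periodic (h mu) rho Hrho) as [A B].
  - intros x y Hx _. apply circ_derive. apply Hx.
  - intros x. unfold h, circ. rewrite (cexp_scal_half mu x k Hmu).
    rewrite (cexp_scal_half (2 * PI) x 1) by (left; simpl; ring). reflexivity.
  - intros y. unfold h. rewrite Hz; [apply Cmult_0_l|].
    rewrite Cmod_circ. simpl. replace (2 * PI * - rho) with (- (2 * PI * rho)) by ring. exact Hsmall.
  - assert (E0 : forall t, cexp (RtoC mu * (0, t)) = (cos (mu * t), sin (mu * t))).
    { intros t. unfold cexp, Re, Im; simpl. replace (mu * 0 - 0 * t) with 0 by ring.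
      replace (mu * t + 0 * 0) with (mu * t) by ring. rewrite exp_0. f_equal; ring. }
    split.
    + rewrite <- A. apply RInt_ext_le; [lra|]. intros t _. unfold h. rewrite E0. reflexivity.
    + rewrite <- B. apply RInt_ext_le; [lra|]. intros t _. unfold h. rewrite E0. reflexivity.
Qed.

Lemma circ_derivable (t : R) : ex_derive u t /\ ex_derive v t.
Proof.
  destruct (cderiv_line (h 0) 0 t) as [A B].
  - apply circ_derive. simpl. lra.
  - assert (E : forall t, h 0 (0, t) = g (circ (0, t))).
    { intros s. unfold h. replace (RtoC 0 * (0, s))%C with (RtoC 0) by ring.
      replace (cexp 0) with (RtoC 1); [ring|].
      unfold cexp, RtoC; simpl. rewrite exp_0, cos_0, sin_0. f_equal; ring. }
    split.
    + apply (ex_derive_ext (fun t => Re (h 0 (0, t)))); [intros; now rewrite E|exact A].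
    + apply (ex_derive_ext (fun t => Im (h 0 (0, t)))); [intros; now rewrite E|exact B].
Qed.

Lemma circ_cos_coef (k : nat) :
  RInt (fun t => u t * cos (2 * PI * INR k * t)) (- / 2) (- / 2 + 1) = 0 /\
  RInt (fun t => v t * cos (2 * PI * INR k * t)) (- / 2) (- / 2 + 1) = 0.
Proof.
  set (mu := 2 * PI * INR k).
  destruct (circ_fourier mu k) as [A B]; [now left|].
  destruct (circ_fourier (- mu) k) as [A' B']; [now right|].
  assert (Cu : forall t, continuous u t) by (intros; apply continuous_of_derivable, circ_derivable).
  assert (Cv : forall t, continuous v t) by (intros; apply continuous_of_derivable, circ_derivable).
  assert (Cc : forall (nu x : R), continuous (fun t => cos (nu * t)) x) by by_derive.
  assert (Cs : forall (nu x : R), continuous (fun t => sin (nu * t)) x) by by_derive.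
  split.
  - rewrite (RInt_ext_le _ (fun t => / 2 * ((u t * cos (mu * t) - v t * sin (mu * t))
      + (u t * cos (- mu * t) - v t * sin (- mu * t))))).
    + rewrite RInt_Rscal, RInt_Rplus, A, A'; try lra; intros;
      cont; auto.
    + lra.
    + intros t _. rewrite Ropp_mult_distr_l_reverse, cos_neg, sin_neg. field.
  - rewrite (RInt_ext_le _ (fun t => / 2 * ((u t * sin (mu * t) + v t * cos (mu * t))
      + (u t * sin (- mu * t) + v t * cos (- mu * t))))).
    + rewrite RInt_Rscal, RInt_Rplus, B, B'; try lra; intros;
      cont; auto.
    + lra.
    + intros t _. rewrite Ropp_mult_distr_l_reverse, cos_neg, sin_neg. field.
Qed.

Lemma fourier_zero (f : R -> R) : (forall t, ex_derive f t) ->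
  (forall k, RInt (fun t => f t * cos (2 * PI * INR k * t)) (- / 2) (- / 2 + 1) = 0) -> f 0 = 0.
Proof.
  intros Hf Hk. assert (Cf : forall t, continuous f t) by (intros; apply continuous_of_derivable, Hf).
  assert (L := fourier_pointwise f (- / 2) 0 ltac:(lra) (fun t _ => Cf t) (Hf 0)).
  assert (L0 : is_lim_seq (fun N => RInt (fun t => f t * dirichlet_kernel N (t - 0)) (- / 2) (- / 2 + 1)) 0).
  { apply is_lim_seq_ext with (fun _ => 0); [|apply is_lim_seq_const].
    intros N. symmetry. induction N as [|N IH].
    - rewrite <- (Hk 0%nat). apply RInt_ext_le; [lra|]. intros t _. simpl.
      rewrite Rmult_0_r, Rmult_0_l, cos_0. reflexivity.
    - cbn [dirichlet_kernel].
      rewrite (RInt_ext_le _ (fun t => f t * dirichlet_kernel N (t - 0)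
        + 2 * (f t * cos (2 * PI * INR (S N) * t)))); [|lra|intros; rewrite Rminus_0_r; ring].
      assert (Cc : forall x, continuous (fun t => f t * cos (2 * PI * INR (S N) * t)) x)
        by (intros; apply continuous_Rmult; [auto|by_derive]).
      rewrite RInt_Rplus, IH; [|lra| |].
      + rewrite RInt_Rscal, Hk by (auto; lra). ring.
      + intros; apply continuous_Rmult; auto. apply continuous_dirichlet_kernel.
      + intros; apply continuous_Rmult; auto using continuous_Rconst. }
  apply is_lim_seq_unique in L. apply is_lim_seq_unique in L0. congruence.
Qed.

Theorem vanish_disc : g (z0 + c)%C = 0.
Proof.
  assert (E : (z0 + c)%C = circ (0, 0)).
  { unfold circ. replace (RtoC (2 * PI) * (0, 0))%C with (RtoC 0) by (unfold RtoC, Cmult; simpl; f_equal; ring).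
    replace (cexp 0) with (RtoC 1); [ring|].
    unfold cexp, RtoC; simpl. rewrite exp_0, cos_0, sin_0. f_equal; ring. }
  rewrite E.
  assert (Hu := fourier_zero u (fun t => proj1 (circ_derivable t)) (fun k => proj1 (circ_cos_coef k))).
  assert (Hv := fourier_zero v (fun t => proj2 (circ_derivable t)) (fun k => proj2 (circ_cos_coef k))).
  unfold u, v in *. destruct (g (circ (0, 0))) as [p q]. simpl in *. now subst.
Qed.

End VanishDisc.

(* Two overlapping discs: one in the upper half plane reaching from [Re s > 1] to the left,
   then one around [u + i/4] that contains [u]. *)
Theorem identity_left (g : C -> C) (u : R) : u < 0 ->
  (forall s, s <> RtoC 1 -> exists l, cderiv g s l) ->
  (forall s, 1 < Re s -> g s = 0) ->
  exists d, 0 < d /\ forall s, Cmod (s - RtoC u) < d -> g s = 0.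
Proof.
  intros Hu Hd Hz.
  assert (Up : forall x y, 0 < y -> g (x, y) = 0).
  { intros x y Hy.
    set (X := 2 + Rabs x). set (Y := y + X * X / y + 1).
    assert (HX : 0 < X) by (unfold X; pose proof (Rabs_pos x); lra).
    assert (HXy : 0 < X * X / y) by (apply Rdiv_lt_0_compat; nra).
    assert (HM : Cmod (x - 2, y - Y) < Y).
    { unfold Cmod. simpl. assert (HY : y < Y) by (unfold Y; lra).
      apply Rlt_le_trans with (sqrt (Y * Y)); [apply sqrt_lt_1_alt|right; apply sqrt_square; lra].
      assert (Hxx : (x - 2) * (x - 2) <= X * X).
      { assert (Rabs (x - 2) <= X).
        { unfold X. apply Rabs_le. pose proof (Rle_abs x). pose proof (Rle_abs (- x)).
          rewrite Rabs_Ropp in H0. lra. }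
        apply Rabs_le_between in H. nra. }
      assert (HyY : X * X < Y * y).
      { unfold Y. replace ((y + X * X / y + 1) * y) with (y * y + X * X + y) by (field; lra). nra. }
      assert (y * y < Y * y) by (apply Rmult_lt_compat_r; lra).
      pose proof (Rle_0_sqr (x - 2)) as S1. pose proof (Rle_0_sqr (y - Y)) as S2.
      unfold Rsqr in S1, S2. rewrite !Rmult_1_r. split; lra. }
    replace (x, y) with ((2, Y) + (x - 2, y - Y)%R)%C by (unfold Cplus; simpl; f_equal; ring).
    apply (vanish_disc g (2, Y) (x - 2, y - Y) 1).
    - intros z Hzz. apply Hd. intros ->.
      assert (Hlt : Cmod (1 - (2, Y)) < Y) by lra.
      pose proof (Rmax_Cmod (1 - (2, Y))%C) as HR. simpl in HR.
      pose proof (Rmax_r (Rabs (1 + - (2))) (Rabs (0 + - Y))) as HR2.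
      rewrite Rplus_0_l, Rabs_Ropp in HR2. pose proof (Rle_abs Y).
      rewrite Rplus_0_l, Rabs_Ropp in HR. lra.
    - lra.
    - intros z Hzz. apply Hz. destruct z as [p q].
      pose proof (Rmax_Cmod ((p, q) - (2, Y))%C) as HR. simpl in HR.
      pose proof (Rmax_l (Rabs (p + - (2))) (Rabs (q + - Y))).
      assert (Rabs (p + - (2)) < 1) by lra. apply Rabs_lt_between in H0. simpl. lra. }
  exists (/ 4). split; [lra|]. intros s Hs.
  replace s with ((u, / 4)%R + (s - (u, / 4)%R))%C by ring.
  assert (Hc : Cmod (s - (u, / 4)%R) <= / 2).
  { replace (s - (u, / 4)%R)%C with ((s - RtoC u) + (0, - / 4)%R)%C
      by (destruct s; unfold Cminus, Cplus, Copp, RtoC; simpl; f_equal; ring).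
    eapply Rle_trans; [apply Cmod_triangle|].
    pose proof (Cmod_le_sum 0 (- / 4)). rewrite Rabs_R0, Rabs_Ropp, (Rabs_pos_eq (/ 4)) in H by lra. lra. }
  apply (vanish_disc g (u, / 4)%R (s - (u, / 4)%R)%C (/ 4)).
  - intros z Hzz. apply Hd. intros ->.
    pose proof (Rmax_Cmod (1 - (u, / 4)%R)%C) as HR. simpl in HR.
    pose proof (Rmax_l (Rabs (1 + - u)) (Rabs (0 + - / 4))).
    pose proof (Rle_abs (1 + - u)). lra.
  - lra.
  - intros [p q] Hzz. apply Up.
    pose proof (Rmax_Cmod ((p, q) - (u, / 4)%R)%C) as HR. simpl in HR.
    pose proof (Rmax_r (Rabs (p + - u)) (Rabs (q + - / 4))).
    assert (Rabs (q + - / 4) < / 4) by lra. apply Rabs_lt_between in H0. lra.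
Qed.

(** * Euler-Maclaurin summation *)

Lemma sum_n_SR (a : nat -> R) (n : nat) : sum_n a (S n) = sum_n a n + a (S n).
Proof. exact (sum_Sn (G := R_AbelianMonoid) a n). Qed.

(* With the Bernoulli polynomials [B_p(u)] and numbers [B_p = B_p(0)]: [beta p = B_p / p!], and
   [emq p u = (-1)^p (B_{p+1}(u) - B_{p+1}) / (p+1)!] for [p >= 1]. *)
Fixpoint emq (p : nat) (u : R) : R :=
  match p with
  | O => u - 1
  | S p => u * RInt (emq p) 0 1 - RInt (emq p) 0 u
  end.

Definition beta (p : nat) : R :=
  match p with
  | O => 1
  | S p => RInt (emq p) 0 1
  end.

Lemma RInt_primitive (f : R -> R) (x : R) : (forall t, continuous f t) ->
  is_derive (fun u => RInt f 0 u) x (f x).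
Proof.
  intros Hf. apply (is_derive_RInt (V := R_NormedModule) f (fun u => RInt f 0 u) 0).
  - exists (mkposreal _ Rlt_0_1). intros y _.
    apply (RInt_correct (V := R_CompleteNormedModule)).
    apply (ex_RInt_continuous (V := R_CompleteNormedModule)). auto.
  - apply Hf.
Qed.

Lemma continuous_emq (p : nat) : forall u, continuous (emq p) u.
Proof.
  induction p as [|p IH]; intros u; cbn [emq].
  - by_derive.
  - apply continuous_Rminus.
    + by_derive.
    + apply continuous_of_derivable. eexists. apply RInt_primitive. exact IH.
Qed.

Lemma emq_S_derive (p : nat) (u : R) : is_derive (emq (S p)) u (beta (S p) - emq p u).
Proof.
  cbn [emq beta]. apply (is_derive_minus (V := R_NormedModule)).
  - auto_derive; auto. apply Rmult_1_l.
  - apply RInt_primitive, continuous_emq.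
Qed.

Lemma emq_S_0 (p : nat) : emq (S p) 0 = 0.
Proof. cbn [emq]. rewrite (RInt_point (V := R_CompleteNormedModule)). unfold zero; simpl. ring. Qed.

Lemma emq_S_1 (p : nat) : emq (S p) 1 = 0.
Proof. cbn [emq]. ring. Qed.

Lemma emq_bound (p : nat) (u : R) : 0 <= u <= 1 -> Rabs (emq p u) <= 2 ^ p.
Proof.
  revert u; induction p as [|p IH]; intros u Hu; cbn [emq].
  - simpl. apply Rabs_le. lra.
  - assert (H : forall v, 0 <= v <= 1 -> Rabs (RInt (emq p) 0 v) <= 2 ^ p).
    { intros v Hv. apply Rle_trans with ((v - 0) * 2 ^ p).
      - apply abs_RInt_le_const; [lra| |intros; apply IH; lra].
        apply ex_RInt_cont; [lra|]. intros; apply continuous_emq.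
      - assert (0 < 2 ^ p) by (apply pow_lt; lra). nra. }
    unfold Rminus. eapply Rle_trans; [apply Rabs_triang|]. rewrite Rabs_Ropp, Rabs_mult, (Rabs_pos_eq u) by lra.
    pose proof (H u Hu). pose proof (H 1 ltac:(lra)). simpl.
    pose proof (Rabs_pos (RInt (emq p) 0 1)). nra.
Qed.

Definition ladder (f : nat -> R -> R) : Prop :=
  forall n x, 0 < x -> is_derive (f n) x (f (S n) x).

Definition em_sum (p : nat) (f : nat -> R -> R) (x : R) : R := sum_n (fun j => beta j * f j x) p.

Definition em_rem (p : nat) (f : nat -> R -> R) (x : R) : R :=
  f 1%nat x - (em_sum p f (x + 1) - em_sum p f x).

Lemma is_derive_shift (f : R -> R) (x u l : R) : is_derive f (x + u) l ->
  is_derive (fun v => f (x + v)) u l.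
Proof.
  intros H. replace l with (1 * l) by ring.
  apply (is_derive_comp (V := R_NormedModule) f (fun v => x + v)); [exact H|].
  auto_derive; auto.
Qed.

Lemma ladder_continuous (f : nat -> R -> R) (n : nat) (x : R) : ladder f -> 0 < x -> continuous (f n) x.
Proof. intros Hf Hx. apply continuous_of_derivable. eexists. apply Hf, Hx. Qed.

Lemma ladder_continuous_shift (f : nat -> R -> R) (n : nat) (x u : R) : ladder f -> 0 < x + u ->
  continuous (fun v => f n (x + v)) u.
Proof.
  intros Hf Hx. apply continuous_of_derivable. eexists. apply is_derive_shift, Hf, Hx.
Qed.

Lemma RInt_derive_le (F f : R -> R) (a b : R) : a <= b ->
  (forall x, a <= x <= b -> is_derive F x (f x)) -> (forall x, a <= x <= b -> continuous f x) ->
  RInt f a b = F b - F a.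
Proof.
  intros Hab HF Hf. apply (is_RInt_unique (V := R_CompleteNormedModule)).
  apply (is_RInt_derive (V := R_CompleteNormedModule) F f);
    rewrite Rmin_left, Rmax_right by lra; auto.
Qed.

Theorem euler_maclaurin (p : nat) (f : nat -> R -> R) (x : R) : ladder f -> 0 < x ->
  em_rem p f x = RInt (fun u => emq p u * f (p + 2)%nat (x + u)) 0 1.
Proof.
  intros Hf Hx.
  assert (Hc : forall n u, 0 <= u <= 1 -> continuous (fun v => f n (x + v)) u)
    by (intros; apply ladder_continuous_shift; auto; lra).
  assert (Hd : forall n u, 0 <= u <= 1 -> is_derive (fun v => f n (x + v)) u (f (S n) (x + u)))
    by (intros; apply is_derive_shift, Hf; lra).
  induction p as [|p IH].
  - rewrite (RInt_derive_le (fun u => (u - 1) * f 1%nat (x + u) - f 0%nat (x + u))).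
    + unfold em_rem, em_sum. rewrite !sum_O. unfold beta. rewrite Rplus_0_r. ring.
    + lra.
    + intros u Hu. cbn [emq].
      replace ((u - 1) * f (0 + 2)%nat (x + u)) with
        ((1 * f 1%nat (x + u) + (u - 1) * f 2%nat (x + u)) - f 1%nat (x + u)) by (simpl Nat.add; ring).
      apply (is_derive_minus (V := R_NormedModule)); [|auto].
      apply (is_derive_mult (K := R_AbsRing) (fun u => u - 1) (fun v => f 1%nat (x + v))); auto.
      * auto_derive; auto.
      * apply Rmult_comm.
    + intros u Hu. apply continuous_Rmult; [apply continuous_emq|auto].
  - assert (E : em_rem (S p) f x = em_rem p f x - beta (S p) * (f (S p) (x + 1) - f (S p) x)).
    { unfold em_rem, em_sum. rewrite !sum_n_SR. ring. }
    rewrite E, IH.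
    assert (E1 : RInt (fun u => f (p + 2)%nat (x + u)) 0 1 = f (S p) (x + 1) - f (S p) x).
    { rewrite (RInt_derive_le (fun v => f (S p) (x + v))); auto; try lra.
      - now rewrite Rplus_0_r.
      - intros. replace (p + 2)%nat with (S (S p)) by lia. auto. }
    assert (E2 : RInt (fun u => (beta (S p) - emq p u) * f (p + 2)%nat (x + u)
        + emq (S p) u * f (S p + 2)%nat (x + u)) 0 1 = 0).
    { rewrite (RInt_derive_le (fun u => emq (S p) u * f (p + 2)%nat (x + u))).
      - rewrite emq_S_0, emq_S_1. lra.
      - lra.
      - intros u Hu.
        apply (is_derive_mult (K := R_AbsRing) (emq (S p)) (fun v => f (p + 2)%nat (x + v))).
        + apply emq_S_derive.
        + now apply Hd.
        + apply Rmult_comm.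
      - intros u Hu. cont; auto using continuous_emq. }
    rewrite RInt_Rplus in E2; [|lra| |].
    + rewrite (RInt_ext_le (fun u => (beta (S p) - emq p u) * f (p + 2)%nat (x + u))
        (fun u => beta (S p) * f (p + 2)%nat (x + u) - emq p u * f (p + 2)%nat (x + u))) in E2
        by (intros; lra).
      rewrite RInt_Rminus, RInt_Rscal, E1 in E2; [lra| | | | |]; try lra; intros; cont;
        auto using continuous_emq.
    + intros u Hu. cont; auto using continuous_emq.
    + intros u Hu. cont; auto using continuous_emq.
Qed.

Lemma em_rem_bound (p : nat) (f : nat -> R -> R) (x M : R) : ladder f -> 0 < x ->
  (forall y, x <= y <= x + 1 -> Rabs (f (p + 2)%nat y) <= M) ->
  Rabs (em_rem p f x) <= 2 ^ p * M.
Proof.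
  intros Hf Hx HM. rewrite euler_maclaurin by auto.
  replace (2 ^ p * M) with ((1 - 0) * (2 ^ p * M)) by ring.
  apply abs_RInt_le_const; [lra| |].
  - apply ex_RInt_cont; [lra|]. intros u Hu. apply continuous_Rmult; [apply continuous_emq|].
    apply ladder_continuous_shift; auto; lra.
  - intros u Hu. rewrite Rabs_mult. apply Rmult_le_compat; try apply Rabs_pos.
    + now apply emq_bound.
    + apply HM. lra.
Qed.

Lemma ladder_shift (f : nat -> R -> R) (i : nat) : ladder f -> ladder (fun n => f (i + n)%nat).
Proof. intros Hf n x Hx. rewrite Nat.add_succ_r. now apply Hf. Qed.

(** * Limits of sequences of holomorphic functions *)

Definition climit (u : nat -> C) (l : C) : Prop :=
  forall e, 0 < e -> exists N, forall n, (N <= n)%nat -> Cmod (u n - l) < e.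

Lemma climit_unique (u : nat -> C) (l l' : C) : climit u l -> climit u l' -> l = l'.
Proof.
  intros H H'. destruct (Ceq_dec l l') as [|Hne]; [assumption|exfalso].
  assert (Hp : 0 < Cmod (l - l')).
  { apply Cmod_gt_0. intros E. apply Hne. replace l with ((l - l') + l')%C by ring. rewrite E. ring. }
  destruct (H (Cmod (l - l') / 2)) as [N HN]; [lra|].
  destruct (H' (Cmod (l - l') / 2)) as [N' HN']; [lra|].
  specialize (HN (N + N')%nat ltac:(lia)). specialize (HN' (N + N')%nat ltac:(lia)).
  pose proof (Cmod_triangle (u (N + N')%nat - l') (- (u (N + N')%nat - l))) as T.
  rewrite Cmod_opp in T.
  replace (u (N + N')%nat - l' + - (u (N + N')%nat - l))%C with (l - l')%C in T by ring. lra.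
Qed.

Lemma climit_ext (u v : nat -> C) (l : C) : (forall n, u n = v n) -> climit u l -> climit v l.
Proof. intros H Hu e He. destruct (Hu e He) as [N HN]. exists N. intros n Hn. rewrite <- H. auto. Qed.

Lemma climit_plus (u v : nat -> C) (l l' : C) : climit u l -> climit v l' ->
  climit (fun n => u n + v n)%C (l + l')%C.
Proof.
  intros H H' e He. destruct (H (e / 2)) as [N HN]; [lra|]. destruct (H' (e / 2)) as [N' HN']; [lra|].
  exists (N + N')%nat. intros n Hn. specialize (HN n ltac:(lia)). specialize (HN' n ltac:(lia)).
  replace (u n + v n - (l + l'))%C with ((u n - l) + (v n - l'))%C by ring.
  eapply Rle_lt_trans; [apply Cmod_triangle|]. lra.
Qed.

Lemma climit_const (c : C) : climit (fun _ => c) c.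
Proof.
  intros e He. exists 0%nat. intros n _. replace (c - c)%C with (RtoC 0) by ring. now rewrite Cmod_0.
Qed.

Lemma climit_scal (c : C) (u : nat -> C) (l : C) : climit u l -> climit (fun n => c * u n)%C (c * l)%C.
Proof.
  intros H e He. pose proof (Cmod_ge_0 c).
  destruct (H (e / (Cmod c + 1))) as [N HN]; [apply Rdiv_lt_0_compat; lra|].
  exists N. intros n Hn. specialize (HN n Hn).
  replace (c * u n - c * l)%C with (c * (u n - l))%C by ring. rewrite Cmod_mult.
  apply (Rmult_lt_compat_r (Cmod c + 1)) in HN; [|lra].
  replace (e / (Cmod c + 1) * (Cmod c + 1)) with e in HN by (field; lra).
  pose proof (Cmod_ge_0 (u n - l)). nra.
Qed.

Lemma climit_incr_1 (u : nat -> C) (l : C) : climit u l <-> climit (fun n => u (S n)) l.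
Proof.
  split; intros H e He; destruct (H e He) as [N HN].
  - exists N. intros n Hn. apply HN. lia.
  - exists (S N). intros [|n] Hn; [lia|]. apply HN. lia.
Qed.

Lemma climit_real (u : nat -> C) (l : C) :
  is_lim_seq (fun n => Re (u n)) (Re l) -> is_lim_seq (fun n => Im (u n)) (Im l) -> climit u l.
Proof.
  intros H H' e He. apply is_lim_seq_spec in H. apply is_lim_seq_spec in H'.
  destruct (H (mkposreal (e / 2) ltac:(lra))) as [N HN].
  destruct (H' (mkposreal (e / 2) ltac:(lra))) as [N' HN'].
  exists (N + N')%nat. intros n Hn. specialize (HN n ltac:(lia)). specialize (HN' n ltac:(lia)).
  simpl in HN, HN'. pose proof (Cmod_le_sum (Re (u n) - Re l) (Im (u n) - Im l)).
  change (u n - l)%C with (Re (u n) - Re l, Im (u n) - Im l)%R. lra.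
Qed.

Lemma climit_Re (u : nat -> C) (l : C) : climit u l -> is_lim_seq (fun n => Re (u n)) (Re l).
Proof.
  intros H. apply is_lim_seq_spec. intros e. destruct (H e (cond_pos e)) as [N HN].
  exists N. intros n Hn. specialize (HN n Hn). eapply Rle_lt_trans; [|exact HN].
  change (Re (u n) - Re l) with (Re (u n - l)%C). apply re_le_Cmod.
Qed.

Lemma Cmod_sum_bound (u : nat -> C) (M : R) :
  (forall K, (1 <= K)%nat -> Cmod (u (S K) - u K) <= M / (INR K * INR K)) ->
  forall N k, (1 <= N)%nat ->
  Cmod (u (N + k)%nat - u N) <= 2 * M * (/ INR N - / INR (N + k)).
Proof.
  intros Hu N k HN. induction k as [|k IH].
  - rewrite Nat.add_0_r. replace (u N - u N)%C with (RtoC 0) by ring. rewrite Cmod_0. lra.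
  - specialize (Hu (N + k)%nat ltac:(lia)). rewrite Nat.add_succ_r.
    replace (u (S (N + k)) - u N)%C with ((u (S (N + k)) - u (N + k)%nat) + (u (N + k)%nat - u N))%C by ring.
    eapply Rle_trans; [apply Cmod_triangle|].
    assert (HK : 1 <= INR (N + k)) by (apply (le_INR 1); lia).
    rewrite (S_INR (N + k)). set (x := INR (N + k)) in *.
    assert (HM : 0 <= M).
    { pose proof (Cmod_ge_0 (u (S (N + k)) - u (N + k)%nat)).
      assert (0 <= M / (x * x) * (x * x)) by (apply Rmult_le_pos; nra).
      replace (M / (x * x) * (x * x)) with M in H0 by (field; lra). exact H0. }
    assert (M / (x * x) <= 2 * M * (/ x - / (x + 1))).
    { replace (2 * M * (/ x - / (x + 1))) with (M * (2 / (x * (x + 1)))) by (field; lra).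
      apply Rmult_le_compat_l; [exact HM|].
      replace (2 / (x * (x + 1))) with (/ (x * (x + 1) / 2)) by (field; lra).
      apply Rinv_le_contravar; nra. }
    lra.
Qed.

Lemma climit_of_increments (u : nat -> C) (M : R) :
  (forall K, (1 <= K)%nat -> Cmod (u (S K) - u K) <= M / (INR K * INR K)) ->
  exists l, climit u l /\ forall N, (1 <= N)%nat -> Cmod (u N - l) <= 2 * M / INR N.
Proof.
  intros Hu. pose proof (Cmod_sum_bound u M Hu) as Hb.
  assert (HM : 0 <= M).
  { specialize (Hu 1%nat (le_n _)). pose proof (Cmod_ge_0 (u 2%nat - u 1%nat)). simpl in Hu. lra. }
  assert (Hb2 : forall N K, (1 <= N)%nat -> (N <= K)%nat -> Cmod (u K - u N) <= 2 * M / INR N).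
  { intros N K HN HK. specialize (Hb N (K - N)%nat HN). replace (N + (K - N))%nat with K in Hb by lia.
    eapply Rle_trans; [exact Hb|]. unfold Rdiv. apply Rmult_le_compat_l; [lra|].
    assert (0 < / INR K) by (apply Rinv_0_lt_compat, lt_0_INR; lia). lra. }
  assert (Hc : forall e, 0 < e -> exists N, (1 <= N)%nat /\ 2 * M / INR N < e).
  { intros e He. destruct (nfloor_ex (2 * M / e)) as [N HN].
    { apply Rmult_le_pos; [lra|]. left; now apply Rinv_0_lt_compat. }
    exists (S N). split; [lia|]. rewrite S_INR.
    assert (0 < INR N + 1) by (pose proof (pos_INR N); lra).
    apply (Rmult_lt_reg_r (INR N + 1)); [lra|].
    replace (2 * M / (INR N + 1) * (INR N + 1)) with (2 * M / e * e) by (field; lra).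
    rewrite (Rmult_comm e). apply Rmult_lt_compat_r; lra. }
  assert (Hcauchy : forall (pr : C -> R), (forall x y, Rabs (pr x - pr y) <= Cmod (x - y)) ->
      ex_finite_lim_seq (fun n => pr (u n))).
  { intros pr Hpr. apply ex_lim_seq_cauchy_corr. intros e.
    destruct (Hc (e / 2) ltac:(destruct e; simpl; lra)) as [N [HN1 HN2]].
    exists N. intros n m Hn Hm. eapply Rle_lt_trans; [apply Hpr|].
    replace (u n - u m)%C with ((u n - u N) - (u m - u N))%C by ring.
    eapply Rle_lt_trans; [apply Cmod_triangle|]. rewrite Cmod_opp.
    pose proof (Hb2 N n HN1 Hn). pose proof (Hb2 N m HN1 Hm). lra. }
  destruct (Hcauchy Re) as [l1 H1].
  { intros. change (Re x - Re y) with (Re (x - y)%C). apply re_le_Cmod. }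
  destruct (Hcauchy Im) as [l2 H2].
  { intros. change (Im x - Im y) with (Im (x - y)%C).
    eapply Rle_trans; [|apply Rmax_Cmod]. apply Rmax_r. }
  exists (l1, l2). assert (HL : climit u (l1, l2)) by (apply climit_real; assumption).
  split; [exact HL|]. intros N HN. apply le_epsilon. intros e He. destruct (HL e He) as [K HK].
  specialize (HK (N + K)%nat ltac:(lia)). specialize (Hb2 N (N + K)%nat HN ltac:(lia)).
  replace (u N - (l1, l2))%C with ((u (N + K)%nat - (l1, l2)) - (u (N + K)%nat - u N))%C by ring.
  eapply Rle_trans; [apply Cmod_triangle|]. rewrite Cmod_opp. lra.
Qed.

Lemma Rderiv_of_eps (f : R -> R) (x l : R) :
  (forall e, 0 < e -> exists d, 0 < d /\ forall y, Rabs (y - x) < d ->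
    Rabs (f y - f x - l * (y - x)) <= e * Rabs (y - x)) -> is_derive f x l.
Proof.
  intros H. split; [apply is_linear_scal_l|]. intros z Hz.
  apply (is_filter_lim_locally_unique (K := R_AbsRing) (V := AbsRing_NormedModule R_AbsRing)) in Hz.
  subst z. intros eps. destruct (H eps (cond_pos eps)) as [d [Hd Hf]].
  exists (mkposreal d Hd). intros t Ht.
  change (Rabs (f t - f x - (t - x) * l) <= eps * Rabs (t - x)).
  rewrite (Rmult_comm (t - x)). apply Hf. exact Ht.
Qed.

Lemma cderiv_segment (g : C -> C) (z h l : C) (t : R) (pr : C -> R) :
  (forall x y, pr (x - y)%C = pr x - pr y) -> (forall x (r : R), pr (x * RtoC r)%C = pr x * r) ->
  (forall x, Rabs (pr x) <= Cmod x) ->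
  cderiv g (z + RtoC t * h)%C l ->
  is_derive (fun t => pr (g (z + RtoC t * h)%C)) t (pr (l * h)%C).
Proof.
  intros Hm Hs Hb Hg. apply Rderiv_of_eps. intros e He.
  pose proof (Cmod_ge_0 h) as Hh.
  destruct (Hg (e / (Cmod h + 1))) as [d [Hd Hy]]; [apply Rdiv_lt_0_compat; lra|].
  exists (d / (Cmod h + 1)). split; [apply Rdiv_lt_0_compat; lra|].
  intros y Hyt.
  assert (E : (z + RtoC y * h - (z + RtoC t * h))%C = (h * RtoC (y - t))%C)
    by (rewrite RtoC_minus; ring).
  specialize (Hy (z + RtoC y * h)%C). rewrite E, Cmod_mult, Cmod_R in Hy.
  apply (Rmult_lt_compat_r (Cmod h + 1)) in Hyt; [|lra].
  replace (d / (Cmod h + 1) * (Cmod h + 1)) with d in Hyt by (field; lra).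
  pose proof (Rabs_pos (y - t)).
  specialize (Hy ltac:(nra)).
  rewrite <- Hm, <- Hs, <- Hm. rewrite <- Cmult_assoc.
  eapply Rle_trans; [apply Hb|]. eapply Rle_trans; [exact Hy|].
  rewrite <- Rmult_assoc. apply Rmult_le_compat_r; [lra|].
  apply (Rmult_le_reg_r (Cmod h + 1)); [lra|].
  replace (e / (Cmod h + 1) * Cmod h * (Cmod h + 1)) with (e * Cmod h) by (field; lra). nra.
Qed.

Lemma cderiv_mean_value (g g' : C -> C) (z y : C) (d B : R) :
  (forall s, Cmod (s - z) < d -> cderiv g s (g' s)) ->
  (forall s, Cmod (s - z) < d -> Cmod (g' s) <= B) ->
  Cmod (y - z) < d -> Cmod (g y - g z) <= 2 * B * Cmod (y - z).
Proof.
  intros Hg HB Hy.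
  assert (Hin : forall t, 0 <= t <= 1 -> Cmod (z + RtoC t * (y - z) - z) < d).
  { intros t Ht. replace (z + RtoC t * (y - z) - z)%C with (RtoC t * (y - z))%C by ring.
    rewrite Cmod_mult, Cmod_R, Rabs_pos_eq by lra. pose proof (Cmod_ge_0 (y - z)). nra. }
  assert (K : forall pr : C -> R, (forall x y, pr (x - y)%C = pr x - pr y) ->
    (forall x (r : R), pr (x * RtoC r)%C = pr x * r) -> (forall x, Rabs (pr x) <= Cmod x) ->
    Rabs (pr (g y - g z)%C) <= B * Cmod (y - z)).
  { intros pr Hm Hs Hb.
    assert (Hd : forall t, 0 <= t <= 1 -> is_derive (fun t => pr (g (z + RtoC t * (y - z))%C)) t
       (pr (g' (z + RtoC t * (y - z)) * (y - z))%C)).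
    { intros t Ht. apply cderiv_segment; auto. }
    destruct (MVT_gen (fun t => pr (g (z + RtoC t * (y - z))%C)) 0 1
      (fun t => pr (g' (z + RtoC t * (y - z)) * (y - z))%C)) as [c [Hc Ec]].
    - rewrite Rmin_left, Rmax_right by lra. intros; apply Hd; lra.
    - rewrite Rmin_left, Rmax_right by lra. intros. apply continuity_pt_filterlim.
      apply continuous_of_derivable. eexists. apply Hd; lra.
    - rewrite Rmin_left, Rmax_right in Hc by lra.
      replace (z + RtoC 1 * (y - z))%C with y in Ec by ring.
      replace (z + RtoC 0 * (y - z))%C with z in Ec by ring.
      rewrite Hm, Ec, Rminus_0_r, Rmult_1_r.
      eapply Rle_trans; [apply Hb|]. rewrite Cmod_mult.
      apply Rmult_le_compat_r; [apply Cmod_ge_0|]. apply HB, Hin, Hc. }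
  assert (K1 := K Re). assert (K2 := K Im).
  specialize (K1 ltac:(reflexivity)). specialize (K2 ltac:(reflexivity)).
  specialize (K1 ltac:(intros [? ?] ?; simpl; ring)). specialize (K2 ltac:(intros [? ?] ?; simpl; ring)).
  specialize (K1 re_le_Cmod).
  specialize (K2 ltac:(intros x; eapply Rle_trans; [|apply Rmax_Cmod]; apply Rmax_r)).
  pose proof (Cmod_le_sum (Re (g y - g z)%C) (Im (g y - g z)%C)) as Hs.
  replace (Re (g y - g z), Im (g y - g z))%C with (g y - g z)%C in Hs
    by (destruct (g y - g z)%C; reflexivity). lra.
Qed.

Theorem cderiv_limit (f f' : nat -> C -> C) (F : C -> C) (z : C) (d M : R) : 0 < d ->
  (forall K s, Cmod (s - z) < d -> cderiv (f K) s (f' K s)) ->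
  (forall K s, (1 <= K)%nat -> Cmod (s - z) < d -> Cmod (f' (S K) s - f' K s) <= M / (INR K * INR K)) ->
  (forall s, Cmod (s - z) < d -> climit (fun K => f K s) (F s)) ->
  exists l, climit (fun K => f' K z) l /\ cderiv F z l.
Proof.
  intros Hd Hf Hinc HF.
  assert (Hzz : Cmod (z - z) < d) by (replace (z - z)%C with (RtoC 0) by ring; now rewrite Cmod_0).
  destruct (climit_of_increments (fun K => f' K z) M) as [l [Hl Hlb]]; [intros; apply Hinc; auto|].
  exists l. split; [exact Hl|].
  assert (HM : 0 <= M).
  { specialize (Hinc 1%nat z (le_n _) Hzz). pose proof (Cmod_ge_0 (f' 2%nat z - f' 1%nat z)). simpl in Hinc. lra. }
  intros e He.
  destruct (nfloor_ex (12 * M / e)) as [N0 HN0].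
  { apply Rmult_le_pos; [lra|]. left; now apply Rinv_0_lt_compat. }
  set (N := S N0).
  assert (HN : 6 * M / INR N <= e / 2).
  { unfold N. rewrite S_INR. assert (0 < INR N0 + 1) by (pose proof (pos_INR N0); lra).
    apply (Rmult_le_reg_r (INR N0 + 1)); [lra|].
    replace (6 * M / (INR N0 + 1) * (INR N0 + 1)) with (12 * M / e * e / 2) by (field; lra).
    assert (12 * M / e * e <= (INR N0 + 1) * e) by (apply Rmult_le_compat_r; lra). lra. }
  assert (HN1 : (1 <= N)%nat) by (unfold N; lia).
  destruct (Hf N z Hzz (e / 2)) as [d' [Hd' Hf']]; [lra|].
  exists (Rmin d d'). split; [now apply Rmin_pos|]. intros y Hy.
  assert (Hy1 : Cmod (y - z) < d) by (eapply Rlt_le_trans; [exact Hy|apply Rmin_l]).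
  assert (Hy2 : Cmod (y - z) < d') by (eapply Rlt_le_trans; [exact Hy|apply Rmin_r]).
  specialize (Hf' y Hy2). specialize (Hlb N HN1).
  destruct (climit_of_increments (fun K => f K y - f K z)%C (2 * M * Cmod (y - z))) as [l2 [Hl2 Hlb2]].
  { intros K HK.
    replace (f (S K) y - f (S K) z - (f K y - f K z))%C with
      ((fun s => f (S K) s - f K s)%C y - (fun s => f (S K) s - f K s)%C z)%C by ring.
    replace (2 * M * Cmod (y - z) / (INR K * INR K)) with (2 * (M / (INR K * INR K)) * Cmod (y - z)).
    2: { field. apply not_0_INR. lia. }
    apply (cderiv_mean_value (fun s => f (S K) s - f K s)%C (fun s => f' (S K) s - f' K s)%C z y d); auto.
    intros s Hs. apply cderiv_minus; auto. }
  assert (E : l2 = (F y - F z)%C).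
  { apply (climit_unique _ _ _ Hl2).
    apply (climit_ext (fun K => f K y + (- (1)) * f K z)%C); [intros; ring|].
    replace (F y - F z)%C with (F y + (- (1)) * F z)%C by ring.
    apply climit_plus; [auto|apply climit_scal; auto]. }
  subst l2. specialize (Hlb2 N HN1).
  replace (F y - F z - l * (y - z))%C with
    ((f N y - f N z - f' N z * (y - z)) + ((f' N z - l) * (y - z) - ((f N y - f N z) - (F y - F z))))%C by ring.
  eapply Rle_trans; [apply Cmod_triangle|].
  pose proof (Cmod_triangle ((f' N z - l) * (y - z)) (- ((f N y - f N z) - (F y - F z)))) as T.
  rewrite Cmod_opp, Cmod_mult in T.
  pose proof (Cmod_ge_0 (y - z)).
  assert (Cmod (f' N z - l) * Cmod (y - z) <= 2 * M / INR N * Cmod (y - z)) by (apply Rmult_le_compat_r; lra).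
  assert (6 * M / INR N * Cmod (y - z) <= e / 2 * Cmod (y - z)) by (apply Rmult_le_compat_r; lra).
  unfold Cminus in *. unfold Rdiv in *. nra.
Qed.

(** * The Hurwitz zeta function and its derivative *)

Definition lpow (A B t : C) (x : R) : C := ((A + B * RtoC (ln x)) * cpow_neg x t)%C.

Lemma lpow_derive (A B t : C) (x : R) : 0 < x ->
  is_derive (fun y => Re (lpow A B t y)) x (Re (lpow (B - t * A) (- (t * B)) (t + 1) x)) /\
  is_derive (fun y => Im (lpow A B t y)) x (Im (lpow (B - t * A) (- (t * B)) (t + 1) x)).
Proof.
  intros Hx. destruct A as [a1 a2], B as [b1 b2], t as [u v].
  assert (E : exp (- (u + 1) * ln x) = exp (- u * ln x) * / x).
  { replace (- (u + 1) * ln x) with (- u * ln x + - ln x) by ring.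
    rewrite exp_plus, exp_Ropp, exp_ln by exact Hx. reflexivity. }
  unfold lpow, cpow_neg, Re, Im, Cmult, Cplus, Cminus, Copp, RtoC; simpl. rewrite E, Rplus_0_r.
  split; (auto_derive; [repeat split; auto|field; lra]).
Qed.

Lemma Cmod_cpow_neg (x : R) (t : C) : Cmod (cpow_neg x t) = exp (- Re t * ln x).
Proof.
  rewrite cpow_neg_cexp, Cmod_cexp. f_equal. destruct t; simpl. ring.
Qed.

Definition tau (n : nat) (s : C) : C := (s + RtoC (INR n) - 1)%C.

Fixpoint cF (n : nat) (s : C) : C :=
  match n with
  | O => / (1 - s)
  | S n => - (tau n s * cF n s)
  end%C.

Fixpoint cG (n : nat) (s : C) : C :=
  match n with
  | O => / (1 - s) * / (1 - s)
  | S n => - cF n s - tau n s * cG n s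
  end%C.

(* [pF n s] is the n-th derivative in [x] of x^(1-s)/(1-s), and [pG n s] its derivative in [s]. *)
Definition pF (n : nat) (s : C) (x : R) : C := lpow (cF n s) 0 (tau n s) x.
Definition pG (n : nat) (s : C) (x : R) : C := lpow (cG n s) (- cF n s) (tau n s) x.

Lemma tau_S (n : nat) (s : C) : tau (S n) s = (tau n s + 1)%C.
Proof. unfold tau. rewrite S_INR, RtoC_plus. ring. Qed.

Lemma ladder_pF (s : C) :
  ladder (fun n x => Re (pF n s x)) /\ ladder (fun n x => Im (pF n s x)).
Proof.
  assert (E : forall n x, pF (S n) s x = lpow (0 - tau n s * cF n s) (- (tau n s * 0)) (tau n s + 1) x).
  { intros n x. unfold pF. rewrite tau_S. cbn [cF]. f_equal; ring. }
  split; intros n x Hx; rewrite E; apply lpow_derive; exact Hx.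
Qed.

Lemma ladder_pG (s : C) :
  ladder (fun n x => Re (pG n s x)) /\ ladder (fun n x => Im (pG n s x)).
Proof.
  assert (E : forall n x, pG (S n) s x = lpow (- cF n s - tau n s * cG n s) (- (tau n s * - cF n s)) (tau n s + 1) x).
  { intros n x. unfold pG. rewrite tau_S. cbn [cF cG]. f_equal; ring. }
  split; intros n x Hx; rewrite E; apply lpow_derive; exact Hx.
Qed.

Lemma Csub_neq_0 (s : C) : s <> RtoC 1 -> (1 - s)%C <> RtoC 0.
Proof. intros H E. apply H. replace s with (1 - (1 - s))%C by ring. rewrite E. ring. Qed.

Lemma cderiv_inv (z : C) : z <> RtoC 0 -> cderiv Cinv z (- (/ z * / z))%C.
Proof.
  intros Hz e He. assert (Hm : 0 < Cmod z) by now apply Cmod_gt_0.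
  set (m := Cmod z) in *.
  exists (Rmin (m / 2) (e * (m * m * m) / 2)).
  assert (Hm3 : 0 < m * m * m) by (repeat apply Rmult_lt_0_compat; lra).
  split; [apply Rmin_pos; nra|]. intros y Hy.
  assert (H1 : Cmod (y - z) < m / 2) by (eapply Rlt_le_trans; [exact Hy|apply Rmin_l]).
  assert (H2 : Cmod (y - z) < e * (m * m * m) / 2) by (eapply Rlt_le_trans; [exact Hy|apply Rmin_r]).
  assert (Hy0 : m / 2 <= Cmod y).
  { pose proof (Cmod_triangle y (z - y)) as T. replace (y + (z - y))%C with z in T by ring.
    rewrite (Cmod_sub_sym z y) in T. fold m in T. lra. }
  assert (Hyn : y <> RtoC 0) by (intros ->; rewrite Cmod_0 in Hy0; lra).
  replace (/ y - / z - - (/ z * / z) * (y - z))%C with ((y - z) * (y - z) * / (y * (z * z)))%C.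
  2: { field. auto. }
  rewrite !Cmod_mult, Cmod_inv, !Cmod_mult by (repeat apply Cmult_neq_0; auto). fold m.
  pose proof (Cmod_ge_0 (y - z)).
  assert (Hinv : Cmod (y - z) * / (Cmod y * (m * m)) <= e).
  { apply (Rmult_le_reg_r (Cmod y * (m * m))); [nra|].
    rewrite Rmult_assoc, Rinv_l, Rmult_1_r by nra.
    assert (e * (m / 2 * (m * m)) <= e * (Cmod y * (m * m))).
    { apply Rmult_le_compat_l; [lra|]. apply Rmult_le_compat_r; [nra|exact Hy0]. }
    lra. }
  rewrite Rmult_assoc, Rmult_comm. apply Rmult_le_compat_r; lra.
Qed.

Lemma cderiv_inv_sub (s : C) : s <> RtoC 1 -> cderiv (fun s => / (1 - s))%C s (/ (1 - s) * / (1 - s))%C.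
Proof.
  intros Hs. eapply cderiv_eq; [|apply (cderiv_comp Cinv (fun s => 1 - s)%C)].
  2: { apply cderiv_inv, Csub_neq_0, Hs. }
  2: { apply cderiv_minus; [apply cderiv_const|apply cderiv_id]. }
  ring.
Qed.

Lemma cderiv_tau (n : nat) (s : C) : cderiv (tau n) s 1.
Proof.
  unfold tau. eapply cderiv_eq;
  [|apply cderiv_minus; [apply cderiv_plus; [apply cderiv_id|apply cderiv_const]|apply cderiv_const]].
  ring.
Qed.

Lemma cderiv_cF (n : nat) (s : C) : s <> RtoC 1 -> cderiv (cF n) s (cG n s).
Proof.
  intros Hs. induction n as [|n IH]; cbn [cF cG].
  - now apply cderiv_inv_sub.
  - eapply cderiv_eq; [|apply cderiv_opp, cderiv_mult; [apply cderiv_tau|exact IH]]. ring.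
Qed.

Lemma ex_cderiv_cG (n : nat) (s : C) : s <> RtoC 1 -> exists l, cderiv (cG n) s l.
Proof.
  intros Hs. induction n as [|n [l IH]]; cbn [cG].
  - eexists. apply cderiv_mult; now apply cderiv_inv_sub.
  - eexists. apply cderiv_minus; [apply cderiv_opp; now apply cderiv_cF|].
    apply cderiv_mult; [apply cderiv_tau|exact IH].
Qed.

Lemma cderiv_locally_bounded (f : C -> C) (z l : C) : cderiv f z l ->
  exists d M, 0 < d /\ 0 <= M /\ forall y, Cmod (y - z) < d -> Cmod (f y) <= M.
Proof.
  intros H. destruct (H 1 Rlt_0_1) as [d [Hd Hy]].
  exists (Rmin d 1), (Cmod (f z) + Cmod l + 1).
  pose proof (Cmod_ge_0 (f z)). pose proof (Cmod_ge_0 l).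
  split; [apply Rmin_pos; lra|]. split; [lra|]. intros y Hyz.
  assert (Y1 : Cmod (y - z) < d) by (eapply Rlt_le_trans; [exact Hyz|apply Rmin_l]).
  assert (Y2 : Cmod (y - z) < 1) by (eapply Rlt_le_trans; [exact Hyz|apply Rmin_r]).
  specialize (Hy y Y1).
  replace (f y) with ((f y - f z - l * (y - z)) + (f z + l * (y - z)))%C by ring.
  eapply Rle_trans; [apply Cmod_triangle|].
  pose proof (Cmod_triangle (f z) (l * (y - z))) as T. rewrite Cmod_mult in T.
  pose proof (Cmod_ge_0 (y - z)). nra.
Qed.

Lemma cderiv_pF (n : nat) (s : C) (x : R) : s <> RtoC 1 ->
  cderiv (fun s => pF n s x) s (pG n s x).
Proof.
  intros Hs. unfold pF, pG, lpow.
  eapply cderiv_eq; [|apply cderiv_mult].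
  2: { apply cderiv_plus; [now apply cderiv_cF|apply cderiv_const]. }
  2: { apply (cderiv_comp (cpow_neg x) (tau n)); [apply cderiv_cpow_neg|apply cderiv_tau]. }
  cbv beta; ring.
Qed.

Fixpoint csum (f : nat -> C) (n : nat) : C :=
  match n with
  | O => 0
  | S n => csum f n + f n
  end%C.

Definition hz_partial (g : nat -> R -> C) (p : nat) (a : R) (K : nat) : C :=
  (csum (fun k => g 1%nat (INR k + a)%R) K
   - csum (fun j => RtoC (beta j) * g j (INR K + a)%R) (S p))%C.

Lemma csum_proj (pr : C -> R) (f : nat -> C) (n : nat) :
  (forall x y, pr (x + y)%C = pr x + pr y) -> pr 0 = 0 ->
  pr (csum f (S n)) = sum_n (fun k => pr (f k)) n.
Proof.
  intros Hp H0. induction n as [|n IH].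
  - cbn [csum]. rewrite sum_O, Hp, H0. ring.
  - rewrite sum_n_SR, <- IH. cbn [csum]. now rewrite !Hp.
Qed.

Lemma hz_partial_step (g : nat -> R -> C) (p : nat) (a : R) (K : nat) (pr : C -> R) :
  (forall x y, pr (x + y)%C = pr x + pr y) -> (forall (r : R) x, pr (RtoC r * x)%C = r * pr x) ->
  pr (hz_partial g p a (S K) - hz_partial g p a K)%C
  = em_rem p (fun n x => pr (g n x)) (INR K + a).
Proof.
  intros Hp Hs.
  assert (H0 : pr 0 = 0).
  { replace (RtoC 0) with (RtoC 0 * 0)%C by ring. rewrite Hs. ring. }
  assert (Hm : forall x y, pr (x - y)%C = pr x - pr y).
  { intros x y. replace (x - y)%C with (x + RtoC (-1) * y)%C.
    - rewrite Hp, Hs. ring.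
    - replace (RtoC (-1)) with (- (1))%C by (now rewrite <- RtoC_opp). ring. }
  unfold hz_partial, em_rem, em_sum. rewrite !Hm. 
  change (csum (fun k => g 1%nat (INR k + a)%R) (S K)) with
    (csum (fun k => g 1%nat (INR k + a)%R) K + g 1%nat (INR K + a)%R)%C.
  rewrite Hp, !csum_proj by auto.
  rewrite (sum_n_ext (fun k => pr (RtoC (beta k) * g k (INR (S K) + a)%R)%C)
    (fun j => beta j * pr (g j (INR K + a + 1)))).
  2: { intros j. rewrite Hs. do 3 f_equal. rewrite S_INR. ring. }
  rewrite (sum_n_ext (fun k => pr (RtoC (beta k) * g k (INR K + a)%R)%C)
    (fun j => beta j * pr (g j (INR K + a)))) by (intros; apply Hs).
  ring.
Qed.

Lemma hz_partial_step_bound (g : nat -> R -> C) (p : nat) (a M : R) (K : nat) :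
  ladder (fun n x => Re (g n x)) -> ladder (fun n x => Im (g n x)) -> 0 < INR K + a ->
  (forall y, INR K + a <= y -> Cmod (g (p + 2)%nat y) <= M) ->
  Cmod (hz_partial g p a (S K) - hz_partial g p a K) <= 2 * 2 ^ p * M.
Proof.
  intros H1 H2 Hx HM.
  set (w := (hz_partial g p a (S K) - hz_partial g p a K)%C).
  assert (B1 : Rabs (Re w) <= 2 ^ p * M).
  { unfold w. rewrite hz_partial_step; [|reflexivity|intros ? [? ?]; simpl; ring].
    apply em_rem_bound; auto. intros y Hy. eapply Rle_trans; [apply re_le_Cmod|]. apply HM. lra. }
  assert (B2 : Rabs (Im w) <= 2 ^ p * M).
  { unfold w. rewrite hz_partial_step; [|reflexivity|intros ? [? ?]; simpl; ring].
    apply em_rem_bound; auto. intros y Hy. apply Rle_trans with (Cmod (g (p + 2)%nat y)); [|apply HM; lra].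
    eapply Rle_trans; [|apply Rmax_Cmod]. apply Rmax_r. }
  pose proof (Cmod_le_sum (Re w) (Im w)) as T.
  replace (Re w, Im w) with w in T by (destruct w; reflexivity). lra.
Qed.

Lemma exp_le_compat (x y : R) : x <= y -> exp x <= exp y.
Proof. intros [H| ->]; [left; now apply exp_increasing|lra]. Qed.

Lemma lpow_bound (A B t : C) (y : R) : 1 <= y -> 3 <= Re t ->
  Cmod (lpow A B t y) <= (Cmod A + Cmod B) / (y * y).
Proof.
  intros Hy Ht. unfold lpow. rewrite Cmod_mult, Cmod_cpow_neg.
  assert (Hl0 : 0 <= ln y) by (rewrite <- ln_1; apply ln_le; lra).
  assert (Hl1 : ln y <= y - 1).
  { pose proof (exp_ineq1_le (ln y)). rewrite exp_ln in H by lra. lra. }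
  assert (H1 : Cmod (A + B * RtoC (ln y)) <= (Cmod A + Cmod B) * y).
  { eapply Rle_trans; [apply Cmod_triangle|]. rewrite Cmod_mult, Cmod_R, Rabs_pos_eq by lra.
    pose proof (Cmod_ge_0 A). pose proof (Cmod_ge_0 B). nra. }
  assert (H2 : exp (- Re t * ln y) <= / (y * y * y)).
  { replace (/ (y * y * y)) with (exp (- (ln y + ln y + ln y))).
    - apply exp_le_compat. nra.
    - rewrite exp_Ropp, !exp_plus, exp_ln by lra. reflexivity. }
  replace ((Cmod A + Cmod B) / (y * y)) with ((Cmod A + Cmod B) * y * / (y * y * y)) by (field; lra).
  apply Rmult_le_compat; [apply Cmod_ge_0|left; apply exp_pos|exact H1|exact H2].
Qed.

Lemma tau_Re (n : nat) (s : C) : Re (tau n s) = Re s + INR n - 1.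
Proof. destruct s. unfold tau, Re. simpl. ring. Qed.

Lemma hz_locally_bounded (p : nat) (s0 : C) : s0 <> RtoC 1 -> 2 < Re s0 + INR p ->
  exists d M, 0 < d /\ 0 <= M /\ forall s, Cmod (s - s0) < d ->
    s <> RtoC 1 /\ 2 < Re s + INR p /\
    forall a K, 0 < a -> (1 <= K)%nat ->
      Cmod (hz_partial (fun n => pF n s) p a (S K) - hz_partial (fun n => pF n s) p a K) <= M / (INR K * INR K) /\
      Cmod (hz_partial (fun n => pG n s) p a (S K) - hz_partial (fun n => pG n s) p a K) <= M / (INR K * INR K).
Proof.
  intros Hs Hp.
  destruct (cderiv_locally_bounded _ _ _ (cderiv_cF (p + 2) s0 Hs)) as (d1 & M1 & Hd1 & HM1 & B1).
  destruct (ex_cderiv_cG (p + 2) s0 Hs) as [l Hl].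
  destruct (cderiv_locally_bounded _ _ _ Hl) as (d2 & M2 & Hd2 & HM2 & B2).
  assert (H1 : 0 < Cmod (1 - s0)) by (apply Cmod_gt_0, Csub_neq_0, Hs).
  set (d := Rmin (Rmin d1 d2) (Rmin (Cmod (1 - s0)) (Re s0 + INR p - 2))).
  assert (D : d <= d1 /\ d <= d2 /\ d <= Cmod (1 - s0) /\ d <= Re s0 + INR p - 2).
  { unfold d. pose proof (Rmin_l (Rmin d1 d2) (Rmin (Cmod (1 - s0)) (Re s0 + INR p - 2))).
    pose proof (Rmin_r (Rmin d1 d2) (Rmin (Cmod (1 - s0)) (Re s0 + INR p - 2))).
    pose proof (Rmin_l d1 d2). pose proof (Rmin_r d1 d2).
    pose proof (Rmin_l (Cmod (1 - s0)) (Re s0 + INR p - 2)).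
    pose proof (Rmin_r (Cmod (1 - s0)) (Re s0 + INR p - 2)). lra. }
  exists d, (2 * 2 ^ p * (M1 + M2)).
  assert (H2p : 0 < 2 ^ p) by (apply pow_lt; lra).
  split; [unfold d; repeat apply Rmin_pos; lra|]. split; [nra|].
  intros s Hss.
  assert (N1 : s <> RtoC 1) by (intros ->; lra).
  assert (N2 : 2 < Re s + INR p).
  { pose proof (re_le_Cmod (s - s0)) as T. change (Re (s - s0)%C) with (Re s - Re s0) in T.
    pose proof (Rabs_maj2 (Re s - Re s0)). lra. }
  split; [exact N1|]. split; [exact N2|].
  intros a K Ha HK. assert (HK1 : 1 <= INR K) by (apply (le_INR 1); lia).
  specialize (B1 s ltac:(lra)). specialize (B2 s ltac:(lra)).
  assert (Ht : 3 <= Re (tau (p + 2) s)) by (rewrite tau_Re, plus_INR; simpl; lra).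
  assert (Hy : forall A B y, Cmod A + Cmod B <= M1 + M2 -> INR K + a <= y ->
    Cmod (lpow A B (tau (p + 2) s) y) <= (M1 + M2) / (INR K * INR K)).
  { intros A B y HAB Hy. eapply Rle_trans; [apply lpow_bound; [lra|exact Ht]|].
    unfold Rdiv. apply Rmult_le_compat; [|left; apply Rinv_0_lt_compat; nra|exact HAB|].
    - pose proof (Cmod_ge_0 A). pose proof (Cmod_ge_0 B). lra.
    - apply Rinv_le_contravar; nra. }
  replace (2 * 2 ^ p * (M1 + M2) / (INR K * INR K)) with (2 * 2 ^ p * ((M1 + M2) / (INR K * INR K)))
    by (field; lra).
  split; apply hz_partial_step_bound; try apply ladder_pF; try apply ladder_pG; try lra; intros y HyK; apply Hy; auto.
  - rewrite Cmod_0. lra.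
  - rewrite Cmod_opp. lra.
Qed.

Lemma cderiv_csum (f f' : nat -> C -> C) (s : C) (n : nat) : (forall k, cderiv (f k) s (f' k s)) ->
  cderiv (fun s => csum (fun k => f k s) n) s (csum (fun k => f' k s) n).
Proof.
  intros H. induction n as [|n IH]; cbn [csum]; [apply cderiv_const|]. now apply cderiv_plus.
Qed.

Lemma cderiv_hz_partial (p : nat) (a : R) (K : nat) (s : C) : s <> RtoC 1 ->
  cderiv (fun s => hz_partial (fun n => pF n s) p a K) s (hz_partial (fun n => pG n s) p a K).
Proof.
  intros Hs. unfold hz_partial. apply cderiv_minus.
  - apply (cderiv_csum (fun k s => pF 1 s (INR k + a)) (fun k s => pG 1 s (INR k + a))).
    intros; now apply cderiv_pF.
  - apply (cderiv_csum (fun j s => RtoC (beta j) * pF j s (INR K + a)%R)%C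
      (fun j s => RtoC (beta j) * pG j s (INR K + a)%R)%C).
    intros j. eapply cderiv_eq; [|apply cderiv_mult; [apply cderiv_const|now apply cderiv_pF]]. cbv beta; ring.
Qed.

Lemma is_lim_seq_exp_ln (eta a : R) : 0 < eta ->
  is_lim_seq (fun K => exp (- eta * ln (INR K + a))) 0.
Proof.
  intros He.
  assert (H1 : is_lim_seq (fun K => INR K + a) p_infty).
  { apply (is_lim_seq_plus _ _ p_infty a p_infty); [apply is_lim_seq_INR|apply is_lim_seq_const|reflexivity]. }
  assert (H2 : is_lim_seq (fun K => ln (INR K + a)) p_infty).
  { apply (is_lim_comp_seq ln _ p_infty p_infty); [apply is_lim_ln_p| |exact H1].
    exists 0%nat. intros n _. discriminate. }
  assert (H3 : is_lim_seq (fun K => - eta * ln (INR K + a)) m_infty).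
  { replace m_infty with (Rbar_mult (- eta) p_infty).
    - apply is_lim_seq_scal_l. exact H2.
    - apply is_Rbar_mult_unique. apply is_Rbar_mult_sym, is_Rbar_mult_p_infty_neg. simpl. lra. }
  apply (is_lim_comp_seq exp _ m_infty 0); [apply is_lim_exp_m| |exact H3].
  exists 0%nat. intros n _. discriminate.
Qed.

Lemma pF_lim (n : nat) (s : C) (a : R) : 0 < Re s + INR n - 1 ->
  climit (fun K => pF n s (INR K + a)) 0.
Proof.
  intros H e He.
  pose proof (Cmod_ge_0 (cF n s)) as Hc.
  assert (L := is_lim_seq_exp_ln _ a H). apply is_lim_seq_spec in L.
  destruct (L (mkposreal (e / (Cmod (cF n s) + 1)) ltac:(apply Rdiv_lt_0_compat; lra))) as [N HN].
  exists N. intros K HK. specialize (HN K HK). simpl in HN.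
  rewrite Rminus_0_r, Rabs_pos_eq in HN by (left; apply exp_pos).
  replace (pF n s (INR K + a)%R - 0)%C with (cF n s * cpow_neg (INR K + a) (tau n s))%C
    by (unfold pF, lpow; ring).
  rewrite Cmod_mult, Cmod_cpow_neg, tau_Re.
  apply (Rmult_lt_compat_r (Cmod (cF n s) + 1)) in HN; [|lra].
  replace (e / (Cmod (cF n s) + 1) * (Cmod (cF n s) + 1)) with e in HN by (field; lra).
  set (x := exp (- (Re s + INR n - 1) * ln (INR K + a))) in *.
  assert (0 < x) by apply exp_pos. nra.
Qed.

Lemma hz_limit_S (p : nat) (a : R) (s l : C) : 2 < Re s + INR p ->
  climit (hz_partial (fun n => pF n s) p a) l -> climit (hz_partial (fun n => pF n s) (S p) a) l.
Proof.
  intros Hp H.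
  apply (climit_ext (fun K => hz_partial (fun n => pF n s) p a K
     + - RtoC (beta (S p)) * pF (S p) s (INR K + a)%R)%C).
  { intros K. unfold hz_partial. cbn [csum]. ring. }
  replace l with (l + - RtoC (beta (S p)) * 0)%C by ring.
  apply climit_plus; [exact H|]. apply climit_scal. apply pF_lim. rewrite S_INR. lra.
Qed.

Lemma hz_limit_ex (p : nat) (a : R) (s : C) : s <> RtoC 1 -> 0 < a -> 2 < Re s + INR p ->
  exists l, climit (hz_partial (fun n => pF n s) p a) l.
Proof.
  intros Hs Ha Hp. destruct (hz_locally_bounded p s Hs Hp) as (d & M & Hd & HM & HB).
  destruct (HB s) as (_ & _ & HK).
  { replace (s - s)%C with (RtoC 0) by ring. now rewrite Cmod_0. }
  destruct (climit_of_increments (hz_partial (fun n => pF n s) p a) M) as [l [Hl _]].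
  - intros K HK1. apply HK; auto.
  - now exists l.
Qed.

Definition zeta_order (s : C) : nat := Z.to_nat (up (2 - Re s)).

Lemma zeta_order_spec (s : C) : 2 < Re s + INR (zeta_order s).
Proof.
  unfold zeta_order. destruct (archimed (2 - Re s)) as [H _]. rewrite INR_IZR_INZ.
  assert (IZR (up (2 - Re s)) <= IZR (Z.of_nat (Z.to_nat (up (2 - Re s))))) by (apply IZR_le; lia). lra.
Qed.

Definition hzeta (a : R) (s : C) : C :=
  epsilon (inhabits (RtoC 0)) (climit (hz_partial (fun n => pF n s) (zeta_order s) a)).

Lemma hzeta_limit (p : nat) (a : R) (s : C) : s <> RtoC 1 -> 0 < a -> 2 < Re s + INR p ->
  climit (hz_partial (fun n => pF n s) p a) (hzeta a s).
Proof.
  intros Hs Ha Hp.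
  assert (H0 : climit (hz_partial (fun n => pF n s) (zeta_order s) a) (hzeta a s)).
  { unfold hzeta. apply epsilon_spec. apply hz_limit_ex; auto. apply zeta_order_spec. }
  assert (Hup : forall q r l, 2 < Re s + INR q -> climit (hz_partial (fun n => pF n s) q a) l ->
     climit (hz_partial (fun n => pF n s) (r + q) a) l).
  { intros q r l Hq Hl. induction r as [|r IH]; [exact Hl|]. simpl. apply hz_limit_S; [|exact IH].
    rewrite plus_INR. pose proof (pos_INR r). lra. }
  destruct (hz_limit_ex p a s Hs Ha Hp) as [l Hl].
  replace (hzeta a s) with l; [exact Hl|].
  apply (climit_unique (hz_partial (fun n => pF n s) (zeta_order s + p) a)).
  - now apply Hup.
  - rewrite Nat.add_comm. apply Hup; [apply zeta_order_spec|exact H0].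
Qed.

Lemma hzeta_derive (p : nat) (a : R) (s : C) : s <> RtoC 1 -> 0 < a -> 2 < Re s + INR p ->
  exists l, climit (hz_partial (fun n => pG n s) p a) l /\ cderiv (hzeta a) s l.
Proof.
  intros Hs Ha Hp. destruct (hz_locally_bounded p s Hs Hp) as (d & M & Hd & HM & HB).
  apply (cderiv_limit (fun K s => hz_partial (fun n => pF n s) p a K)
    (fun K s => hz_partial (fun n => pG n s) p a K) (hzeta a) s d M Hd).
  - intros K y Hy. apply cderiv_hz_partial. apply HB, Hy.
  - intros K y HK Hy. apply HB; auto.
  - intros y Hy. destruct (HB y Hy) as (A & B & _). now apply hzeta_limit.
Qed.

Lemma climit_csum_0 (f : nat -> nat -> C) (n : nat) : (forall j, climit (f j) 0) ->
  climit (fun K => csum (fun j => f j K) n) 0.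
Proof.
  intros H. induction n as [|n IH]; cbn [csum]; [apply climit_const|].
  replace (RtoC 0) with (0 + 0)%C by ring. now apply climit_plus.
Qed.

Lemma pF_1 (s : C) (x : R) : s <> RtoC 1 -> pF 1 s x = cpow_neg x s.
Proof.
  intros Hs. unfold pF, lpow. cbn [cF]. replace (tau 1 s) with s by (unfold tau; simpl; ring).
  replace (tau 0 s) with (- (1 - s))%C by (unfold tau; simpl; ring).
  replace (- (- (1 - s) * / (1 - s)))%C with (RtoC 1) by (field; now apply Csub_neq_0). ring.
Qed.

Lemma climit_is_series (f : nat -> C) (l : C) :
  climit (csum f) l <-> is_series (K := C_AbsRing) (V := C_NormedModule) f l.
Proof.
  assert (E : forall n, csum f (S n) = sum_n (G := C_NormedModule) f n).
  { induction n as [|n IH].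
    - rewrite sum_O. cbn [csum]. ring.
    - rewrite sum_Sn, <- IH. reflexivity. }
  rewrite climit_incr_1. split; intros H.
  - apply filterlim_locally. intros eps. destruct (H eps (cond_pos eps)) as [N HN].
    exists N. intros n Hn. apply C_NormedModule_mixin_compat1. rewrite <- E. apply HN, Hn.
  - intros e He.
    assert (H2 : 0 < sqrt 2) by (apply sqrt_lt_R0; lra).
    destruct (proj1 (filterlim_locally _ _) H (mkposreal (e / sqrt 2) ltac:(apply Rdiv_lt_0_compat; lra)))
      as [N HN].
    exists N. intros n Hn. specialize (HN n Hn). apply C_NormedModule_mixin_compat2 in HN.
    simpl in HN. replace (sqrt 2 * (e / sqrt 2)) with e in HN by (field; lra).
    rewrite E. exact HN.
Qed.

Lemma hzeta_is_hurwitz_zeta (a : R) : 0 < a -> is_hurwitz_zeta a (hzeta a).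
Proof.
  intros Ha. split.
  - intros s Hs. destruct (hzeta_derive _ a s Hs Ha (zeta_order_spec s)) as [l [_ Hl]].
    exists l. now apply cderiv_is_derive.
  - intros s Hs. apply climit_is_series.
    assert (Hs1 : s <> RtoC 1) by (intros ->; simpl in Hs; lra).
    set (p := zeta_order s).
    apply (climit_ext (fun K => hz_partial (fun n => pF n s) p a K
       + csum (fun j => RtoC (beta j) * pF j s (INR K + a)%R) (S p))%C).
    + intros K. unfold hz_partial.
      assert (E : csum (fun k => pF 1 s (INR k + a)) K = csum (fun k => cpow_neg (INR k + a) s) K).
      { induction K as [|K IH]; cbn [csum]; [reflexivity|]. now rewrite IH, pF_1. }
      rewrite E. ring.
    + replace (hzeta a s) with (hzeta a s + 0)%C by ring. apply climit_plus.
      * apply hzeta_limit; auto. apply zeta_order_spec.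
      * apply (climit_csum_0 (fun j K => RtoC (beta j) * pF j s (INR K + a)%R)%C).
        intros j. replace (RtoC 0) with (RtoC (beta j) * 0)%C by ring.
        apply climit_scal, pF_lim. pose proof (pos_INR j). lra.
Qed.

Theorem hurwitz_zeta'_limit (p : nat) (a u : R) : 0 < a -> u < 0 -> 2 < u + INR p ->
  climit (hz_partial (fun n => pG n (RtoC u)) p a) (hurwitz_zeta' (RtoC u) a).
Proof.
  intros Ha Hu Hp.
  assert (Hu1 : RtoC u <> RtoC 1) by (intros E; apply RtoC_inj in E; lra).
  destruct (hzeta_derive p a (RtoC u) Hu1 Ha Hp) as [l [Hl1 Hl2]].
  assert (HZ : is_hurwitz_zeta a (hurwitz_zeta a)).
  { unfold hurwitz_zeta. apply epsilon_spec. exists (hzeta a). now apply hzeta_is_hurwitz_zeta. }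
  destruct HZ as [HZ1 HZ2]. destruct (hzeta_is_hurwitz_zeta a Ha) as [HY1 HY2].
  destruct (identity_left (fun s => hzeta a s - hurwitz_zeta a s)%C u Hu) as [d [Hd E]].
  - intros s Hs. destruct (HZ1 s Hs) as [l1 H1]. destruct (HY1 s Hs) as [l2 H2].
    eexists. apply cderiv_minus; apply cderiv_is_derive; eassumption.
  - intros s Hs. specialize (HZ2 s Hs). specialize (HY2 s Hs).
    apply climit_is_series in HZ2. apply climit_is_series in HY2.
    rewrite (climit_unique _ _ _ HY2 HZ2). ring.
  - assert (Hl3 : cderiv (hurwitz_zeta a) (RtoC u) l).
    { apply (cderiv_ext_loc (hzeta a)); [|exact Hl2]. exists d. split; [exact Hd|].
      intros y Hy. specialize (E y Hy).
      replace (hzeta a y) with ((hzeta a y - hurwitz_zeta a y) + hurwitz_zeta a y)%C by ring.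
      rewrite E. ring. }
    assert (H : is_derive (K := C_AbsRing) (V := C_NormedModule) (hurwitz_zeta a) (RtoC u)
      (hurwitz_zeta' (RtoC u) a)).
    { unfold hurwitz_zeta'. apply epsilon_spec. exists l. now apply cderiv_is_derive. }
    apply cderiv_is_derive in H. rewrite (cderiv_unique _ _ _ _ H Hl3). exact Hl1.
Qed.

(** * The derivative at [1 - 2m] as a function of [a] *)

Lemma INR_2 : INR 2 = 2.
Proof. simpl. ring. Qed.

Lemma ln_half_bound (y : R) : / 2 <= y -> - ln 2 <= ln y.
Proof. intros Hy. rewrite <- ln_Rinv by lra. apply ln_le; lra. Qed.

Lemma sqrt_le_ge (x : R) : 0 < x < 1 -> x <= sqrt x.
Proof.
  intros Hx. rewrite <- (sqrt_square x) at 1 by lra. apply sqrt_le_1_alt. nra.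
Qed.

Lemma log_pow_small (A B r x : R) : 0 < x < 1 -> 1 <= r ->
  Rabs ((A - B * ln x) * exp (r * ln x)) <= (Rabs A + 2 * Rabs B) * sqrt x.
Proof.
  intros Hx Hr.
  assert (Hs : 0 < sqrt x) by (apply sqrt_lt_R0; lra).
  assert (Hss : sqrt x * sqrt x = x) by (apply sqrt_sqrt; lra).
  assert (Hl0 : ln x < 0) by (rewrite <- ln_1; apply ln_increasing; lra).
  assert (Hl : - ln x <= 2 * / sqrt x).
  { replace (- ln x) with (2 * ln (/ sqrt x)).
    - pose proof (exp_ineq1_le (ln (/ sqrt x))). rewrite exp_ln in H by (now apply Rinv_0_lt_compat). lra.
    - rewrite <- Hss at 2. rewrite ln_mult by auto. rewrite ln_Rinv by auto. ring. }
  rewrite Rabs_mult, (Rabs_pos_eq (exp _)) by (left; apply exp_pos).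
  assert (He : exp (r * ln x) <= x).
  { rewrite <- (exp_ln x) at 2 by lra. apply exp_le_compat. nra. }
  assert (H1 : Rabs (A - B * ln x) <= Rabs A + Rabs B * (2 * / sqrt x)).
  { unfold Rminus. eapply Rle_trans; [apply Rabs_triang|]. rewrite Rabs_Ropp, Rabs_mult.
    rewrite (Rabs_left (ln x)) by lra. apply Rplus_le_compat_l.
    apply Rmult_le_compat_l; [apply Rabs_pos|exact Hl]. }
  apply Rle_trans with ((Rabs A + Rabs B * (2 * / sqrt x)) * x).
  - apply Rmult_le_compat; auto using Rabs_pos. left; apply exp_pos.
  - assert (E : (Rabs A + Rabs B * (2 * / sqrt x)) * (sqrt x * sqrt x)
      = Rabs A * (sqrt x * sqrt x) + 2 * Rabs B * sqrt x) by (field; lra).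
    rewrite Hss in E. rewrite E.
    pose proof (Rmult_le_compat_l (Rabs A) _ _ (Rabs_pos A) (sqrt_le_ge x Hx)). lra.
Qed.

Lemma ln_nonpos (x : R) : x <= 0 -> ln x = 0.
Proof. intros Hx. unfold ln. destruct (Rlt_dec 0 x); [exfalso; lra|reflexivity]. Qed.

Fixpoint rsum (f : nat -> R) (n : nat) : R :=
  match n with
  | O => 0
  | S n => rsum f n + f n
  end.

Definition rz_partial (f : nat -> R -> R) (p : nat) (K : nat) (a : R) : R :=
  rsum (fun k => f 1%nat (INR k + a)) K - em_sum p f (INR K + a).

Lemma rz_partial_step (f : nat -> R -> R) (p K : nat) (a : R) :
  rz_partial f p (S K) a - rz_partial f p K a = em_rem p f (INR K + a).
Proof.
  unfold rz_partial, em_rem. cbn [rsum]. rewrite S_INR.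
  replace (INR K + 1 + a) with (INR K + a + 1) by ring. ring.
Qed.

Lemma hz_partial_real (g : nat -> R -> C) (f : nat -> R -> R) (p : nat) (a : R) (K : nat) :
  (forall n x, g n x = RtoC (f n x)) -> hz_partial g p a K = RtoC (rz_partial f p K a).
Proof.
  intros H. unfold hz_partial, rz_partial. rewrite RtoC_minus. f_equal.
  - induction K as [|K IH]; cbn [csum rsum]; [reflexivity|]. rewrite RtoC_plus, IH, H. reflexivity.
  - f_equal. unfold em_sum. induction p as [|p IH].
    + rewrite sum_O. cbn [csum]. rewrite H, RtoC_mult. ring.
    + rewrite sum_n_SR, RtoC_plus, <- IH, RtoC_mult, <- H. reflexivity.
Qed.

Lemma em_sum_derive (q : nat) (f : nat -> R -> R) (x : R) : ladder f -> 0 < x ->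
  is_derive (em_sum q f) x (em_sum q (fun n => f (S n)) x).
Proof.
  intros Hf Hx. unfold em_sum. induction q as [|q IH].
  - apply (is_derive_ext (fun x => beta 0 * f 0%nat x)); [intros; now rewrite sum_O|].
    rewrite sum_O. apply is_derive_scal. auto.
  - apply (is_derive_ext (fun x => sum_n (fun j => beta j * f j x) q + beta (S q) * f (S q) x)).
    { intros; now rewrite sum_n_SR. }
    rewrite sum_n_SR. apply (is_derive_plus (V := R_NormedModule)); [exact IH|].
    apply is_derive_scal. auto.
Qed.

Lemma continuous_shift (f : R -> R) (c x : R) : continuous f (c + x) -> continuous (fun t => f (c + t)) x.
Proof.
  intros H. apply (continuous_comp (fun t => c + t) f); [|exact H].
  apply continuous_Rplus; [apply continuous_Rconst|apply continuous_id].
Qed.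

Lemma continuous_rsum (g : nat -> R -> R) (K : nat) (x : R) : (forall k, (k < K)%nat -> continuous (g k) x) ->
  continuous (fun t => rsum (fun k => g k t) K) x.
Proof.
  intros H. induction K as [|K IH]; cbn [rsum]; [apply continuous_Rconst|].
  apply continuous_Rplus; [apply IH; intros; apply H; lia|apply H; lia].
Qed.

Section RealLadder.
Variable m : nat.
Hypothesis Hm : (0 < m)%nat.

Let u : R := 1 - 2 * INR m.

Fixpoint rF (n : nat) : R :=
  match n with
  | O => / (2 * INR m)
  | S n => (2 * INR m - INR n) * rF n
  end.

Fixpoint rG (n : nat) : R :=
  match n with
  | O => / (2 * INR m) * / (2 * INR m)
  | S n => - rF n + (2 * INR m - INR n) * rG n
  end.

Definition rf (n : nat) (x : R) : R := (rG n - rF n * ln x) * exp ((2 * INR m - INR n) * ln x).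

Lemma INR_m_ge_1 : 1 <= INR m.
Proof. apply (le_INR 1). lia. Qed.

Lemma tau_real (n : nat) : tau n (RtoC u) = RtoC (- (2 * INR m - INR n)).
Proof. unfold tau, u. rewrite <- RtoC_plus, <- RtoC_minus. f_equal. ring. Qed.

Lemma cF_real (n : nat) : cF n (RtoC u) = RtoC (rF n) /\ cG n (RtoC u) = RtoC (rG n).
Proof.
  pose proof INR_m_ge_1.
  induction n as [|n [IH1 IH2]]; cbn [cF cG rF rG].
  - unfold u. rewrite <- RtoC_minus, <- RtoC_inv, <- RtoC_mult by lra.
    replace (1 - (1 - 2 * INR m)) with (2 * INR m) by ring. auto.
  - rewrite IH1, IH2, tau_real. rewrite <- !RtoC_mult, <- !RtoC_opp, <- RtoC_minus.
    split; f_equal; ring.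
Qed.

Lemma pG_real (n : nat) (x : R) : pG n (RtoC u) x = RtoC (rf n x).
Proof.
  unfold pG, lpow, rf. destruct (cF_real n) as [-> ->]. rewrite tau_real.
  unfold cpow_neg, Re, Im, RtoC, Cmult, Cplus, Copp; simpl.
  rewrite Rmult_0_l, cos_0, sin_0, Ropp_involutive. f_equal; ring.
Qed.

Lemma ladder_rf : ladder rf.
Proof.
  intros n x Hx. destruct (ladder_pG (RtoC u)) as [H _]. specialize (H n x Hx). cbv beta in H.
  rewrite pG_real in H. apply (is_derive_ext (fun x => Re (pG n (RtoC u) x))); [|exact H].
  intros t. now rewrite pG_real.
Qed.

Lemma rF_large (n : nat) : (2 * m < n)%nat -> rF n = 0.
Proof.
  induction n as [|n IH]; intros Hn; [lia|]. cbn [rF].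
  destruct (Nat.eq_dec n (2 * m)) as [->|Hne].
  - rewrite mult_INR. simpl. ring.
  - rewrite IH by lia. ring.
Qed.

Lemma rF_fact (n : nat) : (n < 2 * m)%nat -> rF (S n) * INR (fact (2 * m - S n)) = INR (fact (2 * m - 1)).
Proof.
  pose proof INR_m_ge_1.
  induction n as [|n IH]; intros Hn.
  - cbn [rF]. rewrite Rminus_0_r. rewrite Rinv_r by lra. rewrite Rmult_1_l. reflexivity.
  - change (rF (S (S n))) with ((2 * INR m - INR (S n)) * rF (S n)).
    rewrite <- (IH ltac:(lia)). replace (2 * m - S n)%nat with (S (2 * m - S (S n))) by lia.
    rewrite fact_simpl, mult_INR.
    replace (S (2 * m - S (S n))) with (2 * m - S n)%nat by lia.
    rewrite minus_INR, mult_INR by lia. rewrite INR_2. ring.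
Qed.

Lemma rf_1 (x : R) : rf 1 x = - ln x * exp ((2 * INR m - 1) * ln x).
Proof.
  pose proof INR_m_ge_1. unfold rf. cbn [rG rF]. simpl (INR 0). simpl (INR 1). f_equal. field. lra.
Qed.

Lemma rf_pole (x : R) : 0 < x -> rf (2 * m + 1) x = - INR (fact (2 * m - 1)) / x.
Proof.
  intros Hx. unfold rf. rewrite rF_large by lia. rewrite Nat.add_1_r. cbn [rG].
  assert (E : rF (2 * m) = INR (fact (2 * m - 1))).
  { rewrite <- (rF_fact (2 * m - 1)) by lia. replace (S (2 * m - 1)) with (2 * m)%nat by lia.
    rewrite Nat.sub_diag. simpl (fact 0). simpl (INR 1). ring. }
  rewrite E, S_INR, mult_INR. rewrite INR_2.
  replace ((2 * INR m - (2 * INR m + 1)) * ln x) with (- ln x) by ring.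
  rewrite exp_Ropp, exp_ln by exact Hx. replace (2 * INR m - 2 * INR m) with 0 by ring.
  unfold Rdiv. ring.
Qed.

Lemma rf_decay (k n : nat) : (2 * m + 1 <= n)%nat -> (2 * m + k <= n)%nat ->
  exists M, 0 <= M /\ forall y, / 2 <= y -> Rabs (rf n y) <= M / y ^ k.
Proof.
  intros Hn Hk.
  exists (Rabs (rG n) * exp ((INR n - 2 * INR m - INR k) * ln 2)). split.
  { apply Rmult_le_pos; [apply Rabs_pos|left; apply exp_pos]. }
  intros y Hy. unfold rf. rewrite rF_large by lia. rewrite Rmult_0_l, Rminus_0_r, Rabs_mult.
  rewrite (Rabs_pos_eq (exp _)) by (left; apply exp_pos). unfold Rdiv. rewrite Rmult_assoc.
  apply Rmult_le_compat_l; [apply Rabs_pos|].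
  replace (/ y ^ k) with (exp (- (INR k * ln y))).
  2: { rewrite exp_Ropp. f_equal. rewrite <- Rpower_pow by lra. reflexivity. }
  rewrite <- exp_plus. apply exp_le_compat.
  pose proof (ln_half_bound y Hy).
  assert (INR (2 * m + k) <= INR n) by now apply le_INR.
  rewrite plus_INR, mult_INR in H0. rewrite INR_2 in H0. nra.
Qed.

Lemma rf_small (n : nat) (x : R) : (n < 2 * m)%nat -> 0 < x < 1 ->
  Rabs (rf n x) <= (Rabs (rG n) + 2 * Rabs (rF n)) * sqrt x.
Proof.
  intros Hn Hx. apply log_pow_small; auto.
  assert (INR (S n) <= INR (2 * m)) by (apply le_INR; lia).
  rewrite S_INR, mult_INR in H. rewrite INR_2 in H. lra.
Qed.

Lemma rf_small_mult (n : nat) (x : R) : (n <= 2 * m)%nat -> 0 < x < 1 ->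
  Rabs (rf n x * x) <= (Rabs (rG n) + 2 * Rabs (rF n)) * sqrt x.
Proof.
  intros Hn Hx. unfold rf. rewrite <- (exp_ln x) at 3 by lra.
  rewrite Rmult_assoc, <- exp_plus.
  replace ((2 * INR m - INR n) * ln x + ln x) with ((2 * INR m - INR n + 1) * ln x) by ring.
  apply log_pow_small; auto.
  assert (INR n <= INR (2 * m)) by (apply le_INR; lia).
  rewrite mult_INR in H. rewrite INR_2 in H. lra.
Qed.

(* [ln] is [0] on the nonpositive reals, so [rf 1] is [0] there, and [x^(2m-1) ln x] tends to 0. *)
Lemma continuous_rf_1 (x : R) : continuous (rf 1) x.
Proof.
  destruct (Rtotal_order x 0) as [H|[-> |H]].
  - apply (continuous_ext_loc _ (fun _ => 0)); [|apply continuous_Rconst].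
    exists (mkposreal (- x) ltac:(lra)). intros y Hy. rewrite rf_1, ln_nonpos; [lra|].
    change (Rabs (y - x) < - x) in Hy. apply Rabs_lt_between in Hy. lra.
  - apply continuous_eps. intros e He.
    set (M := Rabs (rG 1) + 2 * Rabs (rF 1) + 1).
    assert (HM : 0 < M) by (unfold M; pose proof (Rabs_pos (rG 1)); pose proof (Rabs_pos (rF 1)); lra).
    assert (HeM : 0 < e / M) by now apply Rdiv_lt_0_compat.
    exists (Rmin 1 ((e / M) * (e / M))). split; [apply Rmin_pos; [lra|now apply Rmult_lt_0_compat]|].
    intros y Hy. rewrite (rf_1 0), (ln_nonpos 0) by lra. rewrite Ropp_0, Rmult_0_l, Rminus_0_r.
    rewrite Rminus_0_r in Hy.
    assert (Y1 : Rabs y < 1) by (eapply Rlt_le_trans; [exact Hy|apply Rmin_l]).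
    assert (Y2 : Rabs y < (e / M) * (e / M)) by (eapply Rlt_le_trans; [exact Hy|apply Rmin_r]).
    apply Rabs_lt_between in Y1.
    destruct (Rle_lt_dec y 0) as [Hy0|Hy0].
    + rewrite rf_1, ln_nonpos by lra. rewrite Ropp_0, Rmult_0_l, Rabs_R0. exact He.
    + rewrite Rabs_pos_eq in Y2 by lra.
      assert (Hsq : sqrt y < e / M).
      { rewrite <- (sqrt_square (e / M)) by lra. apply sqrt_lt_1_alt. lra. }
      eapply Rle_lt_trans; [apply rf_small; lia || lra|].
      assert (M * sqrt y < e).
      { apply (Rmult_lt_compat_l M) in Hsq; [|lra]. replace (M * (e / M)) with e in Hsq by (field; lra). exact Hsq. }
      assert (0 <= sqrt y) by apply sqrt_pos. unfold M in H. lra.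
  - apply ladder_continuous; [apply ladder_rf|exact H].
Qed.

Let p : nat := (2 * m + 2)%nat.

Lemma em_rem_rf_decay (i : nat) : exists M, 0 <= M /\ forall x, / 2 <= x ->
  Rabs (em_rem p (fun n => rf (i + n)) x) <= M / x ^ 2.
Proof.
  destruct (rf_decay 2 (i + (p + 2))) as [M [HM HB]]; [unfold p; lia|unfold p; lia|].
  exists (2 ^ p * M). assert (H2 : 0 < 2 ^ p) by (apply pow_lt; lra).
  split; [apply Rmult_le_pos; lra|].
  intros x Hx. unfold Rdiv. rewrite Rmult_assoc.
  apply em_rem_bound; [apply ladder_shift, ladder_rf|lra|].
  intros y Hy. eapply Rle_trans; [apply HB; lra|]. unfold Rdiv. apply Rmult_le_compat_l; [exact HM|].
  apply Rinv_le_contravar; [apply pow_lt; lra|]. apply pow_incr; lra.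
Qed.

Definition rz (i : nat) (a : R) : R := real (Lim_seq (fun K => rz_partial (fun n => rf (i + n)) p K a)).

Lemma rz_spec (i : nat) : exists M, forall a, - / 2 < a < 3 / 2 ->
  is_lim_seq (fun K => rz_partial (fun n => rf (i + n)) p K a) (rz i a) /\
  forall N, (1 <= N)%nat -> Rabs (rz_partial (fun n => rf (i + n)) p N a - rz i a) <= M / INR N.
Proof.
  destruct (em_rem_rf_decay i) as [M [HM HB]]. exists (2 * (4 * M)).
  intros a Ha.
  destruct (climit_of_increments (fun K => RtoC (rz_partial (fun n => rf (i + n)) p K a)) (4 * M))
    as [l [Hl Hlb]].
  { intros K HK. rewrite <- RtoC_minus, Cmod_R, rz_partial_step.
    assert (HK1 : 1 <= INR K) by (apply (le_INR 1); lia).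
    eapply Rle_trans; [apply HB; lra|].
    replace (4 * M / (INR K * INR K)) with (M / (INR K / 2) ^ 2) by (field; lra).
    unfold Rdiv. apply Rmult_le_compat_l; [exact HM|].
    apply Rinv_le_contravar; [apply pow_lt; lra|]. apply pow_incr; lra. }
  assert (E : is_lim_seq (fun K => rz_partial (fun n => rf (i + n)) p K a) (Re l)).
  { apply (climit_Re _ _ Hl). }
  assert (Er : rz i a = Re l) by (unfold rz; now rewrite (is_lim_seq_unique _ _ E)).
  rewrite Er. split; [exact E|]. intros N HN. eapply Rle_trans; [|apply Hlb, HN].
  eapply Rle_trans; [|apply re_le_Cmod]. right. destruct l; reflexivity.
Qed.

Lemma hurwitz_zeta'_real (a : R) : 0 < a < 1 -> hurwitz_zeta' (RtoC u) a = RtoC (rz 0 a).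
Proof.
  intros Ha. pose proof INR_m_ge_1.
  destruct (rz_spec 0) as [M HM]. destruct (HM a ltac:(lra)) as [HL _].
  apply (climit_unique (hz_partial (fun n => pG n (RtoC u)) p a)).
  - apply hurwitz_zeta'_limit; [lra|unfold u; lra|]. unfold u, p. rewrite plus_INR, mult_INR.
    rewrite INR_2. lra.
  - apply (climit_ext (fun K => RtoC (rz_partial (fun n => rf (0 + n)) p K a))).
    + intros K. symmetry. apply hz_partial_real. intros; apply pG_real.
    + apply climit_real; [exact HL|]. simpl. apply is_lim_seq_const.
Qed.

Lemma continuous_rz_partial (K : nat) (x : R) : 0 < INR K + x -> continuous (rz_partial rf p K) x.
Proof.
  intros H. unfold rz_partial. apply continuous_Rminus.
  - apply (continuous_rsum (fun k t => rf 1 (INR k + t))). intros. apply continuous_shift, continuous_rf_1.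
  - apply continuous_shift. apply continuous_of_derivable. eexists. apply em_sum_derive; [apply ladder_rf|exact H].
Qed.

Lemma rz_partial_derive (f : nat -> R -> R) (K : nat) (x : R) : ladder f -> 0 < x ->
  is_derive (rz_partial f p K) x (rz_partial (fun n => f (S n)) p K x).
Proof.
  intros Hf H. unfold rz_partial. apply (is_derive_minus (V := R_NormedModule)).
  - induction K as [|K IH]; cbn [rsum].
    + apply (is_derive_const (V := R_NormedModule)).
    + apply (is_derive_plus (V := R_NormedModule)); [exact IH|]. apply is_derive_shift, Hf.
      pose proof (pos_INR K). lra.
  - apply is_derive_shift, em_sum_derive; auto. pose proof (pos_INR K). lra.
Qed.

Lemma rz_cvu (i : nat) (c : R) (d : posreal) : c - d >= - / 2 -> c + d <= 3 / 2 ->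
  CVU (fun K => rz_partial (fun n => rf (i + n)) p (S K)) (rz i) c d.
Proof.
  intros H1 H2 e He. destruct (rz_spec i) as [M HM].
  destruct (nfloor_ex (Rabs M / e)) as [N HN].
  { apply Rmult_le_pos; [apply Rabs_pos|]. left; now apply Rinv_0_lt_compat. }
  exists N. intros n y Hn Hy. unfold Boule in Hy. apply Rabs_lt_between in Hy.
  destruct (HM y ltac:(lra)) as [_ HB]. specialize (HB (S n) ltac:(lia)).
  rewrite Rabs_minus_sym. eapply Rle_lt_trans; [exact HB|].
  rewrite S_INR. assert (INR N <= INR n) by now apply le_INR.
  assert (Hp : 0 < INR n + 1) by (pose proof (pos_INR n); lra).
  apply (Rmult_lt_reg_r (INR n + 1)); [lra|].
  replace (M / (INR n + 1) * (INR n + 1)) with M by (field; lra).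
  pose proof (Rle_abs M).
  assert (Rabs M / e * e < (INR n + 1) * e) by (apply Rmult_lt_compat_r; lra).
  replace (Rabs M / e * e) with (Rabs M) in H3 by (field; lra). lra.
Qed.

Lemma continuous_rz (a : R) : 0 <= a <= 1 -> continuous (rz 0) a.
Proof.
  intros Ha. apply continuity_pt_filterlim.
  apply (CVU_continuity (fun K => rz_partial (fun n => rf (0 + n)) p (S K)) (rz 0) (/ 2) (mkposreal 1 Rlt_0_1)).
  - apply rz_cvu; simpl; lra.
  - intros n y Hy. apply continuity_pt_filterlim. apply continuous_rz_partial.
    unfold Boule in Hy. simpl in Hy. apply Rabs_lt_between in Hy. rewrite S_INR. pose proof (pos_INR n). lra.
  - unfold Boule. simpl. apply Rabs_lt_between. lra.
Qed.

Lemma ex_derive_rz (a : R) : 0 < a < 1 -> ex_derive (rz 0) a.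
Proof.
  intros Ha. exists (rz 1 a). apply is_derive_Reals.
  apply (CVU_derivable (fun K => rz_partial (fun n => rf (0 + n)) p (S K))
    (fun K => rz_partial (fun n => rf (1 + n)) p (S K)) (rz 0) (rz 1) (/ 2) (mkposreal (/ 2) ltac:(lra))).
  - apply rz_cvu; simpl; lra.
  - intros x Hx. unfold Boule in Hx. simpl in Hx. apply Rabs_lt_between in Hx.
    destruct (rz_spec 0) as [M HM]. destruct (HM x ltac:(lra)) as [HL _].
    apply is_lim_seq_Reals. apply (is_lim_seq_incr_1 (fun K => rz_partial (fun n => rf (0 + n)) p K x)). exact HL.
  - intros n x Hx. unfold Boule in Hx. simpl in Hx. apply Rabs_lt_between in Hx.
    apply is_derive_Reals. apply rz_partial_derive; [apply ladder_rf|lra].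
  - unfold Boule. simpl. apply Rabs_lt_between. lra.
Qed.

End RealLadder.

(** * Sine coefficients *)

Definition sinc (t : R) : R := slope sin 0 1 t.

Lemma sinc_mult (t : R) : sinc t * t = sin t.
Proof.
  unfold sinc. pose proof (slope_mult sin 0 1 t) as H. rewrite sin_0, !Rminus_0_r in H. exact H.
Qed.

Lemma sinc_0 : sinc 0 = 1.
Proof. unfold sinc, slope. destruct (Req_dec_T 0 0); [reflexivity|lra]. Qed.

Lemma continuous_sinc (t : R) : continuous sinc t.
Proof.
  apply slope_continuous.
  - auto_derive; auto. rewrite cos_0. ring.
  - by_derive.
Qed.

Lemma sin_mean_value (t : R) : exists c, Rabs c <= Rabs t /\ sin t = t * cos c.
Proof.
  destruct (MVT_gen sin 0 t cos) as [c [Hc E]].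
  - intros. auto_derive; auto. ring.
  - intros. apply continuity_sin.
  - exists c. rewrite sin_0, !Rminus_0_r in E. split; [|rewrite E; ring].
    unfold Rmin, Rmax in Hc. destruct (Rle_dec 0 t).
    + rewrite !Rabs_pos_eq by lra. lra.
    + rewrite !Rabs_left1 by lra. lra.
Qed.

Lemma Rabs_sin_le (t : R) : Rabs (sin t) <= Rabs t.
Proof.
  destruct (sin_mean_value t) as [c [_ E]]. rewrite E, Rabs_mult.
  assert (Rabs (cos c) <= 1) by (apply Rabs_le; pose proof (COS_bound c); lra).
  pose proof (Rabs_pos t). nra.
Qed.

Lemma sinc_near_1 (t : R) : Rabs (sinc t - 1) <= t * t / 2.
Proof.
  destruct (Req_dec_T t 0) as [->|Hne].
  - rewrite sinc_0, Rminus_diag, Rabs_R0. lra.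
  - destruct (sin_mean_value t) as [c [Hc E]].
    assert (E2 : sinc t = cos c).
    { apply (Rmult_eq_reg_r t); [|exact Hne]. rewrite sinc_mult, E. ring. }
    rewrite E2. replace (cos c) with (1 - 2 * (sin (c / 2) * sin (c / 2))).
    2: { replace c with (2 * (c / 2)) at 3 by field. rewrite cos_2a_sin. ring. }
    assert (Hs : Rabs (sin (c / 2)) <= Rabs t / 2).
    { eapply Rle_trans; [apply Rabs_sin_le|]. unfold Rdiv. rewrite Rabs_mult, (Rabs_pos_eq (/ 2)) by lra. lra. }
    pose proof (Rabs_pos (sin (c / 2))).
    assert (Hq : sin (c / 2) * sin (c / 2) <= t * t / 4).
    { rewrite <- (Rabs_pos_eq (sin (c / 2) * sin (c / 2))), Rabs_mult by apply Rle_0_sqr.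
      replace (t * t) with (Rabs t * Rabs t) by (rewrite <- Rabs_mult; apply Rabs_pos_eq, Rle_0_sqr).
      nra. }
    pose proof (Rle_0_sqr (sin (c / 2))) as Hp. unfold Rsqr in Hp.
    apply Rabs_le. lra.
Qed.

Lemma sinc_decay (t : R) : 0 < t -> Rabs (sinc t) <= / t.
Proof.
  intros Ht. replace (sinc t) with (sin t * / t).
  - rewrite Rabs_mult, (Rabs_pos_eq (/ t)) by (left; now apply Rinv_0_lt_compat).
    rewrite <- (Rmult_1_l (/ t)) at 2. apply Rmult_le_compat_r; [left; now apply Rinv_0_lt_compat|].
    apply Rabs_le. pose proof (SIN_bound t). lra.
  - rewrite <- sinc_mult. field. lra.
Qed.

Lemma dirichlet_kernel_0 (N : nat) : dirichlet_kernel N 0 = 2 * INR N + 1.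
Proof.
  induction N as [|N IH]; cbn [dirichlet_kernel]; [simpl; ring|].
  rewrite IH, Rmult_0_r, cos_0, S_INR. ring.
Qed.

Lemma sinc_dirichlet_kernel (N : nat) (t : R) :
  sinc (PI * t) * dirichlet_kernel N t = (2 * INR N + 1) * sinc ((2 * INR N + 1) * PI * t).
Proof.
  destruct (Req_dec_T t 0) as [->|Hne].
  - rewrite !Rmult_0_r, sinc_0, dirichlet_kernel_0. ring.
  - apply (Rmult_eq_reg_r (PI * t)).
    2: { apply Rmult_integral_contrapositive. split; [apply PI_neq0|exact Hne]. }
    replace (sinc (PI * t) * dirichlet_kernel N t * (PI * t)) with
      (sinc (PI * t) * (PI * t) * dirichlet_kernel N t) by ring.
    rewrite sinc_mult, dirichlet_kernel_sin, <- sinc_mult. ring.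
Qed.

Lemma RInt_affine (f : R -> R) (u v a b : R) : (forall t, continuous f t) ->
  RInt (fun y => u * f (u * y + v)) a b = RInt f (u * a + v) (u * b + v).
Proof.
  intros Hf. apply (RInt_comp_lin (V := R_CompleteNormedModule) f).
  apply (ex_RInt_continuous (V := R_CompleteNormedModule)). auto.
Qed.

Lemma ex_RInt_sinc (a b : R) : ex_RInt sinc a b.
Proof. apply (ex_RInt_continuous (V := R_CompleteNormedModule)). intros; apply continuous_sinc. Qed.

Lemma RInt_sinc_even (x : R) : RInt sinc (- x) 0 = RInt sinc 0 x.
Proof.
  assert (Hs : forall t, sinc (- t) = sinc t).
  { intros t. destruct (Req_dec_T t 0) as [->|Hne]; [now rewrite Ropp_0|].
    apply (Rmult_eq_reg_r t); [|exact Hne]. rewrite sinc_mult.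
    replace (sinc (- t) * t) with (- (sinc (- t) * - t)) by ring. rewrite sinc_mult, sin_neg. ring. }
  pose proof (RInt_affine sinc (-1) 0 0 x continuous_sinc) as H.
  replace (-1 * 0 + 0) with 0 in H by ring. replace (-1 * x + 0) with (- x) in H by ring.
  rewrite <- (opp_RInt_swap (V := R_CompleteNormedModule) sinc 0 (- x)) by apply ex_RInt_sinc.
  rewrite <- H.
  rewrite (RInt_ext (V := R_CompleteNormedModule) _ (fun y => opp (sinc y))).
  - rewrite (RInt_opp (V := R_CompleteNormedModule)) by apply ex_RInt_sinc. apply opp_opp.
  - intros y _. replace (-1 * y + 0) with (- y) by ring. rewrite Hs. unfold opp; simpl. ring.
Qed.

Lemma RInt_sinc_lim_half : is_lim_seq (fun N => RInt sinc 0 ((INR N + / 2) * PI)) (PI / 2).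
Proof.
  pose proof PI_RGT_0 as HPI.
  assert (Hf : ex_derive (fun t => sinc (PI * t)) 0).
  { exists 0. apply Rderiv_of_eps. intros e He.
    exists (e / (PI * PI)). split; [apply Rdiv_lt_0_compat; nra|]. intros y Hy.
    rewrite Rmult_0_r, sinc_0, Rmult_0_l, !Rminus_0_r. rewrite Rminus_0_r in Hy.
    eapply Rle_trans; [apply sinc_near_1|].
    replace (PI * y * (PI * y) / 2) with (PI * PI * (y * y) / 2) by field.
    replace (y * y) with (Rabs y * Rabs y) by (rewrite <- Rabs_mult; apply Rabs_pos_eq, Rle_0_sqr).
    pose proof (Rabs_pos y).
    assert (PI * PI * Rabs y < e).
    { apply (Rmult_lt_compat_l (PI * PI)) in Hy; [|nra].
      replace (PI * PI * (e / (PI * PI))) with e in Hy by (field; lra). exact Hy. }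
    nra. }
  assert (Hc : forall t, continuous (fun t => sinc (PI * t)) t).
  { intros t. apply (continuous_comp (fun t => PI * t) sinc); [by_derive|apply continuous_sinc]. }
  assert (L := fourier_pointwise _ (- / 2) 0 ltac:(lra) (fun t _ => Hc t) Hf). cbv beta in L.
  rewrite Rmult_0_r, sinc_0 in L.
  apply (is_lim_seq_scal_l _ (PI / 2)) in L. simpl in L. rewrite Rmult_1_r in L.
  eapply is_lim_seq_ext; [|exact L]. intros N. cbv beta.
  set (w := (2 * INR N + 1) * PI).
  rewrite (RInt_ext_le _ (fun t => / PI * (w * sinc (w * t + 0)))).
  - rewrite RInt_Rscal.
    + rewrite RInt_affine by apply continuous_sinc.
      replace (w * (- / 2 + 1) + 0) with ((INR N + / 2) * PI) by (unfold w; field).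
      replace (w * - / 2 + 0) with (- ((INR N + / 2) * PI)) by (unfold w; field).
      rewrite <- (RInt_Chasles (V := R_CompleteNormedModule) sinc _ 0) by apply ex_RInt_sinc.
      rewrite RInt_sinc_even. unfold plus; simpl. field. lra.
    + lra.
    + intros. apply continuous_Rmult; [apply continuous_Rconst|].
      apply (continuous_comp (fun t => w * t + 0) sinc); [by_derive|apply continuous_sinc].
  - lra.
  - intros t _. rewrite Rminus_0_r, sinc_dirichlet_kernel. unfold w. rewrite Rplus_0_r. field. lra.
Qed.

Lemma RInt_sinc_lim (n : nat) : (0 < n)%nat ->
  is_lim_seq (fun K => RInt sinc 0 (2 * PI * INR n * INR K)) (PI / 2).
Proof.
  intros Hn. pose proof PI_RGT_0 as HPI. assert (Hn1 : 1 <= INR n) by (apply (le_INR 1); lia).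
  assert (L1 : is_lim_seq (fun K => RInt sinc 0 ((INR (2 * n * K) + / 2) * PI)) (PI / 2)).
  { apply (is_lim_seq_subseq (fun N => RInt sinc 0 ((INR N + / 2) * PI)) _ (fun K => (2 * n * K)%nat)).
    - apply eventually_subseq. intros K. nia.
    - apply RInt_sinc_lim_half. }
  assert (L2 : is_lim_seq (fun K => RInt sinc (2 * PI * INR n * INR K) ((INR (2 * n * K) + / 2) * PI)) 0).
  { apply is_lim_seq_incr_1. apply is_lim_seq_abs_0.
    apply (is_lim_seq_le_le (fun _ => 0) _ (fun K => / INR (S K))).
    - intros K. split; [apply Rabs_pos|].
      set (y := 2 * PI * INR n * INR (S K)).
      assert (Hk : 1 <= INR (S K)) by (apply (le_INR 1); lia).
      replace ((INR (2 * n * S K) + / 2) * PI) with (y + PI / 2)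
        by (unfold y; rewrite !mult_INR, INR_2; field).
      assert (Hy : PI / 2 * INR (S K) <= y).
      { unfold y. apply Rmult_le_compat_r; [lra|]. nra. }
      assert (Hy0 : 0 < y) by nra.
      eapply Rle_trans.
      + apply (abs_RInt_le_const sinc _ _ (/ y)); [lra|apply ex_RInt_sinc|].
        intros t Ht. eapply Rle_trans; [apply sinc_decay; lra|]. apply Rinv_le_contravar; lra.
      + apply (Rmult_le_reg_r (y * INR (S K))); [nra|].
        replace (/ INR (S K) * (y * INR (S K))) with y by (field; lra).
        replace ((y + PI / 2 - y) * / y * (y * INR (S K))) with (PI / 2 * INR (S K)) by (field; lra).
        exact Hy.
    - apply is_lim_seq_const.
    - replace (Finite 0) with (Rbar_inv p_infty) by reflexivity.
      apply is_lim_seq_inv; [|discriminate]. apply (is_lim_seq_incr_1 INR). apply is_lim_seq_INR. }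
  assert (L := is_lim_seq_minus' _ _ _ _ L1 L2). rewrite Rminus_0_r in L.
  eapply is_lim_seq_ext; [|exact L]. intros K. cbv beta.
  rewrite <- (RInt_Chasles (V := R_CompleteNormedModule) sinc 0 (2 * PI * INR n * INR K)) by apply ex_RInt_sinc.
  unfold plus; simpl. ring.
Qed.

Lemma is_derive_Rmult (f g : R -> R) (x f' g' : R) : is_derive f x f' -> is_derive g x g' ->
  is_derive (fun t => f t * g t) x (f' * g x + f x * g').
Proof. intros Hf Hg. apply (is_derive_mult (K := R_AbsRing) f g); auto. apply Rmult_comm. Qed.

Lemma is_derive_eq (f : R -> R) (x l l' : R) : l = l' -> is_derive f x l -> is_derive f x l'.
Proof. now intros ->. Qed.

Section IntegrationByParts.
Variable om : R.
Hypothesis Hom : 0 < om.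

Fixpoint ibp (q : nat) (f : nat -> R -> R) (x : R) : R :=
  match q with
  | O => 0
  | S q => ibp q f x
      + (-1) ^ q * (f (2 * q + 1)%nat x * (sin (om * x) * / om ^ (2 * q + 2))
                    - f (2 * q)%nat x * (cos (om * x) * / om ^ (2 * q + 1)))
  end.

Lemma ibp_derive (q : nat) (f : nat -> R -> R) (x : R) : ladder f -> 0 < x ->
  is_derive (ibp q f) x
    (f 0%nat x * sin (om * x) - (-1) ^ q / om ^ (2 * q) * (f (2 * q)%nat x * sin (om * x))).
Proof.
  intros Hf Hx. induction q as [|q IH]; cbn [ibp].
  - eapply is_derive_eq; [|apply (is_derive_const (V := R_NormedModule))].
    unfold zero; simpl. field.
  - eapply is_derive_eq; [|apply (is_derive_plus (V := R_NormedModule)); [exact IH|]].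
    2: { apply is_derive_scal. apply (is_derive_minus (V := R_NormedModule)).
         - apply is_derive_Rmult; [apply Hf, Hx|auto_derive; [auto|reflexivity]].
         - apply is_derive_Rmult; [apply Hf, Hx|auto_derive; [auto|reflexivity]]. }
    replace (S (2 * q + 1)) with (2 * q + 2)%nat by lia. replace (S (2 * q)) with (2 * q + 1)%nat by lia.
    replace (2 * S q)%nat with (2 * q + 2)%nat by lia.
    assert (E1 : om ^ (2 * q + 1) = om ^ (2 * q) * om) by (rewrite pow_add, pow_1; reflexivity).
    assert (E2 : om ^ (2 * q + 2) = om ^ (2 * q) * om * om) by (rewrite pow_add; ring).
    assert (E3 : om ^ (2 * q) <> 0) by (apply pow_nonzero; lra).
    change (q + (q + 0) + 2)%nat with (2 * q + 2)%nat. change (q + (q + 0) + 1)%nat with (2 * q + 1)%nat.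
    rewrite E1, E2. change ((-1) ^ S q) with (-1 * (-1) ^ q).
    unfold minus, plus, opp; cbn -[Nat.mul Nat.add pow]. field. split; [lra|exact E3].
Qed.

Lemma ibp_RInt (q : nat) (f : nat -> R -> R) (a b : R) : ladder f -> 0 < a <= b ->
  RInt (fun x => f 0%nat x * sin (om * x)) a b =
  ibp q f b - ibp q f a + (-1) ^ q / om ^ (2 * q) * RInt (fun x => f (2 * q)%nat x * sin (om * x)) a b.
Proof.
  intros Hf Hab.
  assert (Hc : forall n x, a <= x <= b -> continuous (fun x => f n x * sin (om * x)) x).
  { intros n x Hx. apply continuous_Rmult; [apply ladder_continuous; auto; lra|by_derive]. }
  assert (E := RInt_derive_le (ibp q f) (fun x => f 0%nat x * sin (om * x)
     - (-1) ^ q / om ^ (2 * q) * (f (2 * q)%nat x * sin (om * x))) a b ltac:(lra)).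
  rewrite <- E.
  - rewrite RInt_Rminus, RInt_Rscal; auto; try lra.
    intros. apply continuous_Rmult; auto using continuous_Rconst.
  - intros. apply ibp_derive; auto. lra.
  - intros. apply continuous_Rminus; auto. apply continuous_Rmult; auto using continuous_Rconst.
Qed.

Fixpoint ibp_cos (q : nat) (v : nat -> R) : R :=
  match q with
  | O => 0
  | S q => ibp_cos q v - (-1) ^ q * / om ^ (2 * q + 1) * v (2 * q)%nat
  end.

Lemma ibp_cos_spec (q : nat) (f : nat -> R -> R) (x : R) : sin (om * x) = 0 -> cos (om * x) = 1 ->
  ibp q f x = ibp_cos q (fun n => f n x).
Proof.
  intros Hs Hc. induction q as [|q IH]; cbn [ibp ibp_cos]; [reflexivity|]. rewrite IH, Hs, Hc. ring.
Qed.

Lemma ibp_cos_minus (q : nat) (v w : nat -> R) :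
  ibp_cos q (fun n => v n - w n) = ibp_cos q v - ibp_cos q w.
Proof. induction q as [|q IH]; cbn [ibp_cos]; [ring|]. rewrite IH. ring. Qed.

Lemma ibp_cos_ext (q : nat) (v w : nat -> R) : (forall n, v n = w n) -> ibp_cos q v = ibp_cos q w.
Proof. intros H. induction q as [|q IH]; cbn [ibp_cos]; [reflexivity|]. now rewrite IH, H. Qed.

Lemma ibp_cos_lim (q : nat) (v : nat -> nat -> R) : (forall n, is_lim_seq (v n) 0) ->
  is_lim_seq (fun K => ibp_cos q (fun n => v n K)) 0.
Proof.
  intros H. induction q as [|q IH]; cbn [ibp_cos]; [apply is_lim_seq_const|].
  replace (Finite 0) with (Finite (0 - (-1) ^ q * / om ^ (2 * q + 1) * 0)) by (f_equal; ring).
  apply is_lim_seq_minus'; [exact IH|]. apply (is_lim_seq_scal_l _ _ (Finite 0)). apply H.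
Qed.

End IntegrationByParts.

Lemma RInt_shift (g : R -> R) (K : nat) : (forall t, INR K <= t <= INR K + 1 -> continuous g t) ->
  RInt (fun t => g (INR K + t)) 0 1 = RInt g (INR K) (INR K + 1).
Proof.
  intros Hg. assert (H := RInt_comp_lin (V := R_CompleteNormedModule) g 1 (INR K) 0 1).
  replace (1 * 0 + INR K) with (INR K) in H by ring. replace (1 * 1 + INR K) with (INR K + 1) in H by ring.
  rewrite <- H.
  - apply RInt_ext_le; [lra|]. intros t _. unfold scal; simpl; unfold mult; simpl.
    rewrite !Rmult_1_l. f_equal. ring.
  - apply ex_RInt_cont; [lra|exact Hg].
Qed.

Lemma lim_inv_INR (C : R) : is_lim_seq (fun K => C / INR K) 0.
Proof.
  replace (Finite 0) with (Rbar_mult C 0) by (simpl; f_equal; ring).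
  apply is_lim_seq_scal_l. replace (Finite 0) with (Rbar_inv p_infty) by reflexivity.
  apply is_lim_seq_inv; [apply is_lim_seq_INR|discriminate].
Qed.

Lemma lim_of_bound (w : nat -> R) (C l : R) : (forall K, (0 < K)%nat -> Rabs (w K - l) <= C / INR K) ->
  is_lim_seq w l.
Proof.
  intros H. assert (L : is_lim_seq (fun K => w K - l) 0).
  { apply is_lim_seq_abs_0. apply (is_lim_seq_le_le_loc (fun _ => 0) (fun K => Rabs (w K - l)) (fun K => C / INR K)).
    - exists 1%nat. intros K HK. split; [apply Rabs_pos|apply H; lia].
    - apply is_lim_seq_const.
    - apply lim_inv_INR. }
  assert (L2 := is_lim_seq_plus' _ _ _ _ L (is_lim_seq_const l)). rewrite Rplus_0_l in L2.
  eapply is_lim_seq_ext; [|exact L2]. intros K. cbv beta. ring.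
Qed.

Section SineCoefficients.
Variables m n : nat.
Hypothesis Hm : (0 < m)%nat.
Hypothesis Hn : (0 < n)%nat.

Let om : R := 2 * PI * INR n.
Let p : nat := (2 * m + 2)%nat.
Let f : nat -> R -> R := rf m.
Let c : R := - INR (fact (2 * m - 1)).

Lemma om_pos : 0 < om.
Proof.
  unfold om. pose proof PI_RGT_0. assert (1 <= INR n) by (apply (le_INR 1); lia). nra.
Qed.

Lemma sin_om_INR (K : nat) (t : R) : sin (om * (INR K + t)) = sin (om * t).
Proof.
  unfold om. replace (2 * PI * INR n * (INR K + t)) with (2 * PI * INR n * t + 2 * PI * INR (n * K))
    by (rewrite mult_INR; ring).
  apply sin_add_multiple_2PI.
Qed.

Lemma om_INR (K : nat) : sin (om * INR K) = 0 /\ cos (om * INR K) = 1.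
Proof.
  pose proof (sin_om_INR K 0) as H. rewrite Rmult_0_r, sin_0, Rplus_0_r in H.
  split; [exact H|]. unfold om.
  replace (2 * PI * INR n * INR K) with (0 + 2 * INR (n * K) * PI) by (rewrite mult_INR; ring).
  rewrite cos_period. apply cos_0.
Qed.

Lemma ladder_f1 : ladder (fun i => f (1 + i)).
Proof. apply ladder_shift, ladder_rf; exact Hm. Qed.

Let em (i : nat) (x : R) : R := em_sum p (fun j => f (i + j)) x.

Lemma ladder_em : ladder em.
Proof.
  intros i x Hx. unfold em.
  replace (em_sum p (fun j => f (S i + j)) x) with (em_sum p (fun j => f (i + S j)) x).
  - apply (em_sum_derive p (fun j => f (i + j))); [|exact Hx]. apply ladder_shift, ladder_rf; exact Hm.
  - unfold em_sum. apply (sum_n_ext (G := R_AbelianMonoid)). intros j. now rewrite Nat.add_succ_r.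
Qed.

Lemma continuous_f1_sin (x : R) : continuous (fun x => f 1 x * sin (om * x)) x.
Proof. apply continuous_Rmult; [apply continuous_rf_1; exact Hm|by_derive]. Qed.

Lemma sine_partial_split (K : nat) : (0 < K)%nat ->
  RInt (fun t => rz_partial f p K t * sin (om * t)) 0 1 =
  RInt (fun x => f 1 x * sin (om * x)) 0 (INR K)
  - RInt (fun x => em 0 x * sin (om * x)) (INR K) (INR K + 1).
Proof.
  intros HK. assert (HK1 : 1 <= INR K) by (apply (le_INR 1); lia).
  assert (Hem : forall t, 0 < t -> continuous (fun x => em 0 x * sin (om * x)) t).
  { intros t Ht. apply continuous_Rmult; [apply ladder_continuous; [apply ladder_em|exact Ht]|by_derive]. }
  assert (Hsh : forall k t, continuous (fun t => f 1 (INR k + t) * sin (om * (INR k + t))) t).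
  { intros k t. apply (continuous_shift (fun x => f 1 x * sin (om * x))). apply continuous_f1_sin. }
  assert (Hrs : forall J t, continuous (fun t => rsum (fun k => f 1 (INR k + t) * sin (om * (INR k + t))) J) t).
  { intros J t. apply (continuous_rsum (fun k t => f 1 (INR k + t) * sin (om * (INR k + t)))). intros; apply Hsh. }
  rewrite (RInt_ext_le _ (fun t => rsum (fun k => f 1 (INR k + t) * sin (om * (INR k + t))) K
     - em 0 (INR K + t) * sin (om * (INR K + t)))).
  - rewrite RInt_Rminus; [|lra|auto|].
    + f_equal.
      * clear HK HK1. induction K as [|K IH]; cbn [rsum].
        -- rewrite RInt_Rconst. simpl (INR 0). rewrite (RInt_point (V := R_CompleteNormedModule)).
           unfold zero; simpl. ring.
        -- rewrite RInt_Rplus by (auto || lra). rewrite IH.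
           rewrite (RInt_shift (fun x => f 1 x * sin (om * x))) by (intros; apply continuous_f1_sin).
           rewrite S_INR. apply (RInt_Chasles (V := R_CompleteNormedModule));
             apply (ex_RInt_continuous (V := R_CompleteNormedModule)); intros; apply continuous_f1_sin.
      * apply (RInt_shift (fun x => em 0 x * sin (om * x))). intros; apply Hem. lra.
    + intros t Ht. apply (continuous_shift (fun x => em 0 x * sin (om * x))). apply Hem. lra.
  - lra.
  - intros t _. unfold rz_partial. rewrite Rmult_minus_distr_r. f_equal.
    + clear HK HK1. induction K as [|K IH]; cbn [rsum]; [ring|]. rewrite <- IH, sin_om_INR. ring.
    + rewrite sin_om_INR. reflexivity.
Qed.

Lemma ibp_small (q : nat) : (q <= m)%nat -> exists C, 0 <= C /\ forall x, 0 < x < 1 ->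
  Rabs (ibp om q (fun i => f (1 + i)) x) <= C * sqrt x.
Proof.
  pose proof om_pos as Hom.
  induction q as [|q IH]; intros Hq; cbn [ibp].
  - exists 0. split; [lra|]. intros. rewrite Rabs_R0, Rmult_0_l. lra.
  - destruct (IH ltac:(lia)) as [C [HC HB]].
    set (c1 := Rabs (rG m (1 + (2 * q + 1))) + 2 * Rabs (rF m (1 + (2 * q + 1)))).
    set (c2 := Rabs (rG m (1 + 2 * q)) + 2 * Rabs (rF m (1 + 2 * q))).
    assert (P1 : 0 < / om ^ (2 * q + 2)) by (apply Rinv_0_lt_compat, pow_lt, Hom).
    assert (P2 : 0 < / om ^ (2 * q + 1)) by (apply Rinv_0_lt_compat, pow_lt, Hom).
    assert (Hc1 : 0 <= c1) by (unfold c1; pose proof (Rabs_pos (rG m (1 + (2 * q + 1)))); pose proof (Rabs_pos (rF m (1 + (2 * q + 1)))); lra).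
    assert (Hc2 : 0 <= c2) by (unfold c2; pose proof (Rabs_pos (rG m (1 + 2 * q))); pose proof (Rabs_pos (rF m (1 + 2 * q))); lra).
    exists (C + (c1 * om * / om ^ (2 * q + 2) + c2 * / om ^ (2 * q + 1))).
    split.
    { assert (0 <= c1 * om * / om ^ (2 * q + 2)) by (apply Rmult_le_pos; [apply Rmult_le_pos|]; lra).
      assert (0 <= c2 * / om ^ (2 * q + 1)) by (apply Rmult_le_pos; lra). lra. }
    intros x Hx. eapply Rle_trans; [apply Rabs_triang|]. specialize (HB x Hx).
    rewrite Rabs_mult, pow_1_abs, Rmult_1_l.
    unfold Rminus. eapply Rle_trans; [apply Rplus_le_compat_l, Rabs_triang|].
    rewrite Rabs_Ropp, !Rabs_mult, (Rabs_pos_eq (/ om ^ (2 * q + 2))), (Rabs_pos_eq (/ om ^ (2 * q + 1))) by lra.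
    assert (B2 : Rabs (f (1 + 2 * q) x) <= c2 * sqrt x) by (apply rf_small; lia || lra).
    assert (B1 : Rabs (f (1 + (2 * q + 1)) x) * x <= c1 * sqrt x).
    { rewrite <- (Rabs_pos_eq x) at 2 by lra. rewrite <- Rabs_mult. apply rf_small_mult; lia || lra. }
    assert (Bs : Rabs (sin (om * x)) <= om * x).
    { eapply Rle_trans; [apply Rabs_sin_le|]. rewrite Rabs_pos_eq; nra. }
    assert (Bc : Rabs (cos (om * x)) <= 1) by (apply Rabs_le; pose proof (COS_bound (om * x)); lra).
    assert (T1 : Rabs (f (1 + (2 * q + 1)) x) * (Rabs (sin (om * x)) * / om ^ (2 * q + 2))
        <= c1 * om * / om ^ (2 * q + 2) * sqrt x).
    { apply Rle_trans with ((Rabs (f (1 + (2 * q + 1)) x) * x) * (om * / om ^ (2 * q + 2))).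
      - replace (Rabs (f (1 + (2 * q + 1)) x) * x * (om * / om ^ (2 * q + 2))) with
          (Rabs (f (1 + (2 * q + 1)) x) * ((om * x) * / om ^ (2 * q + 2))) by ring.
        apply Rmult_le_compat_l; [apply Rabs_pos|]. apply Rmult_le_compat_r; lra.
      - replace (c1 * om * / om ^ (2 * q + 2) * sqrt x) with (c1 * sqrt x * (om * / om ^ (2 * q + 2))) by ring.
        apply Rmult_le_compat_r; [|exact B1]. apply Rmult_le_pos; lra. }
    assert (T2 : Rabs (f (1 + 2 * q) x) * (Rabs (cos (om * x)) * / om ^ (2 * q + 1))
        <= c2 * / om ^ (2 * q + 1) * sqrt x).
    { replace (c2 * / om ^ (2 * q + 1) * sqrt x) with (c2 * sqrt x * (1 * / om ^ (2 * q + 1))) by ring.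
      apply Rmult_le_compat; [apply Rabs_pos| |exact B2|].
      - apply Rmult_le_pos; [apply Rabs_pos|lra].
      - apply Rmult_le_compat_r; lra. }
    lra.
Qed.

Lemma sine_head (K : nat) : (0 < K)%nat ->
  RInt (fun x => f 1 x * sin (om * x)) 0 (INR K) =
  ibp om m (fun i => f (1 + i)) (INR K)
  + (-1) ^ m / om ^ (2 * m) * (c * RInt sinc 0 (om * INR K)).
Proof.
  intros HK. assert (HK1 : 1 <= INR K) by (apply (le_INR 1); lia). pose proof om_pos as Hom.
  set (A := (-1) ^ m / om ^ (2 * m)).
  set (G := fun x => f 1 x * sin (om * x) - A * (c * (om * sinc (om * x + 0)))).
  assert (Csi : forall x, continuous (fun x => om * sinc (om * x + 0)) x).
  { intros x. apply continuous_Rmult; [apply continuous_Rconst|].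
    apply (continuous_comp (fun t => om * t + 0) sinc); [by_derive|apply continuous_sinc]. }
  assert (CG : forall x, continuous G x).
  { intros x. unfold G. apply continuous_Rminus; [apply continuous_f1_sin|].
    apply continuous_Rmult; [apply continuous_Rconst|]. apply continuous_Rmult; [apply continuous_Rconst|auto]. }
  assert (EG : RInt G 0 (INR K) = RInt (fun x => f 1 x * sin (om * x)) 0 (INR K) - A * (c * RInt sinc 0 (om * INR K))).
  { unfold G. rewrite RInt_Rminus; [|lra|intros; apply continuous_f1_sin|].
    - rewrite RInt_Rscal; [|lra|intros; apply continuous_Rmult; [apply continuous_Rconst|auto]].
      rewrite RInt_Rscal by (auto || lra). rewrite RInt_affine by apply continuous_sinc.
      rewrite Rmult_0_r, !Rplus_0_r. reflexivity.
    - intros. apply continuous_Rmult; [apply continuous_Rconst|]. apply continuous_Rmult; [apply continuous_Rconst|auto]. }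
  set (U := ibp om m (fun i => f (1 + i))).
  assert (HUG : forall e, 0 < e <= INR K -> RInt G e (INR K) = U (INR K) - U e).
  { intros e He. apply (RInt_derive_le U G).
    - lra.
    - intros x Hx. eapply is_derive_eq; [|apply ibp_derive; [exact Hom|apply ladder_f1|lra]].
      unfold G, A. cbv beta. simpl (1 + 0)%nat. rewrite Rplus_0_r.
      replace (f (1 + 2 * m) x * sin (om * x)) with (c * (om * sinc (om * x))); [reflexivity|].
      rewrite <- sinc_mult. rewrite Nat.add_comm. unfold f. rewrite rf_pole by (exact Hm || lra).
      unfold c. field. lra.
    - intros; apply CG. }
  assert (E : RInt G 0 (INR K) = U (INR K)).
  { destruct (ibp_small m (le_n m)) as [C [HC HB]].
    assert (Hd : forall e, 0 < e -> Rabs (RInt G 0 (INR K) - U (INR K)) <= 0 + e).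
    { intros e He.
      assert (Cp : continuous (fun y => RInt G 0 y) 0).
      { apply continuous_of_derivable. eexists. apply RInt_primitive. exact CG. }
      destruct (continuous_eps_inv _ _ Cp (e / 2)) as [d [Hd Hy]]; [lra|].
      rewrite (RInt_point (V := R_CompleteNormedModule)) in Hy.
      set (r := e / 2 / (C + 1)).
      assert (Hr : 0 < r) by (unfold r; apply Rdiv_lt_0_compat; lra).
      assert (Hrr : 0 < r * r) by nra.
      set (y := Rmin (d / 2) (Rmin (/ 2) (r * r))).
      assert (Y : y <= d / 2 /\ y <= / 2 /\ y <= r * r).
      { unfold y. pose proof (Rmin_l (d / 2) (Rmin (/ 2) (r * r))).
        pose proof (Rmin_r (d / 2) (Rmin (/ 2) (r * r))).
        pose proof (Rmin_l (/ 2) (r * r)). pose proof (Rmin_r (/ 2) (r * r)). lra. }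
      assert (Y0 : 0 < y) by (unfold y; repeat apply Rmin_pos; lra).
      specialize (Hy y). rewrite Rminus_0_r, Rabs_pos_eq in Hy by lra.
      specialize (Hy ltac:(lra)). change (Rabs (RInt G 0 y - 0) < e / 2) in Hy. rewrite Rminus_0_r in Hy.
      specialize (HB y ltac:(lra)).
      assert (Hsq : sqrt y <= r).
      { rewrite <- (sqrt_square r) by lra. apply sqrt_le_1_alt. lra. }
      assert (HCr : C * sqrt y <= e / 2).
      { apply Rle_trans with (C * r); [apply Rmult_le_compat_l; lra|].
        assert ((C + 1) * r = e / 2) by (unfold r; field; lra). nra. }
      assert (EC : RInt G 0 (INR K) = RInt G 0 y + RInt G y (INR K)).
      { symmetry. apply (RInt_Chasles (V := R_CompleteNormedModule));
          apply (ex_RInt_continuous (V := R_CompleteNormedModule)); auto. }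
      rewrite EC, HUG by lra.
      replace (RInt G 0 y + (U (INR K) - U y) - U (INR K)) with (RInt G 0 y - U y) by ring.
      unfold Rminus. eapply Rle_trans; [apply Rabs_triang|]. rewrite Rabs_Ropp.
      fold U in HB. lra. }
    apply le_epsilon in Hd. pose proof (Rabs_pos (RInt G 0 (INR K) - U (INR K))).
    destruct (Req_dec_T (RInt G 0 (INR K) - U (INR K)) 0) as [Hz|Hz]; [lra|].
    apply Rabs_pos_lt in Hz. lra. }
  rewrite EG in E. fold U. lra.
Qed.

Lemma em_2m_decay : exists C, 0 <= C /\ forall x, 1 <= x -> Rabs (em (2 * m + 1) x) <= C / x.
Proof.
  unfold em, em_sum.
  assert (H : forall q, exists C, 0 <= C /\ forall x, 1 <= x ->
    Rabs (sum_n (fun j => beta j * f (2 * m + 1 + j) x) q) <= C / x).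
  { induction q as [|q [C [HC HB]]].
    - destruct (rf_decay m Hm 1 (2 * m + 1 + 0)) as [M [HM HM1]]; [lia|lia|].
      exists (Rabs (beta 0) * M). split; [apply Rmult_le_pos; [apply Rabs_pos|exact HM]|].
      intros x Hx. rewrite sum_O, Rabs_mult. unfold Rdiv. rewrite Rmult_assoc.
      apply Rmult_le_compat_l; [apply Rabs_pos|]. specialize (HM1 x ltac:(lra)). rewrite pow_1 in HM1. exact HM1.
    - destruct (rf_decay m Hm 1 (2 * m + 1 + S q)) as [M [HM HM1]]; [lia|lia|].
      exists (C + Rabs (beta (S q)) * M). split.
      { assert (0 <= Rabs (beta (S q)) * M) by (apply Rmult_le_pos; [apply Rabs_pos|exact HM]). lra. }
      intros x Hx. rewrite sum_n_SR. eapply Rle_trans; [apply Rabs_triang|].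
      specialize (HB x Hx). specialize (HM1 x ltac:(lra)). rewrite pow_1 in HM1.
      rewrite Rabs_mult. unfold Rdiv in *. rewrite Rmult_plus_distr_r, Rmult_assoc.
      apply Rplus_le_compat; [exact HB|]. apply Rmult_le_compat_l; [apply Rabs_pos|exact HM1]. }
  apply H.
Qed.

Lemma em_tail_lim :
  is_lim_seq (fun K => RInt (fun x => em (2 * m) x * sin (om * x)) (INR K) (INR K + 1)) 0.
Proof.
  destruct em_2m_decay as [C [HC HB]]. pose proof om_pos as Hom.
  apply (lim_of_bound _ C). intros K HK. rewrite Rminus_0_r.
  assert (HK1 : 1 <= INR K) by (apply (le_INR 1); lia).
  assert (Hem : forall x, INR K <= x <= INR K + 1 -> continuous (em (2 * m)) x)
    by (intros; apply ladder_continuous; [apply ladder_em|lra]).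
  assert (Hsin : forall x, continuous (fun x => sin (om * x)) x) by by_derive.
  assert (Hz : RInt (fun x => sin (om * x)) (INR K) (INR K + 1) = 0).
  { rewrite (RInt_derive_le (fun x => - cos (om * x) / om)); [|lra| |intros; auto].
    - rewrite <- S_INR. destruct (om_INR K) as [_ ->]. destruct (om_INR (S K)) as [_ ->]. apply Rminus_diag.
    - intros x _. auto_derive; auto. field. lra. }
  assert (E : RInt (fun x => em (2 * m) x * sin (om * x)) (INR K) (INR K + 1)
    = RInt (fun x => (em (2 * m) x - em (2 * m) (INR K)) * sin (om * x)) (INR K) (INR K + 1)).
  { rewrite (RInt_ext_le (fun x => (em (2 * m) x - em (2 * m) (INR K)) * sin (om * x))
      (fun x => em (2 * m) x * sin (om * x) - em (2 * m) (INR K) * sin (om * x))) by (intros; lra || ring).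
    rewrite RInt_Rminus, RInt_Rscal, Hz; [rewrite Rmult_0_r, Rminus_0_r; reflexivity|lra|auto|lra| |].
    - intros; apply continuous_Rmult; auto.
    - intros; apply continuous_Rmult; auto using continuous_Rconst. }
  rewrite E. replace (C / INR K) with ((INR K + 1 - INR K) * (C / INR K)) by ring.
  apply abs_RInt_le_const; [lra| |].
  - apply ex_RInt_cont; [lra|]. intros. apply continuous_Rmult; auto.
    apply continuous_Rminus; auto using continuous_Rconst.
  - intros x Hx. rewrite Rabs_mult.
    assert (Hs : Rabs (sin (om * x)) <= 1) by (apply Rabs_le; pose proof (SIN_bound (om * x)); lra).
    assert (Hd : Rabs (em (2 * m) x - em (2 * m) (INR K)) <= C / INR K).
    { destruct (MVT_gen (em (2 * m)) (INR K) x (em (2 * m + 1))) as [y [Hy Ey]].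
      - rewrite Rmin_left, Rmax_right by lra. intros y Hy. rewrite Nat.add_1_r. apply ladder_em. lra.
      - rewrite Rmin_left, Rmax_right by lra. intros y Hy. apply continuity_pt_filterlim, Hem. lra.
      - rewrite Rmin_left, Rmax_right in Hy by lra. rewrite Ey, Rabs_mult, (Rabs_pos_eq (x - INR K)) by lra.
        specialize (HB y ltac:(lra)).
        assert (C / y <= C / INR K) by (unfold Rdiv; apply Rmult_le_compat_l; [exact HC|]; apply Rinv_le_contravar; lra).
        pose proof (Rabs_pos (em (2 * m + 1) y)). nra. }
    pose proof (Rabs_pos (em (2 * m) x - em (2 * m) (INR K))).
    pose proof (Rabs_pos (sin (om * x))). nra.
Qed.

Lemma sine_partial_lim :
  is_lim_seq (fun K => RInt (fun t => rz_partial f p K t * sin (om * t)) 0 1)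
    ((-1) ^ m / om ^ (2 * m) * (c * (PI / 2))).
Proof.
  pose proof om_pos as Hom. set (A := (-1) ^ m / om ^ (2 * m)).
  assert (L : is_lim_seq (fun K => ibp_cos om m (fun i => em_rem p (fun j => f (i + j)) (INR K))
     + A * (c * RInt sinc 0 (om * INR K)
            - RInt (fun x => em (2 * m) x * sin (om * x)) (INR K) (INR K + 1)))
     (0 + A * (c * (PI / 2) - 0))).
  { apply is_lim_seq_plus'.
    - apply (ibp_cos_lim om m (fun i K => em_rem p (fun j => f (i + j)) (INR K))).
      intros i. destruct (em_rem_rf_decay m Hm i) as [M [HM HB]].
      apply (lim_of_bound _ M). intros K HK. rewrite Rminus_0_r.
      assert (HK1 : 1 <= INR K) by (apply (le_INR 1); lia).
      eapply Rle_trans; [apply HB; lra|]. unfold Rdiv. apply Rmult_le_compat_l; [exact HM|].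
      apply Rinv_le_contravar; nra.
    - apply (is_lim_seq_scal_l _ A (Finite (c * (PI / 2) - 0))).
      apply is_lim_seq_minus'; [|apply em_tail_lim].
      apply (is_lim_seq_scal_l _ c (Finite (PI / 2))). apply RInt_sinc_lim. exact Hn. }
  rewrite Rplus_0_l, Rminus_0_r in L.
  eapply is_lim_seq_ext_loc; [|exact L]. exists 1%nat. intros K HK.
  assert (HK1 : 1 <= INR K) by (apply (le_INR 1); lia).
  rewrite sine_partial_split, sine_head by lia. fold A.
  rewrite (ibp_RInt om Hom m em) by (apply ladder_em || lra). fold A.
  rewrite <- S_INR. destruct (om_INR K) as [S1 C1]. destruct (om_INR (S K)) as [S2 C2].
  rewrite !ibp_cos_spec by assumption.
  rewrite (ibp_cos_ext om m (fun i => em_rem p (fun j => f (i + j)) (INR K))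
    (fun i => f (1 + i)%nat (INR K) - (em i (INR (S K)) - em i (INR K)))).
  - rewrite !ibp_cos_minus. ring.
  - intros i. unfold em_rem, em. rewrite S_INR. rewrite (Nat.add_comm 1 i). reflexivity.
Qed.

Theorem sine_coefficient :
  RInt (fun t => rz m 0 t * sin (om * t)) 0 1 = (-1) ^ m / om ^ (2 * m) * (c * (PI / 2)).
Proof.
  destruct (rz_spec m Hm 0) as [M HM].
  assert (Hc : forall K t, (0 < K)%nat -> 0 <= t <= 1 -> continuous (fun t => rz_partial f p K t * sin (om * t)) t).
  { intros K t HK Ht. apply continuous_Rmult; [|by_derive]. apply continuous_rz_partial; [exact Hm|].
    assert (1 <= INR K) by (apply (le_INR 1); lia). lra. }
  assert (Hz : forall t, 0 <= t <= 1 -> continuous (fun t => rz m 0 t * sin (om * t)) t).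
  { intros t Ht. apply continuous_Rmult; [|by_derive]. now apply continuous_rz. }
  assert (L : is_lim_seq (fun K => RInt (fun t => rz_partial f p K t * sin (om * t)) 0 1)
     (RInt (fun t => rz m 0 t * sin (om * t)) 0 1)).
  { apply (lim_of_bound _ M). intros K HK. rewrite <- RInt_Rminus by (auto || lra).
    replace (M / INR K) with ((1 - 0) * (M / INR K)) by ring.
    apply abs_RInt_le_const; [lra| |].
    - apply ex_RInt_cont; [lra|]. intros. apply continuous_Rminus; auto.
    - intros t Ht. rewrite <- Rmult_minus_distr_r, Rabs_mult.
      destruct (HM t ltac:(lra)) as [_ HB]. specialize (HB K ltac:(lia)).
      assert (Hs : Rabs (sin (om * t)) <= 1) by (apply Rabs_le; pose proof (SIN_bound (om * t)); lra).
      change (Rabs (rz_partial f p K t - rz m 0 t) <= M / INR K) in HB.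
      pose proof (Rabs_pos (rz_partial f p K t - rz m 0 t)). pose proof (Rabs_pos (sin (om * t))). nra. }
  apply is_lim_seq_unique in L. pose proof (is_lim_seq_unique _ _ sine_partial_lim) as L'.
  rewrite L in L'. now injection L'.
Qed.

End SineCoefficients.

(** * The sine series *)

Definition clausen_partial (m : nat) (x : R) (N : nat) : R :=
  rsum (fun k => sin (INR (S k) * x) / INR (S k) ^ (2 * m)) N.

Definition clausen_factor (m : nat) : R :=
  (-1) ^ m * (2 * PI) * INR (fact (2 * m - 1)) / (2 * PI) ^ (2 * m).

Lemma dirichlet_kernel_reflect (N : nat) (a t : R) :
  dirichlet_kernel N (t - (1 - a)) - dirichlet_kernel N (t - a)
  = rsum (fun k => -4 * sin (INR (S k) * (2 * PI * a)) * sin (2 * PI * INR (S k) * t)) N.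
Proof.
  induction N as [|N IH]; cbn [dirichlet_kernel rsum]; [ring|]. rewrite <- IH.
  set (k := S N).
  assert (E1 : cos (2 * PI * INR k * (t - (1 - a))) = cos (2 * PI * INR k * t + INR k * (2 * PI * a))).
  { rewrite <- (cos_period (2 * PI * INR k * (t - (1 - a))) k). f_equal. ring. }
  rewrite E1, cos_plus.
  replace (2 * PI * INR k * (t - a)) with (2 * PI * INR k * t - INR k * (2 * PI * a)) by ring.
  rewrite cos_minus. ring.
Qed.

Lemma RInt_rsum (g : R -> R) (h : nat -> R -> R) (c : nat -> R) (N : nat) :
  (forall t, 0 <= t <= 1 -> continuous g t) -> (forall k t, continuous (h k) t) ->
  RInt (fun t => g t * rsum (fun k => c k * h k t) N) 0 1
  = rsum (fun k => c k * RInt (fun t => g t * h k t) 0 1) N.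
Proof.
  intros Hg Hh. induction N as [|N IH]; cbn [rsum].
  - rewrite (RInt_ext_le _ (fun _ => 0)) by (intros; lra || ring). rewrite RInt_Rconst. apply Rmult_0_r.
  - rewrite <- IH. rewrite (RInt_ext_le _ (fun t => g t * rsum (fun k => c k * h k t) N + c N * (g t * h N t)))
      by (intros; lra || ring).
    assert (Hs : forall t, continuous (fun t => rsum (fun k => c k * h k t) N) t).
    { intros t. apply (continuous_rsum (fun k t => c k * h k t)). intros.
      apply continuous_Rmult; [apply continuous_Rconst|auto]. }
    rewrite RInt_Rplus, RInt_Rscal; try lra; intros; repeat apply continuous_Rmult; auto using continuous_Rconst.
Qed.

Lemma rsum_ext (f g : nat -> R) (N : nat) : (forall k, f k = g k) -> rsum f N = rsum g N.
Proof. intros H. induction N as [|N IH]; cbn [rsum]; [reflexivity|]. now rewrite IH, H. Qed.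

Lemma rsum_scal (c : R) (f : nat -> R) (N : nat) : rsum (fun k => c * f k) N = c * rsum f N.
Proof. induction N as [|N IH]; cbn [rsum]; [ring|]. rewrite IH. ring. Qed.

Theorem clausen_hurwitz (m : nat) (a : R) : (0 < m)%nat -> 0 < a < 1 ->
  is_lim_seq (fun N => clausen_factor m * clausen_partial m (2 * PI * a) N) (rz m 0 (1 - a) - rz m 0 a).
Proof.
  intros Hm Ha. pose proof PI_RGT_0 as HPI.
  assert (Hc : forall t, 0 <= t <= 0 + 1 -> continuous (rz m 0) t) by (intros; apply continuous_rz; [exact Hm|lra]).
  assert (L1 := fourier_pointwise (rz m 0) 0 (1 - a) ltac:(lra) Hc (ex_derive_rz m Hm (1 - a) ltac:(lra))).
  assert (L2 := fourier_pointwise (rz m 0) 0 a ltac:(lra) Hc (ex_derive_rz m Hm a Ha)).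
  assert (L := is_lim_seq_minus' _ _ _ _ L1 L2).
  eapply is_lim_seq_ext; [|exact L]. intros N. cbv beta. rewrite Rplus_0_l in *.
  rewrite <- RInt_Rminus; [|lra| |]; try (intros; apply continuous_Rmult; [auto|apply continuous_dirichlet_kernel]).
  rewrite (RInt_ext_le _ (fun t => rz m 0 t *
    rsum (fun k => -4 * sin (INR (S k) * (2 * PI * a)) * sin (2 * PI * INR (S k) * t)) N)).
  - rewrite (RInt_rsum (rz m 0) (fun k t => sin (2 * PI * INR (S k) * t))
      (fun k => -4 * sin (INR (S k) * (2 * PI * a)))) by (auto || by_derive).
    unfold clausen_partial. rewrite <- rsum_scal. apply rsum_ext. intros k.
    rewrite (sine_coefficient m (S k) Hm) by lia.
    assert (Hk : INR (S k) <> 0) by (apply not_0_INR; lia).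
    unfold clausen_factor. rewrite !Rpow_mult_distr. field.
    repeat split; auto using pow_nonzero; apply pow_nonzero; lra.
  - lra.
  - intros t _. rewrite <- dirichlet_kernel_reflect. ring.
Qed.

Lemma clausen_odd (m : nat) (x : R) (N : nat) :
  rsum (fun n => sin (INR (2 * n + 1) * x) / INR (2 * n + 1) ^ (2 * m)) N
  = clausen_partial m x (2 * N) - / 2 ^ (2 * m) * clausen_partial m (2 * x) N.
Proof.
  unfold clausen_partial. induction N as [|N IH]; [simpl; ring|].
  replace (2 * S N)%nat with (S (S (2 * N))) by lia. cbn [rsum]. rewrite IH.
  replace (2 * N + 1)%nat with (S (2 * N)) by lia.
  replace (INR (S (S (2 * N)))) with (2 * INR (S N)) by (rewrite !S_INR, mult_INR, INR_2; ring).
  rewrite Rpow_mult_distr.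
  replace (2 * INR (S N) * x) with (INR (S N) * (2 * x)) by ring.
  field. repeat split; apply pow_nonzero; try (apply not_0_INR; lia). lra.
Qed.

Theorem mainTheorem5 (m : nat) (x : R) :
  (0 < m)%nat -> 0 < x < PI ->
  let s : C := RtoC (1 - 2 * INR m) in
  is_series (K := C_AbsRing) (V := C_NormedModule)
    (fun n : nat => RtoC (sin (INR (2 * n + 1) * x) / INR (2 * n + 1) ^ (2 * m)))
    (RtoC ((-1) ^ m * PI ^ (2 * m - 1) / (2 * INR (Factorial.fact (2 * m - 1)))) *
       (RtoC (2 ^ (2 * m)) * hurwitz_zeta' s (1 - x / (2 * PI))
        - RtoC (2 ^ (2 * m)) * hurwitz_zeta' s (x / (2 * PI))
        - hurwitz_zeta' s (1 - x / PI)
        + hurwitz_zeta' s (x / PI)))%C.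
Proof.
  intros Hm Hx s. pose proof PI_RGT_0 as HPI.
  assert (Hb : 0 < x / PI < 1).
  { split; [apply Rdiv_lt_0_compat; lra|]. apply (Rmult_lt_reg_r PI); [lra|].
    unfold Rdiv. rewrite Rmult_assoc, Rinv_l by lra. lra. }
  set (b := x / PI) in *.
  assert (Ha : x / (2 * PI) = b / 2) by (unfold b; field; lra). rewrite Ha.
  unfold s. rewrite !hurwitz_zeta'_real by (exact Hm || lra).
  rewrite <- !RtoC_mult, <- !RtoC_minus, <- RtoC_plus, <- RtoC_mult.
  assert (L1 := clausen_hurwitz m (b / 2) Hm ltac:(lra)).
  assert (L2 := clausen_hurwitz m b Hm Hb).
  replace (2 * PI * (b / 2)) with x in L1 by (unfold b; field; lra).
  replace (2 * PI * b) with (2 * x) in L2 by (unfold b; field; lra).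
  apply (is_lim_seq_subseq _ _ (fun N => (2 * N)%nat)) in L1; [|apply eventually_subseq; intros; lia].
  set (k := (-1) ^ m * PI ^ (2 * m - 1) / (2 * INR (fact (2 * m - 1)))).
  assert (L3 := is_lim_seq_minus' _ _ _ _ (is_lim_seq_scal_l _ (2 ^ (2 * m)) _ L1) L2).
  apply (is_lim_seq_scal_l _ k) in L3. cbv beta in L3.
  apply climit_is_series.
  apply (climit_ext (fun N => RtoC (rsum (fun n => sin (INR (2 * n + 1) * x) / INR (2 * n + 1) ^ (2 * m)) N))).
  { intros N. induction N as [|N IH]; cbn [rsum csum]; [reflexivity|]. rewrite RtoC_plus, IH. reflexivity. }
  apply climit_real; unfold Re, Im, RtoC; cbn [fst snd]; [|apply is_lim_seq_const].
  match goal with |- is_lim_seq _ (Finite ?l) => replace l with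
    (k * (2 ^ (2 * m) * (rz m 0 (1 - b / 2) - rz m 0 (b / 2)) - (rz m 0 (1 - b) - rz m 0 b))) by ring end.
  eapply is_lim_seq_ext; [|exact L3]. intros N. cbv beta.
  rewrite clausen_odd.
  assert (Hf : INR (fact (2 * m - 1)) <> 0) by apply INR_fact_neq_0.
  assert (Hs : (-1) ^ m * (-1) ^ m = 1) by (rewrite <- Rpow_mult_distr; replace (-1 * -1) with 1 by ring; apply pow1).
  assert (Hkf : k * clausen_factor m = / 2 ^ (2 * m)).
  { unfold k, clausen_factor. rewrite Rpow_mult_distr.
    replace (PI ^ (2 * m)) with (PI * PI ^ (2 * m - 1)).
    2: { replace (2 * m)%nat with (S (2 * m - 1)) at 2 by lia. reflexivity. }
    transitivity ((-1) ^ m * (-1) ^ m * / 2 ^ (2 * m)); [field|rewrite Hs; ring].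
    repeat split; auto; try (apply pow_nonzero; lra); lra. }
  replace (k * (2 ^ (2 * m) * (clausen_factor m * clausen_partial m x (2 * N))
      - clausen_factor m * clausen_partial m (2 * x) N))
    with (k * clausen_factor m * (2 ^ (2 * m) * clausen_partial m x (2 * N) - clausen_partial m (2 * x) N)) by ring.
  rewrite Hkf. field. apply pow_nonzero. lra.
Qed.
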